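(* Let $(\mathcal{D}\subseteq\mathcal{A},E)$ be a $\mathcal{D}$-valued probability space and let $a\in\mathcal{A}$. Then the following conditions are equivalent (and $a$ is called $R$-diagonal with amalgamation over $\mathcal{D}$ if they hold). (1) Define $$P_{11}=\operatorname{span}\{\mathcal{D}a^\star\mathcal{D},\ \mathcal{D}a^\star\mathcal{D}a\mathcal{D}a^\star\mathcal{D},\ \mathcal{D}a^\star\mathcal{D}a\mathcal{D}a^\star\mathcal{D}a\mathcal{D}a^\star\mathcal{D},\dots\},$$ $$P_{12}=\{x\in\operatorname{span}\{\mathcal{D},\ \mathcal{D}a^\star\mathcal{D}a\mathcal{D},\ \mathcal{D}a^\star\mathcal{D}a\mathcal{D}a^\star\mathcal{D}a\mathcal{D},\dots\}:E(x)=0\},$$ $$P_{21}=\{x\in\operatorname{span}\{\mathcal{D},\ \mathcal{D}a\mathcal{D}a^\star\mathcal{D},\ \mathcal{D}a\mathcal{D}a^\star\mathcal{D}a\mathcal{D}a^\star\mathcal{D},\dots\}:E(x)=0\},$$ $$P_{22}=\operatorname{span}\{\mathcal{D}a\mathcal{D},\ \mathcal{D}a\mathcal{D}a^\star\mathcal{D}a\mathcal{D},\ \mathcal{D}a\mathcal{D}a^\star\mathcal{D}a\mathcal{D}a^\star\mathcal{D}a\mathcal{D},\dots\}.$$ Then $E(x_1x_2\cdots x_n)=0$ for every $n\ge1$, all $i_1,\dots,i_{n+1}\in\{1,2\}$ and all $x_1\in P_{i_1i_2},\ x_2\in P_{i_2i_3},\dots,x_n\in P_{i_ni_{n+1}}$.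 (2) For all $n\ge1$, $s_1,\dots,s_n\in\{1,\star\}$ and $d_1,\dots,d_n\in\mathcal{D}$, the $\mathcal{D}$-valued noncrossing cumulant $\kappa(d_1a^{s_1}\otimes d_2a^{s_2}\otimes\cdots\otimes d_na^{s_n})$ vanishes whenever $(s_1,\dots,s_n)$ is not alternating, i.e. not of the form $(1,\star,1,\star,\dots,1,\star)$ or $(\star,1,\star,1,\dots,\star,1)$. (3) There exist an enlargement $(\mathcal{D}\subseteq\tilde{\mathcal{A}},\tilde E)$ of $(\mathcal{D}\subseteq\mathcal{A},E)$ and a scalar random variable $u\in\tilde{\mathcal{A}}$ such that: (a) $u$ is unitary; (b) $\{a,a^\star\}$ and $\{u,u^\star\}$ are free with amalgamation over $\mathcal{D}$; (c) $|\tilde E(u)|<1$ (where $\tilde E(u)$, a multiple of the identity, is regarded as a complex number); (d) $a$ and $ua$ are identically $\mathcal{D}$-distributed. (4) For every enlargement $(\mathcal{D}\subseteq\tilde{\mathcal{A}},\tilde E)$ of $(\mathcal{D}\subseteq\mathcal{A},E)$ and every scalar random variable $u\in\tilde{\mathcal{A}}$ such that $u$ is unitary and $\{a,a^\star\}$ and $\{u,u^\star\}$ are free with amalgamation over $\mathcal{D}$, the elements $a$ and $ua$ are identically $\mathcal{D}$-distributed.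
   Context: All algebras are unital over $\mathbb{C}$, all inclusions are unital. A $\mathcal{D}$-valued probability space $(\mathcal{D}\subseteq\mathcal{A},E)$ is a unital $\star$-algebra $\mathcal{A}$, a unital $\star$-subalgebra $\mathcal{D}$ and a conditional expectation $E:\mathcal{A}\to\mathcal{D}$ (linear, $E(I)=I$, $E(d_1xd_2)=d_1E(x)d_2$ for $d_1,d_2\in\mathcal D$). In (1), expressions such as $\mathcal{D}a^\star\mathcal{D}a\mathcal{D}$ denote the set of all products $d_1a^\star d_2ad_3$ with $d_i\in\mathcal{D}$, and span is the linear span of the union of the listed sets. Enlargement: $(\mathcal{D}\subseteq\tilde{\mathcal{A}},\tilde E)$ is an enlargement of $(\mathcal{D}\subseteq\mathcal{A},E)$ if $\mathcal{A}\subseteq\tilde{\mathcal{A}}$ and $\tilde E|_{\mathcal{A}}=E$. Identically $\mathcal{D}$-distributed: $x_1\in(\mathcal{D}\subseteq\mathcal{A}_1,E_1)$ and $x_2\in(\mathcal{D}\subseteq\mathcal{A}_2,E_2)$ are so if $E_1(x_1^{s_1}d_1x_1^{s_2}d_2\cdots d_{n-1}x_1^{s_n})=E_2(x_2^{s_1}d_1x_2^{s_2}d_2\cdots d_{n-1}x_2^{s_n})$ for all $n\ge1$, $s_i\in\{1,\star\}$, $d_i\in\mathcal{D}$. Scalar random variable: $y\in(\mathcal{D}\subseteq\mathcal{A},E)$ is one if $yy^\star=y^\star y$, $y$ and $y^\star$ commute with $\mathcal{D}$, and for all integers $k,l\ge0$, $E(y^k(y^\star)^l)=\alpha_{k,l}I$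 for some $\alpha_{k,l}\in\mathbb{C}$. Freeness with amalgamation: subsets $(X_s)_{s\in S}$ of $\mathcal{A}$ are free with amalgamation over $\mathcal{D}$ if, with $\mathcal{A}_s$ the algebra generated by $X_s\cup\mathcal{D}$, $E(x_1\cdots x_n)=0$ whenever $n\ge1$, $x_j\in\mathcal{A}_{s_j}$, $E(x_j)=0$ for all $j$, and $s_j\ne s_{j+1}$ for all $j<n$. Cumulants: the $\mathcal{D}$-valued noncrossing cumulants are the $\mathcal{D}$-bimodule maps $\kappa:\mathcal{A}^{\otimes_{\mathcal D}n}\to\mathcal{D}$ ($n\ge1$) determined by $E(a_1\cdots a_n)=\sum_{\pi\in NC(\{1,\dots,n\})}\kappa_\pi(a_1\otimes\cdots\otimes a_n)$, where the sum is over noncrossing partitions and $\kappa_\pi$ is the nested product: $\kappa_\pi=\kappa$ if $\pi$ has one block; otherwise choose a block of $\pi$ that is an interval $\{p+1,\dots,p+q\}$, remove it, and multiply $\kappa(a_{p+1}\otimes\cdots\otimes a_{p+q})$ into the right of $a_p$ (equivalently into the left of $a_{p+q+1}$), continuing recursively (e.g. $\kappa_{\{\{1,3\},\{2\}\}}(a_1\otimes a_2\otimes a_3)=\kappa(a_1\otimes\kappa(a_2)a_3)$).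
   Formalization: The conditional expectations (of the given space and of its enlargements) are additionally assumed to satisfy E(x* ) = E(x)*; without this (3) does not imply (1), e.g. D = C, A = C[Z], E(v^n) = 1 for n ≤ 0 and 0 for n > 0, a = v. *)

(* Defs.v *)
From HB Require Import structures.
From mathcomp Require Import all_boot all_order all_algebra.
From mathcomp Require Import complex.
From mathcomp Require Import all_classical all_reals.
From mathcomp Require Import zify.

Set Implicit Arguments.
Unset Strict Implicit.
Unset Printing Implicit Defensive.

Import Order.TTheory GRing.Theory Num.Theory.
Local Open Scope ring_scope.

Definition crossing n (B B' : {set 'I_n}) : bool :=
  [exists i in B, exists j in B', exists k in B, exists l in B',
     [&& i < j, j < k & k < l]%N].

Definition NC n : {set {set {set 'I_n}}} :=
  [set P | finset.partition P [set: 'I_n] &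
     [forall B in P, forall B' in P, (B != B') ==> ~~ crossing B B']].

HB.mixin Record hasStar (C : numClosedFieldType) A of GRing.Algebra C A := {
  star : A -> A;
  starK : forall x, star (star x) = x;
  starD : forall x y, star (x + y) = star x + star y;
  starZ : forall (c : C) x, star (c *: x) = c^* *: star x;
  starM : forall x y, star (x * y) = star y * star x
}.

#[short(type="starAlgType")]
HB.structure Definition StarAlgebra (C : numClosedFieldType) :=
  {A of hasStar C A & GRing.Algebra C A}.

Definition star_morphism (C : numClosedFieldType) (A B : starAlgType C)
    (f : A -> B) :=
  forall x, f (star x) = star (f x).

(* A D-valued probability space.  The inclusion of D into A is a unital
   star-homomorphism [dincl]; it is injective because [cexp] is a left inverse
   of it (see [dinclK]).  A conditional expectation of a star-algebra is
   compatible with the involution: this is automatic for positive maps, and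
   without it |E(u)| < 1 gives no control on E(star u). *)
Record dprobSpace (R : realType) (D : starAlgType R[i]) := DProbSpace {
  dcarrier :> starAlgType R[i];
  dincl : {lrmorphism D -> dcarrier};
  dincl_star : star_morphism dincl;
  cexp : {linear dcarrier -> D};
  cexp1 : cexp 1 = 1;
  cexpM : forall d1 x d2, cexp (dincl d1 * x * dincl d2) = d1 * cexp x * d2;
  cexp_star : star_morphism cexp
}.
Arguments dincl {R D} d.
Arguments cexp {R D} d.

Lemma dinclK (R : realType) (D : starAlgType R[i]) (A : dprobSpace D) :
  cancel (dincl A) (cexp A).
Proof.
move=> d; rewrite -[dincl A d]mulr1 -[_ * 1]mulr1 -(rmorph1 (dincl A)) cexpM.
by rewrite rmorph1 cexp1 !mulr1.
Qed.

(* Exponents in {1, star} are booleans: [true] stands for the star. *)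
Definition spow (C : numClosedFieldType) (A : starAlgType C) (x : A)
    (s : bool) : A :=
  if s then star x else x.

Section Cumulants.
Variables (R : realType) (D : starAlgType R[i]) (A : dprobSpace D).

(* A tensor a_1 (x) ... (x) a_n is represented by the list [:: a_1; ...; a_n].
   While blocks of a partition of 'I_n are being removed, the tensor factors
   that remain are kept together with their original positions, as a list of
   pairs in 'I_n * A. *)
Section Nested.
Variables (kappa : seq A -> D) (n : nat).
Implicit Types (w : seq ('I_n * A)) (B : {set 'I_n}) (P : {set {set 'I_n}}).

Definition is_interval B w : bool := infix (enum B) (unzip1 w).

Definition mulr_head (d : D) w :=
  if w is (i, x) :: w' then (i, dincl A d * x) :: w' else [::].

Definition mulr_last w (d : D) :=
  if rev w is (i, x) :: w' then rev ((i, x * dincl A d) :: w') else [::].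

(* Remove the interval B and multiply its cumulant into the right of the
   preceding factor, or into the left of the following one if there is no
   preceding factor. *)
Definition remove_block B w :=
  let p := find (fun ix => ix.1 \in B) w in
  let before := take p w in
  let after := drop (p + #|B|) w in
  let d := kappa [seq ix.2 | ix <- w & ix.1 \in B] in
  if before is [::] then mulr_head d after else mulr_last before d ++ after.

(* m is the number of blocks that have to be removed to leave one block. *)
Fixpoint nested_rec (m : nat) P w : D :=
  if m is m'.+1 then
    if [pick B in P | is_interval B w] is Some B
    then nested_rec m' (P :\ B) (remove_block B w)
    else 0
  else kappa (unzip2 w).

Definition nested (P : {set {set 'I_n}}) (w : seq A) : D :=
  nested_rec #|P|.-1 P (zip (enum 'I_n) w).

End Nested.

(* The moment-cumulant formula solved for the term of the one-block partition;
   the fuel m bounds the length of the list. *)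
Fixpoint cumulant_rec (m : nat) (w : seq A) : D :=
  match m, w with
  | m'.+1, _ :: _ =>
      cexp A (\prod_(x <- w) x) -
      \sum_(P in NC (size w) | P != [set [set: 'I_(size w)]])
         nested (cumulant_rec m') P w
  | _, _ => 0
  end.

Definition cumulant (w : seq A) : D := cumulant_rec (size w) w.

Section NestedTheory.
Variables (kappa kappa' : seq A -> D) (n : nat).

Lemma size_remove_block (B : {set 'I_n}) (w : seq ('I_n * A)) :
  (size (remove_block kappa B w) <=
   size (take (find (fun ix => ix.1 \in B) w) w) +
   size (drop (find (fun ix => ix.1 \in B) w + #|B|) w))%N.
Proof.
rewrite /remove_block; case: (take _ w) => [|x v].
  by case: (drop _ w) => [|[i y] v].
rewrite size_cat leq_add2r /mulr_last; case E: (rev _) => [|[i y] v'] //.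
by rewrite size_rev -[leqRHS]size_rev E.
Qed.

Lemma size_remove_block_le (B : {set 'I_n}) (w : seq ('I_n * A)) :
  (size (remove_block kappa B w) <= size w)%N.
Proof.
apply: leq_trans (size_remove_block _ _) _.
set p := find _ _; rewrite size_drop size_take_min.
have [|] := leqP p (size w); lia.
Qed.

Lemma eq_nested_rec m P (w : seq ('I_n * A)) :
  (forall v, size v <= size w -> kappa v = kappa' v)%N ->
  nested_rec kappa m P w = nested_rec kappa' m P w.
Proof.
elim: m P w => [|m IHm] P w eqk /=; first by rewrite eqk ?size_map.
case: pickP => // B _.
have -> : remove_block kappa' B w = remove_block kappa B w.
  by rewrite /remove_block eqk // size_map size_filter count_size.
by apply: IHm => v le_v; apply: eqk; apply: leq_trans (size_remove_block_le B _).
Qed.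

End NestedTheory.

Lemma eq_nested (kappa kappa' : seq A -> D) (w : seq A)
    (P : {set {set 'I_(size w)}}) :
  (0 < size w)%N -> P \in NC (size w) -> P != [set [set: 'I_(size w)]] ->
  (forall v, size v < size w -> kappa v = kappa' v)%N ->
  nested kappa P w = nested kappa' P w.
Proof.
move=> w_gt0; rewrite inE => /andP[partP _] PneT eqk; rewrite /nested.
have [/eqP covP tiP nz] := and3P partP.
set z := zip _ w.
have z1 : unzip1 z = enum 'I_(size w) by rewrite unzip1_zip // size_enum_ord.
have sz : size z = size w by rewrite size1_zip size_enum_ord.
case Pc : #|P|.-1 => [|m] /=.
  have P0 : (0 < #|P|)%N.
    rewrite card_gt0; apply: contraTneq w_gt0 => P0; move: covP.
    rewrite P0 /finset.cover finset.big_set0 => w0.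
    by rewrite -leqNgt -[X in (X <= _)%N]card_ord -cardsT -w0 cards0.
  have /eqP/cards1P[B PB] : #|P| = 1%N by lia.
  by move: covP PneT; rewrite PB /finset.cover finset.big_set1 => ->; rewrite eqxx.
case: pickP => // B /andP[BP _].
have [C CP CB] : exists2 C, C \in P & C != B.
  have /card_gt0P[C] : (0 < #|P :\ B|)%N by rewrite (cardsD1 B P) BP in Pc; lia.
  by rewrite !inE => /andP[CB CP]; exists C.
have [x xC] : exists x, x \in C.
  by apply/set0Pn; apply: contraNneq nz => <-.
have [y yB] : exists x, x \in B.
  by apply/set0Pn; apply: contraNneq nz => <-.
have xB : x \notin B.
  have := finset.trivIsetP tiP _ _ CP BP CB.
  by rewrite finset.disjoints_subset => /fintype.subsetP/(_ _ xC); rewrite inE.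
have zin t : exists2 v, v \in z & v.1 = t.
  have : t \in unzip1 z by rewrite z1 mem_enum.
  by case/mapP => v vz ->; exists v.
have remE : remove_block kappa' B z = remove_block kappa B z.
  rewrite /remove_block eqk // size_map size_filter.
  apply: (@leq_trans (size z)); last by rewrite sz.
  rewrite ltn_neqAle count_size andbT -all_count.
  by apply/allPn; have [v vz vx] := zin x; exists v; rewrite // vx.
rewrite remE; apply: eq_nested_rec => v le_v; apply: eqk.
apply: leq_ltn_trans le_v _; apply: leq_ltn_trans (size_remove_block _ _ _) _.
have : has (fun ix => ix.1 \in B) z.
  by apply/hasP; have [u uz uy] := zin y; exists u; rewrite // uy.
rewrite has_find -/z; set p := find _ _ => lt_p; rewrite size_drop size_take_min.
have : (0 < #|B|)%N by apply/card_gt0P; exists y.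
move: lt_p; rewrite sz; move: #|B| p => b p; clear; lia.
Qed.

Lemma cumulant_recE m (w : seq A) :
  (size w <= m)%N -> cumulant_rec m w = cumulant w.
Proof.
elim/ltn_ind: m w => m IHm [|x w]; first by case: m {IHm}.
case: m IHm => // m IHm lt_wm; rewrite /cumulant /=; congr (_ - _).
apply: eq_bigr => P /andP[PNC PneT].
apply: (@eq_nested _ _ (x :: w)) => // v lt_vw.
by rewrite IHm ?IHm //=; move: lt_wm lt_vw => /=; lia.
Qed.

Lemma NC_top n : (0 < n)%N -> [set [set: 'I_n]] \in NC n.
Proof.
case: n => // n _; rewrite inE; apply/andP; split.
  rewrite /finset.partition /finset.cover finset.big_set1 eqxx finset.trivIset1 inE /=.
  by apply/eqP => /setP/(_ ord0); rewrite !inE.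
apply/forall_inP=> B /set1P->; apply/forall_inP=> B' /set1P->.
by rewrite eqxx.
Qed.

Lemma moment_cumulant (w : seq A) : w != [::] ->
  cexp A (\prod_(x <- w) x) =
  \sum_(P in NC (size w)) nested cumulant P w.
Proof.
case: w => // x w _; set v := x :: w.
rewrite (bigD1 _ (NC_top (ltn0Sn (size w)))) -/v /=.
have -> : nested cumulant [set [set: 'I_(size v)]] v = cumulant v.
  rewrite /nested cards1.
  rewrite -[LHS]/(cumulant (unzip2 (zip (enum 'I_(size v)) v))).
  by rewrite unzip2_zip // size_enum_ord.
rewrite {1}/cumulant /= -/v -[LHS](subrK (\sum_(P in NC (size v) |
  P != [set [set: 'I_(size v)]]) nested (cumulant_rec (size w)) P v)).
congr (_ - _ + _); apply: eq_bigr => P /andP[PNC PneT].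
by apply: (@eq_nested _ _ v) => // u; rewrite ltnS => /cumulant_recE.
Qed.

End Cumulants.

Local Open Scope classical_set_scope.

Section Notions.
Variables (R : realType) (D : starAlgType R[i]).

(* j realizes A as a subset of B, over the same D. *)
Definition enlargement (A B : dprobSpace D) (j : {lrmorphism A -> B}) :=
  [/\ injective j, star_morphism j,
      forall d, j (dincl A d) = dincl B d
    & forall x, cexp B (j x) = cexp A x].

(* x^(s_0) d_0 x^(s_1) d_1 ... d_(n-1) x^(s_n) *)
Definition dword (A : dprobSpace D) (x : A) (n : nat)
    (s : nat -> bool) (d : nat -> D) : A :=
  spow x (s 0) * \prod_(i < n) (dincl A (d i) * spow x (s i.+1)).

Definition same_ddistr (A B : dprobSpace D) (x : A) (y : B) :=
  forall n s d, cexp A (dword x n s d) = cexp B (dword y n s d).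

Definition scalar_rv (A : dprobSpace D) (y : A) :=
  [/\ y * star y = star y * y,
      forall d, y * dincl A d = dincl A d * y,
      forall d, star y * dincl A d = dincl A d * star y
    & forall k l, exists alpha : R[i],
        cexp A (y ^+ k * star y ^+ l) = alpha%:A].

Definition unitary (A : dprobSpace D) (u : A) :=
  u * star u = 1 /\ star u * u = 1.

Inductive gen_alg (A : dprobSpace D) (X : set A) : A -> Prop :=
| gen_alg_mem x : X x -> gen_alg X x
| gen_alg1 : gen_alg X 1
| gen_algD x y : gen_alg X x -> gen_alg X y -> gen_alg X (x + y)
| gen_algZ (c : R[i]) x : gen_alg X x -> gen_alg X (c *: x)
| gen_algM x y : gen_alg X x -> gen_alg X y -> gen_alg X (x * y).

Definition free_amalg (A : dprobSpace D) (I : Type) (X : I -> set A) :=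
  forall (n : nat) (s : nat -> I) (x : nat -> A), (0 < n)%N ->
    (forall j, (j < n)%N ->
       gen_alg (X (s j) `|` range (dincl A)) (x j) /\ cexp A (x j) = 0) ->
    (forall j, (j.+1 < n)%N -> s j <> s j.+1) ->
  cexp A (\prod_(j < n) x j) = 0.

Definition free_pair (A : dprobSpace D) (X Y : set A) :=
  free_amalg (fun b : bool => if b then X else Y).

Definition lspan (A : dprobSpace D) (X : set A) : set A :=
  [set x | exists (n : nat) (c : 'I_n -> R[i]) (v : 'I_n -> A),
     (forall i, X (v i)) /\ x = \sum_i c i *: v i].

(* The set D a^s D a^t D ... D with m alternating letters, the first one
   having exponent s; it is D when m = 0. *)
Definition alt_prod (A : dprobSpace D) (a : A) (s : bool) (m : nat) : set A :=
  [set x | exists d : nat -> D,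
     x = dincl A (d 0) *
         \prod_(k < m) (spow a (s (+) odd k) * dincl A (d k.+1))].

Definition P11 (A : dprobSpace D) (a : A) : set A :=
  lspan (\bigcup_k alt_prod a true k.*2.+1).
Definition P12 (A : dprobSpace D) (a : A) : set A :=
  lspan (\bigcup_k alt_prod a true k.*2) `&` [set x | cexp A x = 0].
Definition P21 (A : dprobSpace D) (a : A) : set A :=
  lspan (\bigcup_k alt_prod a false k.*2) `&` [set x | cexp A x = 0].
Definition P22 (A : dprobSpace D) (a : A) : set A :=
  lspan (\bigcup_k alt_prod a false k.*2.+1).

(* The indices 1 and 2 are [false] and [true]. *)
Definition Pmx (A : dprobSpace D) (a : A) (i j : bool) : set A :=
  match i, j with
  | false, false => P11 a
  | false, true => P12 a
  | true, false => P21 a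
  | true, true => P22 a
  end.

(* (1, star, ..., 1, star) or (star, 1, ..., star, 1); in particular n is even. *)
Definition alternating (n : nat) (s : nat -> bool) :=
  ~~ odd n /\ exists b : bool, forall i, (i < n)%N -> s i = b (+) odd i.

End Notions.

(* Main.v *)
(** Each implication is proved through (1).

    (1) <-> (2).  Nested cumulants do not depend on the order in which interval
    blocks are removed.  This gives, for consecutive nonempty segments
    y_1, ..., y_k of a word w,
      E((y_1 - E y_1) ... (y_k - E y_k)) = sum of kappa_P(w)
    over the noncrossing P for which no y_i is a union of blocks of P.  If the y_i
    are the maximal alternating runs of w and every block of P is alternating,
    then removing interval blocks of P one at a time never joins two runs before
    one of them has disappeared, so some y_i is a union of blocks.  Hence under
    (2) every term vanishes, and conversely (1) leaves only the term of the
    one-block partition.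

    (1) -> (4) and (3) -> (1).  Replacing a by ua in an alternating word only
    changes its two ends; in a product of alternating words a letter u or u^*
    appears at each junction.  If the words are centered, and all shorter products
    of this kind have expectation 0, freeness shows that the expectation of the
    new product is c times the old one, where c is a product of values E(u),
    E(u^* ).  With |E(u)| < 1 the invariance under a -> ua forces the expectation
    to vanish.

    Existence of u.  It is enough to adjoin a symmetry u = u^*, u^2 = 1, E(u) = 0.
    The expectation of x_0 u x_1 u ... u x_k is defined by recursion.  The quotient
    of the formal words by the kernel of this expectation need not contain A, so
    it is paired with the copy of A obtained by setting u = 1, which the
    expectation ignores. *)

Require Import Defs.
From HB Require Import structures.
From mathcomp Require Import all_boot all_order all_algebra.
From mathcomp Require Import complex.
From mathcomp Require Import all_classical all_reals.
From mathcomp Require Import zify.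
Import Order.TTheory GRing.Theory Num.Theory.

Set Implicit Arguments.
Unset Strict Implicit.
Unset Printing Implicit Defensive.
Local Open Scope ring_scope.

(** * Nested evaluation with states *)

(** A circularity shapes the combinatorics. Independence of the order of removal needs cumulants
    that are balanced over D, while balancedness of a cumulant of length n is read off from nested
    evaluations of shorter ones; truncating the cumulants below length n breaks the circle.
    Multiplying a leading block into the letter on its right would also spoil inductions on
    prefixes, hence states with a separate coefficient in front, where every removed block is
    absorbed on its left. Positions of the full word are kept, so that a segment and its complement
    use blocks of the same index set.

    The bound |E(u)| < 1 enters through a count: a product of n factors with indices i_1, ...,
    i_(n+1) acquires one mean of u or [star u] at each of its n-1 junctions, and one more at its
    ends exactly when i_1 = i_(n+1). Only single factors with i_1 different from i_2 acquire none,
    and these have expectation 0 by definition.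

    A symmetry is convenient for existence because D and u generate just D + D u, so reduced words
    need only record their letters from A. *)

Lemma cat_eq_cat (T : Type) (u v u' v' : seq T) :
  u ++ v = u' ++ v' -> (size u <= size u')%N ->
  exists m, u' = u ++ m /\ v = m ++ v'.
Proof.
elim: u u' => [|x u IHu] [|y u'] //=.
- by move=> ->; exists [::].
- by move=> ->; exists (y :: u').
by case=> <- /IHu{}IHu; rewrite ltnS => /IHu[m [-> ->]]; exists m.
Qed.

Lemma infix_disjointP (T : eqType) (u b t u' c t' : seq T) :
  u ++ b ++ t = u' ++ c ++ t' -> uniq (u ++ b ++ t) ->
  b != [::] -> c != [::] -> ~~ has (mem b) c ->
  (exists m, u' = u ++ b ++ m /\ t = m ++ c ++ t') \/
  (exists m, u = u' ++ c ++ m /\ t' = m ++ b ++ t).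
Proof.
wlog le_u : u b t u' c t' / (size u <= size u')%N.
  move=> IH E U b0 c0 dis; have [le_u|/ltnW le_u] := leqP (size u) (size u').
    exact: IH.
  have dis' : ~~ has (mem c) b.
    by apply: contra dis => /hasP[x xb xc]; apply/hasP; exists x.
  rewrite E in U; case: (IH _ _ _ _ _ _ le_u (esym E) U c0 b0 dis'); by [right|left].
move=> E U b0 c0 dis; left.
have [m [-> {E}E]] := cat_eq_cat E le_u.
have [le_b|lt_m] := leqP (size b) (size m).
  have [k [-> ->]] := cat_eq_cat E le_b.
  by exists k.
have [k [Eb Ec]] := cat_eq_cat (esym E) (ltnW lt_m).
case: k => [|x k] in Eb Ec.
  by move: lt_m; rewrite Eb cats0 ltnn.
case: c c0 dis Ec {E} => [|y c] //= _; rewrite negb_or => /andP[xb _] [yx _].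
by rewrite Eb mem_cat inE yx eqxx orbT in xb.
Qed.

Section States.
Variables (R : realType) (D : starAlgType R[i]) (A : dprobSpace D) (n : nat).
Implicit Types (u v w t : seq ('I_n * A)) (g d : D) (B C : {set 'I_n})
  (P : {set {set 'I_n}}).

(* The state (g, w) stands for the word w with the coefficient g in front. *)
Definition app (st : D * seq ('I_n * A)) (d : D) : D * seq ('I_n * A) :=
  if rev st.2 is (i, x) :: w'
  then (st.1, rev ((i, x * dincl A d) :: w')) else (st.1 * d, [::]).

Definition scat (st : D * seq ('I_n * A)) t := (st.1, st.2 ++ t).

Lemma app_nil g d : app (g, [::]) d = (g * d, [::]). Proof. by []. Qed.

Lemma app_rcons g w i x d :
  app (g, rcons w (i, x)) d = (g, rcons w (i, x * dincl A d)).
Proof. by rewrite /app rev_rcons /= rev_cons revK. Qed.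

Lemma scatE g w t : scat (g, w) t = (g, w ++ t). Proof. by []. Qed.

Lemma scat0 st : scat st [::] = st.
Proof. by case: st => g w; rewrite scatE cats0. Qed.

Lemma scatA st t t' : scat (scat st t) t' = scat st (t ++ t').
Proof. by case: st => g w; rewrite !scatE catA. Qed.

Lemma app_app st d e : app (app st d) e = app st (d * e).
Proof.
case: st => g; elim/last_ind => [|w [i x] _]; first by rewrite !app_nil mulrA.
by rewrite !app_rcons rmorphM mulrA.
Qed.

Lemma app1 st : app st 1 = st.
Proof.
case: st => g; elim/last_ind => [|w [i x] _]; first by rewrite app_nil mulr1.
by rewrite app_rcons rmorph1 mulr1.
Qed.

Lemma app_scat st t d : t != [::] ->
  app (scat st t) d = scat st (app (1, t) d).2.
Proof.
case: st => g w; case/lastP: t => // t [i x] _.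
by rewrite scatE -rcons_cat !app_rcons /= scatE -rcons_cat.
Qed.

Lemma unzip1_app st d : unzip1 (app st d).2 = unzip1 st.2.
Proof.
case: st => g; elim/last_ind => [|w [i x] _] //.
by rewrite app_rcons /unzip1 !map_rcons.
Qed.

Lemma app_neq0 st d : ((app st d).2 == [::]) = (st.2 == [::]).
Proof.
case: st => g; elim/last_ind => [|w [i x] _] //.
by rewrite app_rcons /= -!size_eq0 !size_rcons.
Qed.

Lemma app_fst g t d : t != [::] -> app (g, t) d = (g, (app (1, t) d).2).
Proof. by case/lastP: t => // t [i x] _; rewrite !app_rcons. Qed.

Lemma app1_fst t d : t != [::] -> (app (1, t) d).1 = 1.
Proof. by case/lastP: t => // t [i x] _; rewrite app_rcons. Qed.

Lemma unzip1_cat u v : unzip1 (u ++ v) = unzip1 u ++ unzip1 v.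
Proof. exact: map_cat. Qed.

Section Rec.
Variable kappa : seq A -> D.

Definition rem_st B (st : D * seq ('I_n * A)) :=
  let p := find (fun ix => ix.1 \in B) st.2 in
  scat (app (st.1, take p st.2) (kappa [seq ix.2 | ix <- st.2 & ix.1 \in B]))
    (drop (p + #|B|) st.2).

(* Unlike [nested_rec], [Nrec] removes all the blocks, and the cumulant of a
   leading block goes to the coefficient in front of the word. *)
Fixpoint Nrec (m : nat) P (st : D * seq ('I_n * A)) : D :=
  if m is m'.+1 then
    if [pick B in P | is_interval B st.2] is Some B
    then Nrec m' (P :\ B) (rem_st B st)
    else 0
  else if st.2 is [::] then st.1 else 0.

Definition N P st := Nrec #|P| P st.

Lemma split_interval B w : is_interval B w ->
  exists u v t, [/\ w = u ++ v ++ t & unzip1 v = enum B].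
Proof.
move=> /infixP[p [s E]].
exists (take (size p) w), (take #|B| (drop (size p) w)),
  (drop #|B| (drop (size p) w)); split; first by rewrite !cat_take_drop.
by rewrite /unzip1 map_take map_drop -/(unzip1 w) E drop_size_cat // cardE
  take_size_cat.
Qed.

Lemma interval_split B u v t : unzip1 v = enum B -> is_interval B (u ++ v ++ t).
Proof. by move=> E; rewrite /is_interval /unzip1 !map_cat -E infix_infix. Qed.

Lemma uniq_notin u v t B (i : 'I_n) : uniq (unzip1 (u ++ v ++ t)) ->
  unzip1 v = enum B ->
  (i \in unzip1 u) || (i \in unzip1 t) -> i \notin B.
Proof.
move=> + E; rewrite /unzip1 !map_cat in E *; rewrite E.
rewrite uniq_catCA cat_uniq => /and3P[_ + _].
rewrite -mem_cat => /hasPn h /h; by rewrite /= mem_enum.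
Qed.

Lemma filter_block B u v t : uniq (unzip1 (u ++ v ++ t)) ->
  unzip1 v = enum B ->
  [seq ix <- u ++ v ++ t | ix.1 \in B] = v.
Proof.
move=> U E; rewrite !filter_cat.
have -> : [seq ix <- v | ix.1 \in B] = v.
  by apply/all_filterP/allP => ix /(map_f fst); rewrite -/(unzip1 v) E mem_enum.
have h r : {subset r <= u ++ t} -> [seq ix <- r | ix.1 \in B] = [::].
  move=> rs; apply/eqP; rewrite -[_ == _]negbK -has_filter; apply/hasPn => ix /rs.
  move=> ixr; apply: (uniq_notin U E); move: ixr; rewrite mem_cat.
  by case/orP => /(map_f fst) ->; rewrite ?orbT.
rewrite !h ?cats0 // => x; rewrite mem_cat => ->; by rewrite ?orbT.
Qed.

Lemma find_block B u v t : uniq (unzip1 (u ++ v ++ t)) ->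
  unzip1 v = enum B -> B != finset.set0 ->
  find (fun ix => ix.1 \in B) (u ++ v ++ t) = size u.
Proof.
move=> U E B0; rewrite find_cat ifF; last first.
  apply/hasP => -[ix ixu ixB]; move: (ixB).
  by rewrite (negPf (uniq_notin U E _)) // (map_f fst ixu).
case: v E {U} => [|[i x] v] /= E.
  by have := cards_eq0 B; rewrite cardE -E (negPf B0).
by rewrite -mem_enum -E inE eqxx addn0.
Qed.

Lemma rem_stE B g u v t : uniq (unzip1 (u ++ v ++ t)) ->
  unzip1 v = enum B -> B != finset.set0 ->
  rem_st B (g, u ++ v ++ t) = scat (app (g, u) (kappa (unzip2 v))) t.
Proof.
move=> U E B0; rewrite /rem_st /= find_block // filter_block //.
by rewrite take_size_cat // catA cardE -E size_map -size_cat drop_size_cat.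
Qed.

Lemma remove_blockE B u v t : uniq (unzip1 (u ++ v ++ t)) ->
  unzip1 v = enum B -> B != finset.set0 ->
  remove_block kappa B (u ++ v ++ t) =
    if u is [::] then mulr_head (kappa (unzip2 v)) t
    else (app (1, u) (kappa (unzip2 v))).2 ++ t.
Proof.
move=> U E B0; rewrite /remove_block find_block // filter_block //.
rewrite take_size_cat // catA cardE -E size_map -size_cat drop_size_cat //.
by case: u {U} => // x u; rewrite /mulr_last /app /=; case: (rev _) => [|[]].
Qed.

End Rec.
End States.

Section NrecTheory.
Variables (R : realType) (D : starAlgType R[i]) (A : dprobSpace D).

(* kappa is a D-bimodule map on the tensor powers of A over D. *)
Definition bimodular (kappa : seq A -> D) :=
  [/\ forall d x w, kappa (dincl A d * x :: w) = d * kappa (x :: w),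
      forall d x w, kappa (rcons w (x * dincl A d)) = kappa (rcons w x) * d
    & forall d x y v w, kappa (rcons v (x * dincl A d) ++ y :: w) =
        kappa (rcons v x ++ dincl A d * y :: w)].

Variables (n : nat) (kappa : seq A -> D).
Hypothesis kP : bimodular kappa.
Implicit Types (u v w t : seq ('I_n * A)) (g d : D) (B C : {set 'I_n})
  (P : {set {set 'I_n}}) (st : D * seq ('I_n * A)).

Lemma is_interval_eq B w w' : unzip1 w = unzip1 w' ->
  is_interval B w = is_interval B w'.
Proof. by rewrite /is_interval => ->. Qed.

Lemma NrecE m P st : Nrec kappa m.+1 P st =
  if [pick B in P | is_interval B st.2] is Some B
    then Nrec kappa m (P :\ B) (rem_st kappa B st) else 0.
Proof. by []. Qed.

Lemma pick_interval P w w' : unzip1 w = unzip1 w' ->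
  [pick B in P | is_interval B w] = [pick B in P | is_interval B w'].
Proof. by move=> E; apply: eq_pick => B; rewrite (is_interval_eq B E). Qed.

Lemma block_neq0 P B : finset.set0 \notin P -> B \in P -> B != finset.set0.
Proof. by move=> P0 BP; apply: contraNneq P0 => <-. Qed.

Lemma set0_notinD1 P B : finset.set0 \notin P -> finset.set0 \notin P :\ B.
Proof. by apply: contra; rewrite in_setD1 => /andP[]. Qed.

Lemma enum_neq0 B v : unzip1 v = enum B -> B != finset.set0 -> v != [::].
Proof.
by move=> E; apply: contraNneq => v0; rewrite -cards_eq0 cardE -E v0.
Qed.

Lemma uniq_rem u v t : uniq (unzip1 (u ++ v ++ t)) -> uniq (unzip1 (u ++ t)).
Proof.
rewrite /unzip1 !map_cat; apply: subseq_uniq.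
by apply: cat_subseq => //; apply: suffix_subseq.
Qed.

Lemma Nrec_mulg m P g g' w :
  Nrec kappa m P (g * g', w) = g * Nrec kappa m P (g', w).
Proof.
elim: m P g' w => [|m IHm] P g' w; first by case: w => //= *; rewrite mulr0.
rewrite !NrecE /=.
case: pickP => [B _|_]; last by rewrite mulr0.
rewrite /rem_st /= /app /=; case: (rev _) => [|[i x] r]; last exact: IHm.
by rewrite -mulrA; apply: IHm.
Qed.

Lemma kappa_app v d : v != [::] ->
  kappa (unzip2 (app (1, v) d).2) = kappa (unzip2 v) * d.
Proof.
case: kP => _ HR _.
by case/lastP: v => // v [i x] _; rewrite app_rcons /unzip2 !map_rcons HR.
Qed.

Lemma kappa_balanced m (l : 'I_n) d y k : m != [::] ->
  kappa (unzip2 ((app (1, m) d).2 ++ (l, y) :: k)) =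
  kappa (unzip2 (m ++ (l, dincl A d * y) :: k)).
Proof.
case: kP => _ _ HB; case/lastP: m => // m [i x] _.
by rewrite app_rcons /unzip2 !map_cat !map_rcons /= HB.
Qed.

(** If the block ends the word, d sits inside its cumulant and comes out by right linearity;
    otherwise the removal does not touch the letter that carries d. *)
Lemma rem_appE B g u v t : uniq (unzip1 (u ++ v ++ t)) ->
  unzip1 v = enum B -> B != finset.set0 -> forall d,
  rem_st kappa B (app (g, u ++ v ++ t) d) = app (rem_st kappa B (g, u ++ v ++ t)) d.
Proof.
move=> U E B0 d; rewrite rem_stE //.
have v0 := enum_neq0 E B0.
have [t0|t0] := eqVneq t [::].
  subst t; rewrite !cats0 -scatE app_scat // scatE /=.
  rewrite -[X in u ++ X]cats0 rem_stE ?unzip1_app //.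
    by rewrite !scat0 kappa_app // app_app.
  by move: U; rewrite !unzip1_cat unzip1_app cats0.
rewrite catA -scatE app_scat // scatE /= -catA rem_stE //.
  by rewrite app_scat.
by move: U; rewrite !unzip1_cat unzip1_app.
Qed.

Lemma rem_scatE B st v t : uniq (unzip1 (st.2 ++ v ++ t)) ->
  unzip1 v = enum B -> B != finset.set0 ->
  rem_st kappa B (scat st (v ++ t)) = scat (app st (kappa (unzip2 v))) t.
Proof. by case: st => g w; apply: rem_stE. Qed.

Lemma uniq_rem_st B st : uniq (unzip1 st.2) -> B != finset.set0 ->
  is_interval B st.2 -> uniq (unzip1 (rem_st kappa B st).2).
Proof.
case: st => g w U B0 /split_interval[u [v [t [wE E]]]].
rewrite /= in U wE; subst w; rewrite rem_stE //= unzip1_cat unzip1_app -unzip1_cat.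
exact: uniq_rem U.
Qed.

Lemma Nrec0 P st : st.2 != [::] -> Nrec kappa 0 P st = 0.
Proof. by case: st => g [|]. Qed.

Lemma Nrec_app m P st d : uniq (unzip1 st.2) -> finset.set0 \notin P ->
  Nrec kappa m P (app st d) = Nrec kappa m P st * d.
Proof.
elim: m P st => [|m IHm] P st U P0.
  have [w0|w0] := eqVneq st.2 [::]; last by rewrite !Nrec0 ?mul0r ?app_neq0.
  by case: st w0 U => g w /= ->.
rewrite !NrecE (pick_interval _ (unzip1_app _ _)).
case: pickP => [B /andP[BP iB]|_]; last by rewrite mul0r.
have B0 := block_neq0 P0 BP.
rewrite -IHm ?set0_notinD1 //; last exact: uniq_rem_st.
case: st U iB => g w /= U /split_interval[u [v [t [wE E]]]].
by rewrite wE in U *; rewrite rem_appE.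
Qed.

Lemma app_cons (l : 'I_n) y m d e : exists y' m',
  (app (1, (l, y) :: m) e).2 = (l, y') :: m' /\
  (app (1, (l, dincl A d * y) :: m) e).2 = (l, dincl A d * y') :: m'.
Proof.
case/lastP: m => [|m [i x]].
  by exists (y * dincl A e), [::]; rewrite /app /= mulrA.
by exists y, (rcons m (i, x * dincl A e)); rewrite -!rcons_cons !app_rcons.
Qed.

(** Each removal is compatible with moving d across the boundary between [st] and the letter [l].
    The cases are the positions of the removed block relative to this boundary. *)
Lemma Nrec_balanced m P st l d y t :
  uniq (unzip1 (st.2 ++ (l, y) :: t)) -> finset.set0 \notin P ->
  Nrec kappa m P (scat (app st d) ((l, y) :: t)) =
  Nrec kappa m P (scat st ((l, dincl A d * y) :: t)).
Proof.
elim: m P st y t => [|m IHm] P st y t U P0.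
  by rewrite !Nrec0 //= -size_eq0 size_cat addnS.
rewrite !NrecE (@pick_interval P _ (st.2 ++ (l, dincl A d * y) :: t)); last first.
  by rewrite !unzip1_cat unzip1_app.
case: pickP => [B /andP[BP iB]|//].
have B0 := block_neq0 P0 BP; have P0' := set0_notinD1 B P0.
have {}U : uniq (unzip1 (st.2 ++ (l, dincl A d * y) :: t)).
  by move: U; rewrite !unzip1_cat.
have [u [v [t1 [wE E]]]] := split_interval iB.
have v0 := enum_neq0 E B0.
have remE : rem_st kappa B (scat st ((l, dincl A d * y) :: t)) =
    scat (app (st.1, u) (kappa (unzip2 v))) t1.
  by rewrite /scat wE rem_stE // -wE.
have U' := uniq_rem_st (st := scat st ((l, dincl A d * y) :: t)) U B0 iB.
rewrite remE /= unzip1_cat unzip1_app /= -unzip1_cat in U'.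
rewrite remE {remE iB}; rewrite wE in U.
(* The block lies to the right of [l]: the letter [l] stays, and at most its right end receives the
   cumulant. *)
have [lt_u0|le_u] := ltnP (size st.2) (size u).
  have [m1 [uE]] := cat_eq_cat wE (ltnW lt_u0).
  case: m1 => [|[l' y'] m1] in uE * => [|[? ?] tE].
    by rewrite uE cats0 ltnn in lt_u0.
  subst l' y' t u.
  have [y' [m' [appE appE']]] := app_cons l y m1 d (kappa (unzip2 v)).
  have -> : rem_st kappa B (scat (app st d) ((l, y) :: m1 ++ v ++ t1)) =
      scat (app st d) ((l, y') :: m' ++ t1).
    rewrite /scat -cat_cons catA rem_stE //.
      by rewrite -scatE app_scat // appE scatA -cat_cons; case: (app st d).
    by move: U; rewrite !unzip1_cat unzip1_app.
  rewrite -scatE app_scat // appE' scatA cat_cons -surjective_pairing.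
  apply: IHm => //; move: U'; rewrite !unzip1_cat; congr (uniq _).
  have := congr1 unzip1 appE; rewrite unzip1_app /= => -[E1].
  by rewrite unzip1_cat -E1 -catA.
have [m1 [u0E vE]] := cat_eq_cat (esym wE) le_u.
have stE : st = scat (st.1, u) m1 by case: (st) u0E => g w /= ->.
(* The block lies to the left of [l]. If it touches the boundary ([m2] empty), d is inside its
   cumulant and comes out on the right. *)
have [le_v|lt_m] := leqP (size v) (size m1).
  have [m2 [m1E t1E]] := cat_eq_cat vE le_v; subst m1 t1.
  have -> : rem_st kappa B (scat (app st d) ((l, y) :: t)) =
      scat (app (scat (app (st.1, u) (kappa (unzip2 v))) m2) d) ((l, y) :: t).
    rewrite [in LHS]stE.
    have [m20|m20] := eqVneq m2 [::].
      subst m2; rewrite !cats0 !scat0 app_app -kappa_app //.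
      rewrite app_scat // scatA scatE rem_stE ?unzip1_app //.
      by move: U; rewrite !unzip1_cat unzip1_app.
    rewrite -scatA app_scat // !scatA scatE.
    rewrite rem_stE //; last by move: U; rewrite !unzip1_cat unzip1_app.
    by rewrite -scatA -app_scat.
  rewrite -scatA; apply: IHm => //.
  by move: U'; rewrite /= !unzip1_cat unzip1_app -!catA.
(* The block contains [l]: left linearity of [kappa] applies if it starts there, balancedness of
   [kappa] if it starts earlier. *)
have [[|[l' y'] k] [vE' tE]] := cat_eq_cat (esym vE) (ltnW lt_m).
  by rewrite vE' cats0 ltnn in lt_m.
case: tE => ? ? ?; subst l' y' t v; congr Nrec.
rewrite stE; have [m10|m10] := eqVneq m1 [::].
  subst m1; rewrite scat0 -cat_cons rem_scatE //; last first.
    by move: U; rewrite !unzip1_cat unzip1_app.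
  by rewrite app_app; case: kP => HL _ _; rewrite /= HL.
rewrite app_scat // scatA -cat_cons catA rem_scatE.
- by rewrite kappa_balanced.
- by move: U; rewrite !unzip1_cat unzip1_app.
- by move: E; rewrite !unzip1_cat unzip1_app.
- by [].
Qed.
End NrecTheory.

(** * Noncrossing partitions of positions *)

Section Positions.
Variable n : nat.
Implicit Types (s p q : seq 'I_n) (B C X J : {set 'I_n})
  (P Q : {set {set 'I_n}}).

Definition osorted s := sorted (fun i j : 'I_n => (i < j)%N) s.

Lemma ord_ltn_trans : transitive (fun i j : 'I_n => (i < j)%N).
Proof. by move=> j i k; apply: ltn_trans. Qed.

Lemma osorted_uniq s : osorted s -> uniq s.
Proof. by apply: sorted_uniq ord_ltn_trans _ _ => i; apply: ltnn. Qed.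

Lemma osorted_subseq s s' : subseq s s' -> osorted s' -> osorted s.
Proof. exact: subseq_sorted ord_ltn_trans s s'. Qed.

Lemma osorted_enum B : osorted (enum B).
Proof.
apply: sorted_filter ord_ltn_trans _ _ _; rewrite -enumT.
have : sorted ltn (map val (enum 'I_n)) by rewrite val_enum_ord iota_ltn_sorted.
by rewrite sorted_map.
Qed.

Lemma enum_filter B s : osorted s -> {subset B <= s} ->
  enum B = [seq i <- s | i \in B].
Proof.
move=> ss sB; apply: (irr_sorted_eq ord_ltn_trans).
- by move=> i; apply: ltnn.
- exact: osorted_enum.
- exact: sorted_filter ord_ltn_trans _ _ ss.
move=> i; rewrite mem_enum mem_filter.
by case iB: (i \in B) => //=; rewrite sB.
Qed.

Lemma enum_set_of s : osorted s -> enum [set i in s] = s.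
Proof.
move=> ss; rewrite (@enum_filter _ s) //; last by move=> i; rewrite inE.
by apply/all_filterP/allP => i si; rewrite inE.
Qed.

Definition noncrossing P :=
  [forall B in P, forall B' in P, (B != B') ==> ~~ crossing B B'].

Definition ncpart s P :=
  finset.partition P [set i in s] && noncrossing P.

Lemma noncrossingP P : reflect
  (forall B C i j k l, B \in P -> C \in P -> B != C ->
    i \in B -> j \in C -> k \in B -> l \in C ->
    (i < j)%N -> (j < k)%N -> (k < l)%N -> False) (noncrossing P).
Proof.
apply: (iffP forall_inP) => [h B C i j k l BP CP BC iB jC kB lC ij jk kl|h B BP].
  have /forall_inP/(_ C CP)/implyP/(_ BC)/negP := h B BP; apply.
  apply/existsP; exists i; rewrite iB /=; apply/existsP; exists j; rewrite jC /=.
  apply/existsP; exists k; rewrite kB /=; apply/existsP; exists l.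
  by rewrite lC ij jk.
apply/forall_inP => C CP; apply/implyP => BC; apply/negP.
move=> /existsP[i /andP[iB /existsP[j /andP[jC]]]].
move=> /existsP[k /andP[kB /existsP[l /andP[lC]]]].
by case/and3P; apply: h BC _ _ _ _.
Qed.

Lemma noncrossing_sub P Q : {subset Q <= P} -> noncrossing P -> noncrossing Q.
Proof.
move=> QP /noncrossingP h; apply/noncrossingP => B C i j k l /QP BP /QP CP.
exact: h.
Qed.

Lemma convex_infix s (a : pred 'I_n) : osorted s ->
  (forall i j k, a i -> j \in s -> a k -> (i < j)%N -> (j < k)%N -> a j) ->
  exists u t, s = u ++ [seq i <- s | a i] ++ t.
Proof.
elim: s => [|x s IHs] /=; first by move=> _ _; exists [::], [::].
move=> /[dup] xs /path_sorted ss h.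
have [|u [t sE]] := IHs ss.
  by move=> i j k ai js; apply: h => //; rewrite inE js orbT.
case: ifP => ax; last by exists (x :: u), t; rewrite /= -sE.
case fE: [seq i <- s | a i] sE => [|y f] sE; first by exists [::], s.
case: u => [|z u] in sE *; first by exists [::], t; rewrite /= sE.
have ay : a y.
  by have : y \in [seq i <- s | a i] by [rewrite fE mem_head]; rewrite mem_filter => /andP[].
have az : a z.
  apply: (h x z y) => //.
  - by rewrite sE /= !inE eqxx orbT.
  - by move: xs; rewrite sE /= => /andP[].
  - move: ss; rewrite sE /= => zs.
    have := order_path_min ord_ltn_trans zs => /allP/(_ y).
    by rewrite !mem_cat inE eqxx !orbT; apply.
have : z \in [seq i <- s | a i] by rewrite mem_filter az sE mem_head.
rewrite fE => zf; move: (osorted_uniq ss); rewrite sE cat_cons cons_uniq.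
by rewrite mem_cat mem_cat zf orbT.
Qed.

Definition hull B : {set 'I_n} :=
  [set x : 'I_n | [exists i in B, exists k in B, (i <= x)%N && (x <= k)%N]].

(** A block with the smallest hull is an interval of s. A point of s in a gap of B would belong to a
    block C which, B and C not crossing, lies strictly between two points of B; its hull would then
    be strictly smaller. *)
Lemma exists_interval s P : osorted s -> s != [::] -> ncpart s P ->
  exists2 B, B \in P & infix (enum B) s.
Proof.
move=> ss s0 /andP[partP /noncrossingP ncP].
have [/eqP covP tiP P0] := and3P partP.
have [x xs] : exists x, x \in s by case: (s) s0 => // x s' _; exists x; rewrite mem_head.
have blk y : y \in s -> exists2 B, B \in P & y \in B.
  move=> ys; have : y \in finset.cover P by rewrite covP inE.
  by move=> /finset.bigcupP[B BP yB]; exists B.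
have [B0 B0P _] := blk _ xs.
case: (arg_minnP (fun B => #|hull B|) B0P) => B BP minB; exists B => //.
have subB : {subset B <= s}.
  by move=> y yB; have := fintype.subsetP (partitionS partP BP) y yB; rewrite inE.
rewrite (enum_filter ss subB).
have [|u [t sE]] := @convex_infix s (mem B) ss; last by rewrite {2}sE infix_infix.
move=> i y k /= iB ys kB iy yk.
have [C CP yC] := blk _ ys; have [-> //|CB] := eqVneq B C.
have disj z : z \in B -> z \in C -> False.
  have := finset.trivIsetP tiP _ _ BP CP CB.
  by rewrite finset.disjoints_subset => /fintype.subsetP h /h; rewrite inE => /negP.
have CB' : forall z, z \in C -> (i < z)%N && (z < k)%N.
  move=> z zC; apply/andP; split; rewrite ltnNge leq_eqVlt; apply/negP.
    case/orP=> [/eqP/val_inj zi|zi]; first by apply: (disj i) => //; rewrite -zi.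
    by apply: (ncP C B z i y k) => //; rewrite eq_sym.
  case/orP=> [/eqP/val_inj kz|kz]; first by apply: (disj k) => //; rewrite kz.
  exact: (ncP B C i y k z).
suff /proper_card : hull C \proper hull B by rewrite ltnNge minB.
apply/properP; split.
  apply/fintype.subsetP => z; rewrite !inE.
  move=> /existsP[l /andP[lC /existsP[r /andP[rC /andP[lz zr]]]]].
  apply/existsP; exists i; rewrite iB; apply/existsP; exists k; rewrite kB /=.
  have /andP[il _] := CB' _ lC; have /andP[_ rk] := CB' _ rC.
  by rewrite (leq_trans (ltnW il) lz) (leq_trans zr (ltnW rk)).
exists i.
  rewrite inE; apply/existsP; exists i; rewrite iB; apply/existsP; exists k.
  by rewrite kB leqnn (ltnW (ltn_trans iy yk)).
rewrite inE; apply/negP => /existsP[l /andP[lC /existsP[r /andP[rC /andP[li _]]]]].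
by have /andP[] := CB' _ lC; rewrite ltnNge li.
Qed.

Lemma partition_infixD1 u b t P B : osorted (u ++ b ++ t) ->
  finset.partition P [set i in u ++ b ++ t] -> b = enum B -> B \in P ->
  finset.partition (P :\ B) [set i in u ++ t].
Proof.
move=> ss partP bE BP; subst b.
have -> : [set i in u ++ t] = [set i in u ++ enum B ++ t] :\: B.
  apply/setP => i; rewrite !inE !mem_cat mem_enum.
  have := osorted_uniq ss; rewrite uniq_catCA cat_uniq => /and3P[_ /hasPn h _].
  case: (boolP (i \in B)) => //= iB; apply/negbTE; rewrite -mem_cat.
  by apply: contraL iB => /h; rewrite /= mem_enum.
exact: partitionD1.
Qed.

Lemma ncpartD1 u b t P B : osorted (u ++ b ++ t) -> ncpart (u ++ b ++ t) P ->
  b = enum B -> B \in P -> ncpart (u ++ t) (P :\ B).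
Proof.
move=> ss /andP[partP ncP] E BP; rewrite /ncpart (partition_infixD1 ss partP E BP).
by apply: noncrossing_sub ncP => C; rewrite in_setD1 => /andP[].
Qed.

End Positions.

(** * Independence of the order of removal *)

Section Removal.
Variables (R : realType) (D : starAlgType R[i]) (A : dprobSpace D).
Variables (n : nat) (kappa : seq A -> D).
Hypothesis kP : bimodular kappa.
Implicit Types (u v w t : seq ('I_n * A)) (g d : D) (B C : {set 'I_n})
  (P Q : {set {set 'I_n}}) (st : D * seq ('I_n * A)).

(** If nothing separates the blocks, removing C first leaves its value at the right end of the last
    letter of B, and right linearity carries it out of the cumulant of B. Otherwise the two values
    land in different places. *)
Lemma rem_comm_cat st b m c t B C :
  uniq (unzip1 (st.2 ++ b ++ m ++ c ++ t)) ->
  unzip1 b = enum B -> unzip1 c = enum C ->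
  B != finset.set0 -> C != finset.set0 ->
  rem_st kappa C (rem_st kappa B (scat st (b ++ m ++ c ++ t))) =
  rem_st kappa B (rem_st kappa C (scat st (b ++ m ++ c ++ t))).
Proof.
move=> U Eb Ec B0 C0; rewrite rem_scatE //.
have b0 := enum_neq0 Eb B0.
rewrite -scatA rem_scatE //; last first.
  apply: subseq_uniq U; rewrite !unzip1_cat unzip1_app -!unzip1_cat /unzip1.
  by apply: map_subseq; rewrite -catA cat_subseq // suffix_subseq.
rewrite [in RHS]catA -[in RHS](scatA st) rem_scatE //; last by rewrite /= -!catA.
have [->|m0] := eqVneq m [::].
  rewrite cats0 scat0 app_app app_scat // scatA rem_scatE ?unzip1_app //.
    by rewrite -kappa_app.
  apply: subseq_uniq U; rewrite !unzip1_cat unzip1_app -!unzip1_cat /unzip1.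
  by apply: map_subseq; rewrite !cat_subseq // catA suffix_subseq.
rewrite -[scat st (b ++ m)]scatA !app_scat // !scatA rem_scatE //; last first.
  move: U; rewrite !unzip1_cat unzip1_app -!unzip1_cat /unzip1.
  apply: subseq_uniq; apply: map_subseq; rewrite !cat_subseq //.
  exact: suffix_subseq.
Qed.

Lemma interval_rem st B C : uniq (unzip1 st.2) -> is_interval B st.2 ->
  is_interval C st.2 -> B != finset.set0 -> C != finset.set0 ->
  [disjoint B & C] ->
  is_interval C (rem_st kappa B st).2 /\
  rem_st kappa C (rem_st kappa B st) = rem_st kappa B (rem_st kappa C st).
Proof.
case: st => g w U iB iC B0 C0 dis.
have [u [v [t [wE Ev]]]] := split_interval iB.
have [u' [v' [t' [wE' Ev']]]] := split_interval iC.
have v0 := enum_neq0 Ev B0; have v'0 := enum_neq0 Ev' C0.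
have hdis : ~~ has (mem v) v'.
  apply/hasPn => -[k x] /(map_f fst); rewrite -/(unzip1 v') Ev' mem_enum /= => kC.
  apply/negP => /(map_f fst); rewrite -/(unzip1 v) Ev mem_enum /= => kB.
  by move: dis; rewrite finset.disjoints_subset => /fintype.subsetP/(_ _ kB); rewrite inE kC.
rewrite /= in U wE wE'.
have Uw : uniq w by apply: map_uniq U.
rewrite wE in Uw; have E := etrans (esym wE) wE'.
have [[m [u'E tE]]|[m [uE t'E]]] := infix_disjointP E Uw v0 v'0 hdis.
  subst u' t; rewrite {}wE {wE' E Uw} in U iB iC *; split.
    rewrite rem_stE //= /is_interval !unzip1_cat Ev'.
    by rewrite catA infix_infix.
  by rewrite -scatE rem_comm_cat.
subst u t'; rewrite {}wE' {wE E Uw} in U iB iC *; split; last first.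
  by rewrite -scatE -rem_comm_cat.
have wE : u' ++ v' ++ m ++ v ++ t = (u' ++ v' ++ m) ++ v ++ t by rewrite -!catA.
rewrite wE in U *; rewrite rem_stE // /is_interval unzip1_cat unzip1_app /=.
by rewrite !unzip1_cat Ev' -!catA infix_infix.
Qed.

Lemma interval_neq0 B w : is_interval B w -> B != finset.set0 -> w != [::].
Proof.
move=> iB B0; apply: contraNneq B0 => w0; move: iB.
by rewrite w0 /is_interval infixs0 -size_eq0 -cardE cards_eq0.
Qed.

(** Diamond argument: when the recursion picks another block C, induction lets B be removed right
    after C on one side and C right after B on the other, and the two removals commute. *)
Lemma Nrec_remove m P st B : uniq (unzip1 st.2) -> finset.set0 \notin P ->
  finset.trivIset P -> B \in P -> is_interval B st.2 ->
  Nrec kappa m.+1 P st = Nrec kappa m (P :\ B) (rem_st kappa B st).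
Proof.
elim: m P st B => [|m IHm] P st B U P0 tiP BP iB.
all: rewrite NrecE; case: pickP => [C /andP[CP iC]|/(_ B)]; last by rewrite BP iB.
all: have [->//|CB] := eqVneq C B; have BC : B != C by rewrite eq_sym.
all: have B0 := block_neq0 P0 BP; have C0 := block_neq0 P0 CP.
all: have [iC' remE] :=
  interval_rem U iB iC B0 C0 (finset.trivIsetP tiP _ _ BP CP BC).
all: have [iB' _] :=
  interval_rem U iC iB C0 B0 (finset.trivIsetP tiP _ _ CP BP CB).
  (* With no step left both sides are 0, because each remaining word still contains the other
     block. *)
  by rewrite !Nrec0 ?(interval_neq0 iB') ?(interval_neq0 iC').
rewrite (IHm _ _ B) ?set0_notinD1 ?uniq_rem_st ?finset.trivIsetD ?in_setD1 ?BC //.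
rewrite (IHm (P :\ B) _ C) ?set0_notinD1 ?uniq_rem_st ?finset.trivIsetD ?in_setD1 ?CB //.
by rewrite remE !finset.setDDl finset.setUC.
Qed.

Lemma N_remove P st B : uniq (unzip1 st.2) -> finset.set0 \notin P ->
  finset.trivIset P -> B \in P -> is_interval B st.2 ->
  N kappa P st = N kappa (P :\ B) (rem_st kappa B st).
Proof. by move=> U P0 tiP BP iB; rewrite /N (cardsD1 B) BP; apply: Nrec_remove. Qed.

(* The coefficient of the following letter in [remove_block] and the
   coefficient in front in [Nrec] are reconciled by [Nrec_balanced]. *)
Lemma nested_recE m P w : osorted (unzip1 w) ->
  finset.partition P [set i in unzip1 w] -> #|P| = m.+1 ->
  nested_rec kappa m P w = Nrec kappa m.+1 P (1, w).
Proof.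
elim: m P w => [|m IHm] P w sw partP cP.
  have /eqP/cards1P[B PB] := cP.
  have wB : unzip1 w = enum B.
    by rewrite -(enum_set_of sw) -(cover_partition partP) PB /finset.cover finset.big_set1.
  have B0 : B != finset.set0 by apply: (partition_neq0 partP); rewrite PB finset.set11.
  rewrite NrecE; case: pickP => [C|/(_ B)]; last first.
    by rewrite PB finset.set11 /= /is_interval -wB infix_refl.
  rewrite PB => /andP[/finset.set1P-> _].
  have U : uniq (unzip1 ([::] ++ w ++ [::])) by rewrite cats0 osorted_uniq.
  have := rem_stE kappa 1 U wB B0; rewrite cat0s cats0 => ->.
  by rewrite scat0 app_nil mul1r.
rewrite NrecE [LHS]/=; case: pickP => [B /andP[BP iB]|//].
have B0 := partition_neq0 partP BP; have P0 := negbT (partition0 partP).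
have U := osorted_uniq sw.
have [u [v [t [wE Ev]]]] := split_interval iB; subst w.
have cPB : #|P :\ B| = m.+1 by move: cP; rewrite (cardsD1 B) BP => -[].
have sut : osorted (unzip1 (u ++ t)).
  apply: osorted_subseq sw; rewrite /unzip1 map_subseq // cat_subseq //.
  exact: suffix_subseq.
have partPB : finset.partition (P :\ B) [set i in unzip1 (u ++ t)].
  by rewrite !unzip1_cat in sw partP *; apply: partition_infixD1 partP Ev BP.
rewrite rem_stE // remove_blockE //.
case: u U sw partP iB sut partPB => [|x u] U sw partP iB sut partPB.
  rewrite app_nil mul1r scatE cat0s; case: t {U sw partP iB} sut partPB => [|[l y] t] sut partPB.
    case/and3P: partPB => /eqP covP _ /negP[].
    have [C CP] : exists C, C \in P :\ B by apply/card_gt0P; rewrite cPB.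
    suff <- : C = finset.set0 by [].
    apply/eqP; rewrite -finset.subset0 (fintype.subset_trans (finset.bigcup_sup _ CP)) //.
    by rewrite -/(finset.cover _) covP; apply/fintype.subsetP => i; rewrite inE.
  rewrite IHm //.
  have := @Nrec_balanced _ _ _ _ _ kP m.+1 (P :\ B) (1, [::]) l (kappa (unzip2 v)) y t.
  rewrite app_nil mul1r => H; symmetry; apply: H; last exact: set0_notinD1.
  exact: (osorted_uniq sut).
rewrite IHm // ?unzip1_cat ?unzip1_app -?unzip1_cat //.
by rewrite /scat app1_fst.
Qed.
End Removal.

(** * Bimodularity of the cumulants *)

Section Bimodularity.
Variables (R : realType) (D : starAlgType R[i]) (A : dprobSpace D).
Implicit Types (d : D) (x y : A) (v w : seq A).

Lemma cexpMl d x : cexp A (dincl A d * x) = d * cexp A x.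
Proof. by rewrite -[_ * x]mulr1 -(rmorph1 (dincl A)) cexpM mulr1. Qed.

Lemma cexpMr x d : cexp A (x * dincl A d) = cexp A x * d.
Proof. by rewrite -[x]mul1r -(rmorph1 (dincl A)) cexpM mul1r rmorph1 mul1r. Qed.

Lemma nested_top (kappa : seq A -> D) w :
  nested kappa [set [set: 'I_(size w)]] w = kappa w.
Proof.
rewrite /nested cards1 -[LHS]/(kappa (unzip2 (zip (enum 'I_(size w)) w))).
by rewrite unzip2_zip // size_enum_ord.
Qed.

Lemma unzip1_zip_enum n w : size w = n -> unzip1 (zip (enum 'I_n) w) = enum 'I_n.
Proof. by move=> sw; rewrite unzip1_zip // size_enum_ord sw. Qed.

Lemma osorted_enumT n : osorted (enum 'I_n).
Proof.
have := @osorted_enum n finset.setT; congr osorted.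
by apply: eq_enum => i; rewrite inE.
Qed.

Lemma set_of_enumT n : [set i in enum 'I_n] = finset.setT.
Proof. by apply/setP => i; rewrite !inE mem_enum. Qed.

Lemma nested_N (kappa : seq A -> D) n (P : {set {set 'I_n}}) w :
  bimodular kappa -> size w = n -> (0 < n)%N -> P \in NC n ->
  nested kappa P w = N kappa P (1, zip (enum 'I_n) w).
Proof.
move=> kP sw n0; rewrite inE => /andP[partP _].
case cP: #|P| => [|m].
  move: n0; rewrite -[X in (0 < X)%N]card_ord -cardsT (card_partition partP).
  by rewrite big_pred0 // => B; move/eqP: cP; rewrite cards_eq0 => /eqP->; rewrite inE.
by rewrite /nested /N cP nested_recE // unzip1_zip_enum ?set_of_enumT ?osorted_enumT.
Qed.

(** The lemmas on [Nrec] ask for a map that is bimodular on all lists, while an induction on length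
    only knows the short ones. Extending by 0 keeps bimodularity. *)
Definition trunc (m : nat) w : D := if (size w < m)%N then cumulant w else 0.

Lemma cumulantE n w : size w = n -> (0 < n)%N -> cumulant w =
  cexp A (\prod_(x <- w) x) -
  \sum_(P in NC n | P != [set [set: 'I_n]]) nested (trunc n) P w.
Proof.
move=> <- n0; rewrite moment_cumulant; last by rewrite -size_eq0 -lt0n.
rewrite (bigD1 _ (NC_top n0)) /= nested_top.
rewrite [X in _ - X](eq_bigr (fun P => nested (@cumulant _ _ A) P w)) ?addrK //.
move=> P /andP[PNC PneT]; symmetry; apply: eq_nested => // v lt_v.
by rewrite /trunc lt_v.
Qed.

Lemma cumulantE_N n w : size w = n -> (0 < n)%N -> bimodular (trunc n) ->
  cumulant w = cexp A (\prod_(x <- w) x) -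
  \sum_(P in NC n | P != [set [set: 'I_n]])
     N (trunc n) P (1, zip (enum 'I_n) w).
Proof.
move=> sw n0 kP; rewrite (cumulantE sw n0); congr (_ - _).
by apply: eq_bigr => P /andP[PNC _]; apply: nested_N.
Qed.

Lemma zip_split (T : Type) (e : seq T) v w : size e = size (v ++ w) ->
  zip e (v ++ w) = zip (take (size v) e) v ++ zip (drop (size v) e) w.
Proof.
move=> se; rewrite -{1}(cat_take_drop (size v) e) zip_cat // size_takel //.
by rewrite se size_cat leq_addr.
Qed.

(** Only words of length exactly m are new at each step. For them the cumulant is a moment minus
    nested evaluations of [trunc m]; both transform as required, the latter by the properties of
    [Nrec]. *)
Lemma trunc_bimodular m : bimodular (trunc m).
Proof.
elim: m => [|m IHm]; first by split=> *; rewrite /trunc /= ?mulr0 ?mul0r.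
have old v : (size v < m)%N -> trunc m.+1 v = trunc m v.
  by move=> lt_v; rewrite /trunc lt_v ltnS ltnW.
have big v : (m < size v)%N -> trunc m.+1 v = 0.
  by move=> lt_v; rewrite /trunc ltnS leqNgt lt_v.
have new v : size v = m -> trunc m.+1 v = cumulant v.
  by move=> lt_v; rewrite /trunc lt_v ltnSn.
have [HL HR HB] := IHm.
have U w (sw : size w = m) : uniq (unzip1 (zip (enum 'I_m) w)).
  by rewrite unzip1_zip_enum // enum_uniq.
have P0 P : P \in NC m -> finset.set0 \notin P.
  by rewrite inE => /andP[partP _]; rewrite (partition0 partP).
split=> [d x w|d x w|d x y v w].
- have [lt_m|lt_m|sw] := ltngtP (size (x :: w)) m.
  + by rewrite !old // HL.
  + by rewrite !big // mulr0.
  have m0 : (0 < m)%N by rewrite -sw.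
  rewrite !new // (@cumulantE_N m (dincl A d * x :: w) sw) // (cumulantE_N sw) //.
  rewrite mulrBr !big_cons -mulrA cexpMl; congr (_ - _); rewrite mulr_sumr.
  apply: eq_bigr => P /andP[PNC _]; rewrite /N -Nrec_mulg mulr1.
  have := U (x :: w) sw; have : size (enum 'I_m) = size (x :: w) by rewrite size_enum_ord sw.
  case: (enum 'I_m) => //= k e _ Ue.
  (* With an empty prefix, balancedness moves d from the coefficient in front into the first
     letter. *)
  have := Nrec_balanced IHm (st := (1, [::])) #|P| d Ue (P0 P PNC).
  by rewrite app_nil mul1r => H; exact: esym (H x).
- have [lt_m|lt_m|sw] := ltngtP (size (rcons w x)) m.
  + by rewrite !old ?HR //; move: lt_m; rewrite !size_rcons.
  + by rewrite !big ?mul0r //; move: lt_m; rewrite !size_rcons.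
  have m0 : (0 < m)%N by rewrite -sw size_rcons.
  have sw' : size (rcons w (x * dincl A d)) = m by rewrite -sw !size_rcons.
  rewrite !new // (cumulantE_N sw) // (cumulantE_N sw') //.
  rewrite mulrBl !big_rcons /= -cexpMr mulrA; congr (_ - _); rewrite mulr_suml.
  apply: eq_bigr => P /andP[PNC _].
  rewrite /N -Nrec_app ?P0 ?U //; congr (Nrec _ _ _ _).
  have : size (enum 'I_m) = (size w).+1 by rewrite size_enum_ord -sw size_rcons.
  case/lastP: (enum 'I_m) => // e k.
  by rewrite size_rcons => -[se]; rewrite !zip_rcons // app_rcons.
have sz z z' : size (rcons v z ++ z' :: w) = (size v + size w).+2.
  by rewrite size_cat size_rcons /= addSn addnS.
have [lt_m|lt_m|sw] := ltngtP (size v + size w).+2 m.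
+ by rewrite !old ?sz.
+ by rewrite !big ?sz.
have m0 : (0 < m)%N by rewrite -sw.
have sw' z z' : size (rcons v z ++ z' :: w) = m by rewrite sz.
rewrite !new // !(cumulantE_N (sw' _ _)) //; congr (_ - _).
  by rewrite !big_cat !big_rcons !big_cons /= !mulrA.
apply: eq_bigr => P /andP[PNC _]; rewrite /N.
have := U _ (sw' x y); rewrite !zip_split ?size_enum_ord ?sz ?sw' // !size_rcons.
set e1 := take _ _; set e2 := drop _ _.
have : size e1 = (size v).+1 by rewrite size_takel // size_enum_ord -sw ltnS leqW // leq_addr.
have : size e2 = (size w).+1 by rewrite size_drop size_enum_ord -sw subSS -addnS addKn.
case: e2 => // l e2 [se2]; case/lastP: e1 => // e1 k; rewrite size_rcons => -[se1].
rewrite !zip_rcons //= => Ue.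
have := Nrec_balanced IHm (st := (1, rcons (zip e1 v) (k, x))) #|P| d Ue (P0 P PNC).
by rewrite app_rcons !scatE.
Qed.

Lemma cumulant_bimodular : bimodular (@cumulant _ _ A).
Proof.
split=> [d x w|d x w|d x y v w].
- have [HL _ _] := trunc_bimodular (size w).+2.
  by have := HL d x w; rewrite /trunc /= !ltnSn.
- have [_ HR _] := trunc_bimodular (size w).+2.
  by have := HR d x w; rewrite /trunc !size_rcons !ltnSn.
have [_ _ HB] := trunc_bimodular (size v + size w).+3.
by have := HB d x y v w; rewrite /trunc !size_cat !size_rcons /= !addSn !addnS !ltnSn.
Qed.
End Bimodularity.

(** * Partitions saturating a segment *)

Section Saturation.
Variable n : nat.
Implicit Types (p q s u v t : seq 'I_n) (B C X J : {set 'I_n})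
  (P Q : {set {set 'I_n}}).

(** For a partition P of a set containing J this means that J is a union of blocks of P. *)
Definition saturated P J := [forall B in P, (B \subset J) || [disjoint B & J]].

Lemma saturatedP P J : reflect
  (forall B, B \in P -> (B \subset J) \/ [disjoint B & J]) (saturated P J).
Proof. by apply: (iffP forall_inP) => h B /h /orP. Qed.

Lemma mem_block P v B : finset.partition P [set i in v] -> B \in P ->
  {subset B <= v}.
Proof.
move=> partP BP i iB.
by have := fintype.subsetP (partitionS partP BP) i iB; rewrite inE.
Qed.

Lemma disjoint_set_of B s t : uniq (s ++ t) -> {subset B <= t} ->
  [disjoint B & [set i in s]].
Proof.
rewrite cat_uniq => /and3P[_ /hasPn h _] Bt.
rewrite finset.disjoints_subset; apply/fintype.subsetP => i /Bt /h.
by rewrite !inE.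
Qed.

Section Split.
Variables (u v t : seq 'I_n).
Hypothesis suvt : osorted (u ++ v ++ t).

Let uniq_vut : uniq (v ++ u ++ t).
Proof. by rewrite uniq_catCA osorted_uniq. Qed.

Lemma osorted_catl : osorted v.
Proof.
by apply: osorted_subseq suvt; rewrite catA; apply: subseq_trans (prefix_subseq _ _);
  apply: suffix_subseq.
Qed.

Lemma osorted_outer : osorted (u ++ t).
Proof.
by apply: osorted_subseq suvt; rewrite cat_subseq //; apply: suffix_subseq.
Qed.

Lemma block_neq_part P1 P2 B : finset.partition P1 [set i in v] ->
  finset.partition P2 [set i in u ++ t] -> B \in P1 -> B \notin P2.
Proof.
move=> p1 p2 B1; apply/negP => B2.
have dis := disjoint_set_of uniq_vut (mem_block p2 B2).
have B0 := partition_neq0 p1 B1.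
have BJ : B \subset [set i in v] by apply: partitionS B1.
move: B0; rewrite -finset.subset0 -(finset.setICr [set i in v]) finset.subsetI BJ.
by rewrite -finset.disjoints_subset dis.
Qed.

Lemma set_of_cat3 : [set i in u ++ v ++ t] = [set i in v] :|: [set i in u ++ t].
Proof. by apply/setP => i; rewrite !inE !mem_cat orbCA. Qed.

Lemma disjoint_parts : [disjoint [set i in v] & [set i in u ++ t]].
Proof.
rewrite disjoint_sym; apply: disjoint_set_of uniq_vut _ => i; by rewrite inE.
Qed.

Lemma partitionU P1 P2 : finset.partition P1 [set i in v] ->
  finset.partition P2 [set i in u ++ t] ->
  finset.partition (P1 :|: P2) [set i in u ++ v ++ t].
Proof.
move=> /and3P[/eqP c1 t1 z1] /and3P[/eqP c2 t2 z2]; apply/and3P; split.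
- by rewrite /finset.cover finset.bigcup_setU -!/(finset.cover _) c1 c2 set_of_cat3.
- by apply: trivIsetU => //; rewrite c1 c2 disjoint_parts.
- by rewrite inE negb_or z1.
Qed.

Lemma outer_convex i j k : i \in v -> k \in v -> j \in u ++ t ->
  (i < j)%N -> (j < k)%N -> False.
Proof.
move: suvt; rewrite /osorted !(sorted_pairwise (@ord_ltn_trans n)).
rewrite !pairwise_cat => /and3P[/allrelP uvt _ /and3P[/allrelP vt _ _]].
move=> iv kv; rewrite mem_cat => /orP[ju|jt] ij jk.
  have := uvt j i ju; rewrite mem_cat iv => /(_ isT); lia.
have := vt k j kv jt; lia.
Qed.

Lemma ncpartU P1 P2 : ncpart v P1 -> ncpart (u ++ t) P2 ->
  ncpart (u ++ v ++ t) (P1 :|: P2).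
Proof.
move=> /andP[p1 /noncrossingP n1] /andP[p2 /noncrossingP n2].
rewrite /ncpart partitionU //=; apply/noncrossingP => B C i j k l.
have sub1 B' x : B' \in P1 -> x \in B' -> x \in v by move=> h; apply: mem_block p1 h x.
have sub2 B' x : B' \in P2 -> x \in B' -> x \in u ++ t by move=> h; apply: mem_block p2 h x.
move=> /finset.setUP[B1|B2] /finset.setUP[C1|C2] BC iB jC kB lC ij jk kl.
- exact: (n1 B C i j k l).
- exact: (@outer_convex i j k (sub1 _ _ B1 iB) (sub1 _ _ B1 kB) (sub2 _ _ C2 jC)).
- exact: (@outer_convex j k l (sub1 _ _ C1 jC) (sub1 _ _ C1 lC) (sub2 _ _ B2 kB)).
- exact: (n2 B C i j k l).
Qed.

Lemma ncpart_split P : ncpart (u ++ v ++ t) P -> saturated P [set i in v] ->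
  ncpart v [set B in P | B \subset [set i in v]] /\
  ncpart (u ++ t) [set B in P | ~~ (B \subset [set i in v])].
Proof.
move=> /andP[partP ncP] /saturatedP sat.
have [/eqP covP tiP P0] := and3P partP.
have sub1 : {subset [set B in P | B \subset [set i in v]] <= P}.
  by move=> B; rewrite inE => /andP[].
have sub2 : {subset [set B in P | ~~ (B \subset [set i in v])] <= P}.
  by move=> B; rewrite inE => /andP[].
have blk y : y \in u ++ v ++ t -> exists2 B, B \in P & y \in B.
  move=> ys; have : y \in finset.cover P by rewrite covP inE.
  by move=> /finset.bigcupP[B BP yB]; exists B.
split; rewrite /ncpart (noncrossing_sub _ ncP) // andbT; apply/and3P; split.
- apply/eqP/setP => i; rewrite inE; apply/finset.bigcupP/idP => [[B]|iv].
    by rewrite inE => /andP[_ /fintype.subsetP BJ] /BJ; rewrite inE.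
  have [|B BP iB] := blk i; first by rewrite !mem_cat iv orbT.
  exists B => //; rewrite inE BP; case: (sat _ BP) => // dis.
  move: dis; rewrite finset.disjoints_subset => /fintype.subsetP/(_ i iB).
  by rewrite !inE iv.
- by apply: finset.trivIsetS tiP; apply/fintype.subsetP.
- by apply: contra P0 => /sub1.
- apply/eqP/setP => i; rewrite inE; apply/finset.bigcupP/idP => [[B]|iv].
    rewrite inE => /andP[BP nBJ] iB.
    have : i \in u ++ v ++ t by apply: mem_block partP BP i iB.
    case: (sat _ BP) => [BJ|dis]; first by rewrite BJ in nBJ.
    move: dis; rewrite finset.disjoints_subset => /fintype.subsetP/(_ i iB).
    by rewrite !inE !mem_cat => /negbTE->.
  have [|B BP iB] := blk i; first by move: iv; rewrite !mem_cat => /orP[]->; rewrite ?orbT.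
  exists B => //; rewrite inE BP /=; apply/negP => /fintype.subsetP/(_ i iB).
  rewrite inE => iv'; move: uniq_vut; rewrite cat_uniq => /and3P[_ /hasPn/(_ _ iv)].
  by rewrite /= iv'.
- by apply: finset.trivIsetS tiP; apply/fintype.subsetP.
- by apply: contra P0 => /sub2.
Qed.

(** P corresponds to the pair of its blocks inside v and its blocks outside; unions stay noncrossing
    because v is contiguous. The condition [r] depends on the outer part only: it will carry the
    requirements on later segments. *)
Lemma sum_saturated (V : zmodType) (F : {set {set 'I_n}} -> V)
    (r : pred {set {set 'I_n}}) :
  (forall P1 P2, ncpart v P1 -> ncpart (u ++ t) P2 -> r (P1 :|: P2) = r P2) ->
  \sum_(P | [&& ncpart (u ++ v ++ t) P, r P & saturated P [set i in v]]) F P =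
  \sum_(P1 | ncpart v P1) \sum_(P2 | ncpart (u ++ t) P2 && r P2) F (P1 :|: P2).
Proof.
move=> rE; rewrite pair_big_dep /=.
pose h P := ([set B in P | B \subset [set i in v]],
             [set B in P | ~~ (B \subset [set i in v])]).
rewrite (reindex_onto (fun Q : {set {set 'I_n}} * {set {set 'I_n}} => Q.1 :|: Q.2) h).
  apply: eq_bigl => -[P1 P2] /=; apply/idP/idP.
    move=> /andP[/and3P[ncP rP sat] /eqP[E1 E2]].
    have [nc1 nc2] := ncpart_split ncP sat.
    by rewrite E1 in nc1; rewrite E2 in nc2; rewrite nc1 nc2 -(rE _ _ nc1 nc2).
  move=> /and3P[nc1 nc2 r2].
  have [/andP[p1 _] /andP[p2 _]] := (nc1, nc2).
  have in1 B : B \in P1 -> B \subset [set i in v] by apply: partitionS.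
  have in2 B : B \in P2 -> [disjoint B & [set i in v]].
    by move=> B2; apply: disjoint_set_of uniq_vut _; apply: mem_block B2.
  have nin2 B : B \in P2 -> ~~ (B \subset [set i in v]).
    move=> B2; apply: contra (partition_neq0 p2 B2) => BJ.
    rewrite -finset.subset0 -(finset.setICr [set i in v]) finset.subsetI BJ.
    by rewrite -finset.disjoints_subset in2.
  rewrite ncpartU // rE // r2 /=; apply/andP; split.
    by apply/saturatedP => B /finset.setUP[/in1|/in2]; [left|right].
  apply/eqP; congr pair; apply/setP => B; rewrite !inE.
    case B1: (B \in P1) => /=; first exact: in1.
    by case B2: (B \in P2) => //=; apply/negbTE/nin2.
  case B2: (B \in P2); first by rewrite orbT nin2.
  by case B1: (B \in P1) => //=; rewrite in1.
by move=> P _ /=; apply/setP => B; rewrite !inE -andb_orr orbN andbT.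
Qed.

End Split.
End Saturation.

(** * Evaluating the blocks inside a segment first *)

Section Fubini.
Variables (R : realType) (D : starAlgType R[i]) (A : dprobSpace D).
Variables (n : nat) (kappa : seq A -> D).
Hypothesis kP : bimodular kappa.
Implicit Types (u v w t : seq ('I_n * A)) (g d e : D) (B C : {set 'I_n})
  (P Q : {set {set 'I_n}}) (st : D * seq ('I_n * A)).

Lemma N0 st : N kappa finset.set0 st = if st.2 is [::] then st.1 else 0.
Proof. by rewrite /N cards0. Qed.

Lemma rem_local B st e v t : uniq (unzip1 (st.2 ++ v ++ t)) ->
  is_interval B v -> B != finset.set0 ->
  rem_st kappa B (scat (app st e) (v ++ t)) =
  scat (app st (rem_st kappa B (e, v)).1) ((rem_st kappa B (e, v)).2 ++ t).
Proof.
move=> U /split_interval[v1 [vb [v2 [vE E]]]] B0; subst v.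
have U1 : uniq (unzip1 (v1 ++ vb ++ v2)).
  apply: subseq_uniq U; rewrite /unzip1 map_subseq //.
  exact: subseq_trans (prefix_subseq _ t) (suffix_subseq st.2 _).
rewrite rem_stE // -!catA -(scatA _ v1) rem_scatE //; last first.
  by move: U; rewrite /= !unzip1_cat unzip1_app -!catA.
have [->|v10] := eqVneq v1 [::].
  by rewrite scat0 app_app app_nil.
by rewrite app_scat // scatA (app_fst e).
Qed.

Lemma positions_rem B g w : uniq (unzip1 w) -> is_interval B w ->
  B != finset.set0 -> exists p q, unzip1 w = p ++ enum B ++ q /\
    unzip1 (rem_st kappa B (g, w)).2 = p ++ q.
Proof.
move=> U /split_interval[u [v [t [wE E]]]] B0; subst w.
exists (unzip1 u), (unzip1 t); rewrite rem_stE //= !unzip1_cat E.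
by rewrite unzip1_app.
Qed.

(** By order independence the blocks of P1 are removed first. They see only letters of v, and what
    leaves v on the left goes into e, which sits at the right end of [st]. Once v is exhausted, e
    has become the value of P1 on v. *)
Lemma N_union P1 P2 st e v t :
  osorted (unzip1 (st.2 ++ v ++ t)) -> ncpart (unzip1 v) P1 ->
  finset.partition P2 [set i in unzip1 (st.2 ++ t)] ->
  N kappa (P1 :|: P2) (scat (app st e) (v ++ t)) =
  N kappa P2 (scat (app st (N kappa P1 (e, v))) t).
Proof.
move Em: #|P1| => m; elim: m P1 e v Em => [|m IHm] P1 e v cP1 sw nc1 p2.
  move/eqP: cP1; rewrite cards_eq0 => /eqP P10; subst P1.
  rewrite finset.set0U N0 /=; suff -> : v = [::] by [].
  have /andP[p1 _] := nc1; have := cover_partition p1.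
  rewrite /finset.cover finset.big_set0; case: (v) => //= x w /esym/setP/(_ x.1).
  by rewrite !inE eqxx.
have sw' : osorted (unzip1 st.2 ++ unzip1 v ++ unzip1 t) by rewrite -!unzip1_cat.
have sv := osorted_catl sw'.
have p2' : finset.partition P2 [set i in unzip1 st.2 ++ unzip1 t].
  by rewrite -unzip1_cat.
have [p1 ncr1] := andP nc1.
have v0 : unzip1 v != [::].
  apply/eqP => v0; have [C CP] : exists C, C \in P1 by apply/card_gt0P; rewrite cP1.
  have := partition_neq0 p1 CP; have := partitionS p1 CP.
  have -> : [set i in unzip1 v] = finset.set0 by apply/setP => i; rewrite v0 !inE.
  by rewrite finset.subset0 => ->.
have [B BP iB] := exists_interval sv v0 nc1.
have B0 := partition_neq0 p1 BP.
have U : uniq (unzip1 (st.2 ++ v ++ t)) by apply: osorted_uniq.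
have Uv := osorted_uniq sv.
have pU := partitionU sw' p1 p2'.
have [tiU zU] : finset.trivIset (P1 :|: P2) /\ finset.set0 \notin P1 :|: P2.
  by case/and3P: pU.
rewrite (N_remove kP (B := B)) //; last first.
- rewrite /is_interval unzip1_cat unzip1_app -unzip1_cat !unzip1_cat.
  by apply: infix_catl; apply: infix_catr.
- by rewrite inE BP.
- by rewrite unzip1_cat unzip1_app -unzip1_cat.
have [z1 ti1] : finset.set0 \notin P1 /\ finset.trivIset P1 by case/and3P: p1.
rewrite (N_remove kP (st := (e, v)) Uv z1 ti1 BP iB).
rewrite rem_local //; have [p [q [vE remE]]] := positions_rem e Uv iB B0.
have -> : (P1 :|: P2) :\ B = (P1 :\ B) :|: P2.
  apply/setP => C; rewrite !inE; case: eqVneq => //= ->.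
  by rewrite (negbTE (block_neq_part sw' p1 p2' BP)).
rewrite vE in sv nc1 sw'.
have nc1' : ncpart (p ++ q) (P1 :\ B) by apply: ncpartD1 nc1 _ BP.
have cP1' : #|P1 :\ B| = m by move: cP1; rewrite (cardsD1 B) BP => -[].
case: (rem_st kappa B (e, v)) remE => e' v' /= remE.
apply: IHm => //; rewrite ?unzip1_cat remE //.
apply: osorted_subseq sw'; rewrite -!catA.
by do 2!apply: cat_subseq => //; apply: suffix_subseq.
Qed.
End Fubini.

(** * Relabelling positions *)

Section Transport.
Variables (m n : nat) (f : 'I_m -> 'I_n).
Hypothesis f_mono : forall i j : 'I_m, (i < j)%N -> (f i < f j)%N.

Let f_inj : injective f.
Proof.
move=> i j fij; apply: val_inj; case: (ltngtP i j) => // /f_mono;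
by rewrite fij ltnn.
Qed.

Let f_ltn i j : (f i < f j)%N = (i < j)%N.
Proof.
apply/idP/idP => [|/f_mono//]; rewrite ltnNge; case: ltngtP => //.
  by move=> /f_mono/ltnW->.
by move=> /val_inj->; rewrite leqnn.
Qed.

Definition fset (P : {set {set 'I_m}}) : {set {set 'I_n}} :=
  [set f @: (B : {set 'I_m}) | B in P].

Lemma enum_imset (B : {set 'I_m}) : enum (f @: B) = map f (enum B).
Proof.
apply: (irr_sorted_eq (@ord_ltn_trans n)).
- by move=> i; apply: ltnn.
- exact: osorted_enum.
- by rewrite sorted_map; apply: sub_sorted (osorted_enum B) => i j; apply: f_mono.
move=> i; rewrite mem_enum; apply/imsetP/mapP => -[j jB ->]; exists j => //.
  by rewrite mem_enum.
by rewrite -mem_enum.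
Qed.

Lemma noncrossing_fset P : noncrossing (fset P) = noncrossing P.
Proof.
apply/noncrossingP/noncrossingP => h B C i j k l.
  move=> BP CP BC iB jC kB lC; rewrite -!f_ltn.
  apply: (h (f @: B) (f @: C)); rewrite ?imset_f //.
  by rewrite (inj_eq (imset_inj f_inj)).
move=> /imsetP[B' BP ->] /imsetP[C' CP ->] BC /imsetP[i' iB ->] /imsetP[j' jC ->].
move=> /imsetP[k' kB ->] /imsetP[l' lC ->]; rewrite !f_ltn.
by apply: (h B' C') => //; apply: contraNneq BC => ->.
Qed.

Lemma fsetD1 P (B : {set 'I_m}) : fset P :\ (f @: B) = fset (P :\ B).
Proof.
apply/setP => C; rewrite in_setD1; apply/andP/imsetP.
  case=> CB /imsetP[C' CP CE]; exists C' => //; rewrite in_setD1 CP andbT.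
  by apply: contraNneq CB => <-; rewrite CE.
case=> C'; rewrite in_setD1 => /andP[CB CP] ->.
by rewrite (inj_eq (imset_inj f_inj)) CB imset_f.
Qed.

Variables (R : realType) (D : starAlgType R[i]) (A : dprobSpace D).
Variable kappa : seq A -> D.
Hypothesis kP : bimodular kappa.

Definition fword (w : seq ('I_m * A)) : seq ('I_n * A) :=
  [seq (f ix.1, ix.2) | ix <- w].

Lemma unzip1_fword w : unzip1 (fword w) = map f (unzip1 w).
Proof. by rewrite /unzip1 -!map_comp. Qed.

Lemma unzip2_fword w : unzip2 (fword w) = unzip2 w.
Proof. by rewrite /unzip2 -!map_comp. Qed.

Lemma app_fword g w d : app (g, fword w) d = ((app (g, w) d).1, fword (app (g, w) d).2).
Proof.
elim/last_ind: w => [|w [i x] _] //.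
by rewrite app_rcons /fword !map_rcons app_rcons.
Qed.

Lemma rem_fword (B : {set 'I_m}) g w : uniq (unzip1 w) -> is_interval B w -> B != finset.set0 ->
  rem_st kappa (f @: B) (g, fword w) =
    ((rem_st kappa B (g, w)).1, fword (rem_st kappa B (g, w)).2) /\
  is_interval (f @: B) (fword w).
Proof.
move=> U /split_interval[u [v [t [wE E]]]] B0; subst w.
have fE : fword (u ++ v ++ t) = fword u ++ fword v ++ fword t.
  by rewrite /fword !map_cat.
have Ef : unzip1 (fword v) = enum (f @: B) by rewrite unzip1_fword enum_imset E.
split; last by rewrite fE; apply: interval_split.
have Uf : uniq (unzip1 (fword u ++ fword v ++ fword t)).
  by rewrite -fE unzip1_fword (map_inj_uniq f_inj).
rewrite fE !rem_stE //; last by rewrite imset_eq0.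
by rewrite app_fword unzip2_fword /scat /= /fword map_cat.
Qed.

Lemma N_fword P g w : osorted (unzip1 w) -> ncpart (unzip1 w) P ->
  N kappa (fset P) (g, fword w) = N kappa P (g, w).
Proof.
move Em: #|P| => k; elim: k P g w Em => [|k IHk] P g w cP sw nc.
  move/eqP: cP; rewrite cards_eq0 => /eqP->.
  by rewrite /fset imset0 !N0 /=; case: (w).
have [partP ncP] := andP nc.
have w0 : unzip1 w != [::].
  apply/eqP => w0; have [C CP] : exists C, C \in P by apply/card_gt0P; rewrite cP.
  have := partition_neq0 partP CP; have := partitionS partP CP.
  have -> : [set i in unzip1 w] = finset.set0 by apply/setP => i; rewrite w0 !inE.
  by rewrite finset.subset0 => ->.
have [B BP iB] := exists_interval sw w0 nc.
have B0 := partition_neq0 partP BP; have U := osorted_uniq sw.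
have [remE ifB] := rem_fword g U iB B0.
have [/and3P[_ tiP zP] cPB] : finset.partition P [set i in unzip1 w] /\ #|P :\ B| = k.
  by split=> //; move: cP; rewrite (cardsD1 B) BP => -[].
rewrite (N_remove kP (B := B)) // (N_remove kP (B := f @: B)) //; first last.
- by rewrite imset_f.
- by rewrite imset_trivIset.
- by rewrite imset0mem.
- by rewrite unzip1_fword (map_inj_uniq f_inj).
have [p [q [wE]]] := positions_rem kappa g U iB B0.
rewrite remE fsetD1; case: (rem_st kappa B (g, w)) => g' w' /= w'E.
rewrite wE in sw nc; rewrite IHk ?w'E //.
  by apply: osorted_subseq sw; rewrite cat_subseq // suffix_subseq.
exact: ncpartD1 nc _ BP.
Qed.

End Transport.

Section Moments.
Variables (R : realType) (D : starAlgType R[i]) (A : dprobSpace D).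
Let kP := cumulant_bimodular A.

Lemma moment_N n (w : seq A) : size w = n -> (0 < n)%N ->
  cexp A (\prod_(x <- w) x) =
  \sum_(P | ncpart (enum 'I_n) P) N (@cumulant _ _ A) P (1, zip (enum 'I_n) w).
Proof.
move=> sw n0; have w0 : w != [::] by rewrite -size_eq0 sw -lt0n.
have -> : cexp A (\prod_(x <- w) x) =
    \sum_(P in NC n) nested (@cumulant _ _ A) P w.
  by move: n0; rewrite -sw => n0; rewrite moment_cumulant.
have ncE P : (P \in NC n) = ncpart (enum 'I_n) P.
  by rewrite inE /ncpart set_of_enumT.
rewrite -(eq_bigl _ _ ncE).
by apply: eq_bigr => P PNC; apply: nested_N.
Qed.

(** The moment-cumulant formula uses all of ['I_m], while a segment of a longer word carries some
    increasing list of positions in ['I_n]. The increasing enumeration f of that list transports one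
    to the other, since nested evaluation depends only on the relative order. *)
Lemma moment_ncpart n (w : seq ('I_n * A)) : osorted (unzip1 w) ->
  cexp A (\prod_(x <- unzip2 w) x) =
  \sum_(P | ncpart (unzip1 w) P) N (@cumulant _ _ A) P (1, w).
Proof.
move=> sw; have [w0|w0] := eqVneq w [::].
  rewrite w0 /= big_nil cexp1 (big_pred1 finset.set0) ?N0 // => P.
  rewrite /ncpart; have -> : [set i in [::]] = finset.set0 :> {set 'I_n}.
    by apply/setP => i; rewrite !inE.
  rewrite partition_set0 /=; case: eqVneq => //= ->.
  by apply/noncrossingP => B C i j k l; rewrite inE.
set v := unzip1 w; pose m := size v.
have m0 : (0 < m)%N by rewrite /m size_map lt0n size_eq0.
pose f (i : 'I_m) : 'I_n := tnth (in_tuple v) i.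
have fmono (i j : 'I_m) : (i < j)%N -> (f i < f j)%N.
  move=> ij; rewrite /f !(tnth_nth (f i)) /=.
  apply: (sorted_ltn_nth (@ord_ltn_trans n) (f i) sw) => //; exact: ltn_ord.
have finj : injective f.
  move=> i j fij; apply: val_inj; case: (ltngtP i j) => // /fmono;
  by rewrite fij ltnn.
have vE : v = map f (enum 'I_m).
  by rewrite /f; have := map_tnth_enum (in_tuple v).
rewrite (@moment_N m) //; last by rewrite /m !size_map.
have wE : fword f (zip (enum 'I_m) (unzip2 w)) = w.
  have sz : size (enum 'I_m) = size (unzip2 w) by rewrite size_enum_ord /m !size_map.
  rewrite -[RHS]zip_unzip -[LHS]zip_unzip unzip1_fword unzip2_fword.
  by rewrite unzip1_zip ?sz // unzip2_zip ?sz // -vE.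
have sT := osorted_enumT m.
have z1 : unzip1 (zip (enum 'I_m) (unzip2 w)) = enum 'I_m.
  by rewrite unzip1_zip_enum // /m !size_map.
have fT : f @: [set i in enum 'I_m] = [set i in v].
  apply/setP => i; rewrite inE vE; apply/imsetP/mapP => -[j].
    by rewrite inE => jT ->; exists j.
  by move=> jT ->; exists j; rewrite ?inE.
have ncf P : ncpart v (fset f P) = ncpart (enum 'I_m) P.
  by rewrite /ncpart noncrossing_fset // -fT imset_partition.
(* Preimages invert [fset f] on partitions of v, which is the image of f. *)
pose g (P : {set {set 'I_n}}) : {set {set 'I_m}} :=
  [set f @^-1: (B : {set 'I_n}) | B in P].
have fK P : g (fset f P) = P.
  rewrite /g /fset -imset_comp -[RHS]imset_id; apply: eq_imset => B /=.
  by apply/setP => i; rewrite inE mem_imset.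
rewrite [RHS](reindex_onto (fset f) g) /=.
  apply: eq_big => [P|P]; first by rewrite ncf fK eqxx andbT.
  by move=> nc; rewrite -[in RHS]wE N_fword ?z1.
move=> P /andP[partP _]; rewrite /g /fset -imset_comp -[RHS]imset_id.
apply: eq_in_imset => B BP /=; apply/setP => i; apply/imsetP/idP.
  by case=> j; rewrite inE => jB ->.
move=> iB; have : i \in v by apply: mem_block partP BP _ iB.
by rewrite vE => /mapP[j _ E]; exists j => //; rewrite inE -E.
Qed.
End Moments.

(** * Moments of centered segments *)

Section CenteredMoments.
Variables (R : realType) (D : starAlgType R[i]) (A : dprobSpace D).
Let kP := cumulant_bimodular A.
Let kappa := @cumulant _ _ A.

Definition centered (x : A) : A := x - dincl A (cexp A x).

Lemma cexp_centered x : cexp A (centered x) = 0.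
Proof. by rewrite /centered linearB /= dinclK subrr. Qed.

Section Words.
Variable n : nat.
Implicit Types (p w y : seq ('I_n * A)) (ys : seq (seq ('I_n * A)))
  (P : {set {set 'I_n}}).

Definition stval (st : D * seq ('I_n * A)) : A :=
  dincl A st.1 * \prod_(x <- unzip2 st.2) x.

Lemma stval_app st d : stval (app st d) = stval st * dincl A d.
Proof.
case: st => g; elim/last_ind => [|w [i x] _].
  by rewrite app_nil /stval /= big_nil !mulr1 rmorphM.
by rewrite app_rcons /stval /= /unzip2 !map_rcons !big_rcons /= !mulrA.
Qed.

(** The blocks of P1 lie in y, hence are disjoint from every later segment. *)
Lemma unsaturatedU (p y : seq 'I_n) zs P1 P2 : osorted (p ++ y ++ flatten zs) ->
  ncpart y P1 ->
  all (fun z => ~~ saturated (P1 :|: P2) [set i in z]) zs =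
  all (fun z => ~~ saturated P2 [set i in z]) zs.
Proof.
move=> s3 /andP[p1 _]; apply: eq_in_all => z zzs; congr (~~ _).
apply/saturatedP/saturatedP => h B BP; first by apply: h; rewrite inE BP orbT.
case/finset.setUP: BP => [B1|]; last exact: h.
right; apply: (@disjoint_set_of _ B z y); last exact: mem_block p1 B1.
rewrite uniq_catC; apply: subseq_uniq (osorted_uniq s3).
apply: subseq_trans (suffix_subseq p _); apply: cat_subseq => //.
by case/splitPr: zzs => z1 z2; rewrite flatten_cat /=;
  apply: subseq_trans (suffix_subseq _ _); apply: prefix_subseq.
Qed.

(** Expand the first centered factor. Its leading term puts no condition on y. In the subtracted
    term the moment of y is inserted as a coefficient, and by [N_union] it sums over exactly the
    partitions that saturate y. The difference keeps the unsaturated ones; [st] is the prefix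
    already expanded. *)
Lemma moment_centered ys st : osorted (unzip1 (st.2 ++ flatten ys)) ->
  cexp A (stval st * \prod_(y <- ys) centered (\prod_(x <- unzip2 y) x)) =
  \sum_(P | ncpart (unzip1 (st.2 ++ flatten ys)) P &&
            all (fun y => ~~ saturated P [set i in unzip1 y]) ys)
     N kappa P (scat st (flatten ys)).
Proof.
elim: ys st => [|y ys IHys] st.
  rewrite cats0 big_nil mulr1 scat0 => s1; rewrite cexpMl moment_ncpart //.
  rewrite mulr_sumr; apply: eq_big => [P|P _]; first by rewrite andbT.
  by rewrite /N -Nrec_mulg mulr1 -surjective_pairing.
rewrite big_cons [flatten _]/= => s3.
have s3' : osorted (unzip1 st.2 ++ unzip1 y ++ flatten (map (@unzip1 _ _) ys)).
  move: s3; rewrite !unzip1_cat; congr (osorted (_ ++ _ ++ _)).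
  by rewrite /unzip1 map_flatten.
have fE : unzip1 (flatten ys) = flatten (map (@unzip1 _ _) ys) :> seq 'I_n.
  by rewrite /unzip1 map_flatten.
set Z := \prod_(y <- ys) _; set d := \prod_(x <- _) _.
have -> : stval st * (centered d * Z) =
    stval (scat st y) * Z - stval (app st (cexp A d)) * Z.
  rewrite stval_app /centered mulrA mulrBr mulrBl; congr (_ * _ - _).
  by rewrite /stval /scat /= /unzip2 map_cat big_cat mulrA.
rewrite linearB /= IHys /=; last by rewrite -catA.
rewrite scatA -!catA.
rewrite [X in X - _](bigID (fun P => saturated P [set i in unzip1 y])) /=.
rewrite [X in _ - X](_ : _ = \sum_(P | [&& ncpart (unzip1 (st.2 ++ y ++ flatten ys)) P,
  all (fun y => ~~ saturated P [set i in unzip1 y]) ys &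
  saturated P [set i in unzip1 y]]) N kappa P (scat st (y ++ flatten ys))).
  rewrite (eq_bigl _ _ (fun P => esym (andbA _ _ _))) addrC addrK.
  by apply: eq_bigl => P; rewrite andbCA andbC andbA andbC.
rewrite !unzip1_cat fE (@sum_saturated _ _ _ _ s3'); last first.
  move=> P1 P2 nc1 _; have := unsaturatedU P2 s3' nc1.
  by rewrite !all_map.
rewrite /d moment_ncpart; last exact: osorted_catl s3'.
have appS (I : finType) (a : pred I) (F : I -> D) :
    cexp A (stval (app st (\sum_(i | a i) F i)) * Z) =
    \sum_(i | a i) cexp A (stval (app st (F i)) * Z).
  rewrite stval_app linear_sum mulr_sumr mulr_suml linear_sum.
  by apply: eq_bigr => i _; rewrite stval_app.
rewrite appS; apply: eq_bigr => P1 nc1.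
rewrite IHys; last first.
  rewrite !unzip1_cat unzip1_app fE; exact: osorted_outer s3'.
rewrite unzip1_cat unzip1_app fE; apply: eq_bigr => P2 /andP[/andP[p2 _] _].
rewrite -[st in RHS]app1 N_union //.
  by rewrite !unzip1_cat fE.
Qed.

End Words.
End CenteredMoments.

(** * Alternating runs and even alternating blocks *)

Section Alternation.

Fixpoint altl (b : bool) (k : nat) : seq bool :=
  if k is k'.+1 then b :: altl (~~ b) k' else [::].

Definition is_alt (l : seq bool) := l == altl (head true l) (size l).

Definition even_alt l := is_alt l && ~~ odd (size l).

Lemma size_altl b k : size (altl b k) = k.
Proof. by elim: k b => //= k IHk b; rewrite IHk. Qed.

Lemma is_altP l : reflect (exists b k, l = altl b k) (is_alt l).
Proof.
apply: (iffP eqP) => [->|[b [k ->]]]; first by do 2!eexists.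
by rewrite size_altl; case: k.
Qed.

Lemma altl_cat b k l : altl b (k + l)%N = altl b k ++ altl (b (+) odd k) l.
Proof.
elim: k b => [|k IHk] b; first by rewrite addbF.
by rewrite addSn /= IHk addbN addNb.
Qed.

Lemma last_altl b k c : last c (altl b k.+1) = b (+) odd k.
Proof.
elim: k b c => [|k IHk] b c; first by rewrite addbF.
by rewrite -[altl b k.+2]/(b :: altl (~~ b) k.+1) last_cons IHk addNb addbN.
Qed.

Lemma altl_cat_inv b k l l' : altl b k = l ++ l' ->
  l = altl b (size l) /\ l' = altl (b (+) odd (size l)) (size l').
Proof.
move=> E; have : k = (size l + size l')%N by rewrite -size_cat -E size_altl.
move=> kE; move: E; rewrite kE altl_cat => /eqP.
by rewrite eqseq_cat ?size_altl // => /andP[/eqP-> /eqP->].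
Qed.

(** An even number of removed letters does not shift the phase of what follows, so alternation and
    the last letter survive. *)
Lemma altl_remove b k l1 l2 l3 : altl b k = l1 ++ l2 ++ l3 ->
  ~~ odd (size l2) -> l1 ++ l3 = altl b (size (l1 ++ l3)) /\
  ((size l1 + size l3)%N = 0%N \/ last true (l1 ++ l3) = last true (altl b k)).
Proof.
move=> E ev2; have [E1 E23] := altl_cat_inv E.
have [E2 E3] := altl_cat_inv (esym E23); rewrite (negbTE ev2) addbF in E3.
split; first by rewrite size_cat altl_cat -E1 -E3.
have : l1 ++ l3 = altl b (size l1 + size l3)%N by rewrite altl_cat -E1 -E3.
have : k = (size l1 + (size l2 + size l3))%N by rewrite -!size_cat -E size_altl.
case s13: (size l1 + size l3)%N => [|j]; first by left.
move=> kE ->; right; have -> : k = (size l2 + j).+1 by lia.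
by rewrite !last_altl oddD (negbTE ev2).
Qed.

Variables (n : nat) (s : 'I_n -> bool).
Implicit Types (y u t : seq 'I_n) (ys : seq (seq 'I_n)) (P : {set {set 'I_n}}).

(** Equal letters on both sides of each junction make the alternating runs maximal. *)
Definition runs (L : seq (seq bool)) :=
  all (fun l => (l != [::]) && is_alt l) L &&
  sorted (fun l l' => last true l == head true l') L.

(** An alternating word has no two equal consecutive letters, so it cannot straddle a junction. *)
Lemma interval_in_run ys u b t : flatten ys = u ++ b ++ t ->
  runs (map (map s) ys) -> b != [::] -> is_alt (map s b) ->
  exists ys1 u' t' ys2, [/\ ys = ys1 ++ (u' ++ b ++ t') :: ys2,
    u = flatten ys1 ++ u' & t = t' ++ flatten ys2].
Proof.
elim: ys u => [|y ys IHys] u /=.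
  by move=> E _ b0 _; case: u b b0 E => [|? ?] [|? ?].
move=> E /andP[/andP[/andP[y0 ya] ays] js] b0 ba.
have [le_y|lt_u] := leqP (size y) (size u).
  have [m [uE E']] := cat_eq_cat E le_y.
  have ry : runs (map (map s) ys) by apply/andP; split; [exact: ays | exact: path_sorted js].
  have [ys1 [u' [t' [ys2 [ysE mE tE]]]]] := IHys m E' ry b0 ba.
  by exists (y :: ys1), u', t', ys2; split; rewrite ?uE ?mE ?ysE //= catA.
have [y' [yE E']] := cat_eq_cat (esym E) (ltnW lt_u).
have [le_b|lt_y'] := leqP (size b) (size y').
  have [t' [y'E tE]] := cat_eq_cat E' le_b.
  by exists [::], u, t', ys; rewrite yE y'E.
have [b' [bE E'']] := cat_eq_cat (esym E') (ltnW lt_y').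
case: y' yE E' bE lt_y' => [|x y'] yE E' bE lt_y'.
  by rewrite yE cats0 ltnn in lt_u.
case: b' bE E'' => [|x' b'] bE E''; first by rewrite bE cats0 ltnn in lt_y'.
case: ys E js {IHys E'} ays E'' => [|z ys] E js //= /andP[/andP[z0 _] _].
case: z z0 E js => [|z0 z] //= _ E js [xE _]; subst z0.
move: js => /andP[/eqP js _].
(* Here the block straddles a junction: alternation within it makes the two letters there different,
   against [js]. *)
case/is_altP: ba => c [k]; rewrite bE map_cat => /esym/altl_cat_inv[+ +].
rewrite /= => E1 [+ _]; rewrite -js yE map_cat last_cat /=.
have -> : last (s x) (map s y') = last true (map s (x :: y')) by [].
rewrite -[map s (x :: y')]/(s x :: map s y') E1.
rewrite -[c :: _]/(altl c (size (map s y')).+1) last_altl.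
by case: c {E1}; case: odd.
Qed.

(** The first and last letters of the shortened run agree with the old ones, so both of its
    junctions survive. *)
Lemma runs_replace (ys1 ys2 : seq (seq bool)) (l1 l2 l3 : seq bool) :
  runs (ys1 ++ (l1 ++ l2 ++ l3) :: ys2) -> even_alt l2 ->
  l1 ++ l3 != [::] -> runs (ys1 ++ (l1 ++ l3) :: ys2).
Proof.
move=> /andP[] + + /andP[a2 e2] n0.
rewrite all_cat => /and3P[all1 /andP[_ /is_altP[b [k kE]]] all2] js.
have [E [s0|lastE]] := altl_remove (esym kE) e2.
  by move: n0; rewrite -size_eq0 size_cat s0.
have sz : (0 < size (l1 ++ l3))%N by rewrite lt0n size_eq0.
have k0 : (0 < k)%N.
  by rewrite -(size_altl b k) -kE; move: sz; rewrite !size_cat; lia.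
have headE : head true (l1 ++ l3) = head true (l1 ++ l2 ++ l3).
  by rewrite E kE; case: (size _) sz => // j _; case: (k) k0.
apply/andP; split.
  rewrite all_cat; apply/and3P; split=> //; rewrite n0; apply/is_altP.
  by do 2!eexists; apply: E.
rewrite -kE in lastE; move: js; case: ys1 {all1} => [|y ys1] /=.
  by case: ys2 {all2} => //= z ys2; rewrite lastE.
rewrite !cat_path /= headE => /and3P[-> ->] /=.
by case: ys2 {all2} => //= z ys2; rewrite lastE.
Qed.

Lemma alternating_saturated P ys : ys != [::] -> osorted (flatten ys) ->
  ncpart (flatten ys) P -> runs (map (map s) ys) ->
  (forall B, B \in P -> even_alt (map s (enum B))) ->
  has (fun y => saturated P [set i in y]) ys.
Proof.
move Em: #|P| => m; elim: m P ys Em => [|m IHm] P ys cP ys0 so nc rys evP.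
all: have [partP _] := andP nc.
  move/eqP: cP; rewrite cards_eq0 => /eqP P0.
  have := cover_partition partP; rewrite P0 /finset.cover finset.big_set0.
  case: ys ys0 so nc rys partP => [//|[//|i y] ys] _ _ _ _ _ /setP/(_ i).
  by rewrite !inE eqxx.
have f0 : flatten ys != [::].
  by case: ys ys0 rys {so nc partP} => [//|[//|i y] ys].
have [B BP iB] := exists_interval so f0 nc.
have B0 := partition_neq0 partP BP.
have /andP[aB oB] := evP B BP.
have eB0 : enum B != [::] by rewrite -size_eq0 -cardE cards_eq0.
have [u [t fE]] := infixP iB.
have [ys1 [u' [t' [ys2 [ysE uE tE]]]]] := interval_in_run fE rys eB0 aB.
(* If the block is its entire run, that run is saturated. Otherwise the shortened run is still
   present and the induction hypothesis applies. *)
have [z0|z0] := eqVneq (u' ++ t') [::].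
  have [u'0 t'0] : u' = [::] /\ t' = [::] by case: (u') z0; case: (t').
  rewrite ysE u'0 t'0 cats0 has_cat /= orbC; apply/orP; left; apply/orP; left.
  apply/saturatedP => C CP.
  have -> : [set i in enum B] = B by apply/setP => i; rewrite inE mem_enum.
  have [->|CB] := eqVneq C B; [by left | right].
  have /and3P[_ /finset.trivIsetP tiP _] := partP; exact: tiP.
have cPB : #|P :\ B| = m by move: cP; rewrite (cardsD1 B) BP => -[].
have so1 := so; rewrite fE in so1.
have zE : flatten (ys1 ++ (u' ++ t') :: ys2) = u ++ t.
  by rewrite flatten_cat /= uE tE -!catA.
have /hasP[z zin /saturatedP zsat] :
    has (fun z => saturated (P :\ B) [set i in z]) (ys1 ++ (u' ++ t') :: ys2).
  apply: IHm; rewrite ?zE //.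
  - by case: (ys1).
  - exact: osorted_outer so1.
  - by apply: (ncpartD1 so1 _ (erefl _) BP); rewrite -fE.
  - move: rys; rewrite ysE !map_cat /= !map_cat => /runs_replace; apply.
      exact: evP.
    by move: z0; rewrite -!map_cat -!size_eq0 size_map.
  - by move=> C /setD1P[_ /evP].
have nB i : i \in u ++ t -> i \notin B.
  have := osorted_uniq so1; rewrite uniq_catCA cat_uniq => /and3P[_ /hasPn h _].
  by move=> /h /=; rewrite mem_enum.
have zB C : C \in P -> C != B -> [disjoint C & B].
  by move=> CP; have /and3P[_ /finset.trivIsetP tiP _] := partP; apply: tiP.
have dzB : [disjoint B & [set i in z]].
  rewrite finset.disjoints_subset; apply/fintype.subsetP => i iB'; rewrite !inE.
  apply/negP => iz; have : i \in u ++ t by rewrite -zE; apply/flattenP; exists z.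
  by move=> /nB; rewrite iB'.
(* A saturated segment for the smaller partition yields one for P: B is put back into the shortened
   run, and every other run is disjoint from B. *)
apply/hasP; move: zin; rewrite mem_cat inE orbCA => /orP[/eqP zE'|zin].
  exists (u' ++ enum B ++ t'); first by rewrite ysE mem_cat mem_head orbT.
  have yE : [set i in u' ++ enum B ++ t'] = B :|: [set i in z].
    by apply/setP => i; rewrite zE' !inE !mem_cat mem_enum orbCA.
  apply/saturatedP => C CP; rewrite yE.
  have [->|CB] := eqVneq C B; first by left; apply: finset.subsetUl.
  have [|Cz|Cz] := zsat C; first by rewrite in_setD1 CB.
    by left; rewrite (fintype.subset_trans Cz) // finset.subsetUr.
  right; rewrite finset.disjoints_subset finset.setCU finset.subsetI.
  by rewrite -!finset.disjoints_subset zB.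
exists z; first by rewrite ysE mem_cat inE orbCA zin orbT.
apply/saturatedP => C CP; have [->|CB] := eqVneq C B; first by right.
by apply: zsat; rewrite in_setD1 CB.
Qed.

End Alternation.

(** * Alternating words and their cumulants *)

Section Spans.
Variables (R : realType) (D : starAlgType R[i]) (A : dprobSpace D).
Implicit Types (X : A -> Prop).

Lemma lspan_ind X (Q : A -> Prop) : Q 0 ->
  (forall c x y, X x -> Q y -> Q (c *: x + y)) ->
  forall x, lspan X x -> Q x.
Proof.
move=> Q0 QD x [n [c [v [Xv ->]]]].
elim: n c v Xv => [|n IHn] c v Xv; first by rewrite big_ord0.
by rewrite big_ord_recl; apply: QD => //; apply: IHn.
Qed.

Lemma lspan0 X : lspan X 0.
Proof. by exists 0%N, (fun=> 0), (fun=> 0); split=> [[]//|]; rewrite big_ord0. Qed.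

Lemma lspan_cons X c x y : X x -> lspan X y -> lspan X (c *: x + y).
Proof.
move=> Xx [n [d [v [Xv ->]]]].
exists n.+1, (fun i => if unlift ord0 i is Some j then d j else c),
  (fun i => if unlift ord0 i is Some j then v j else x); split.
  by move=> i; case: unliftP => [j|] _.
rewrite big_ord_recl unlift_none; congr (_ + _).
by apply: eq_bigr => i _; rewrite liftK.
Qed.

Lemma lspan_mem X x : X x -> lspan X x.
Proof. by move=> Xx; rewrite -[x]addr0 -[x]scale1r; apply: lspan_cons (lspan0 X). Qed.

Lemma lspan_sub X Y x : (forall y, X y -> lspan Y y) -> lspan X x -> lspan Y x.
Proof.
have lD y z : lspan Y y -> lspan Y z -> lspan Y (y + z).
  move=> Yy Yz; move: y Yy; apply: lspan_ind; first by rewrite add0r.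
  by move=> c u v Yu; rewrite -addrA; apply: lspan_cons.
have lZ c y : lspan Y y -> lspan Y (c *: y).
  move: y; apply: lspan_ind; first by rewrite scaler0; apply: lspan0.
  by move=> e u v Yu; rewrite scalerDr scalerA; apply: lspan_cons.
move=> h; move: x; apply: lspan_ind; first exact: lspan0.
by move=> c u v /h Yu; apply: lD; apply: lZ.
Qed.

(** Each entry carries the second index of its factor; the first index is inherited from the
    preceding entry, or is [i] at the start. This encodes the matching of indices in (1). *)
Fixpoint chain (X : bool -> bool -> A -> Prop) (i : bool) (l : seq (A * bool)) :=
  if l is (x, j) :: l' then X i j x /\ chain X j l' else True.

Definition chain_end (i : bool) (l : seq (A * bool)) := last i (unzip2 l).

Definition lprod (l : seq (A * bool)) : A := \prod_(z <- l) z.1.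

Lemma chain_cat (X : bool -> bool -> A -> Prop) i l1 l2 :
  chain X i (l1 ++ l2) <-> chain X i l1 /\ chain X (chain_end i l1) l2.
Proof.
elim: l1 i => [|[x j] l1 IHl1] i /=; first by tauto.
by have := IHl1 j; rewrite /chain_end /=; tauto.
Qed.

Lemma lprod_cat l1 l2 : lprod (l1 ++ l2) = lprod l1 * lprod l2.
Proof. exact: big_cat. Qed.

Lemma lprod_nil : lprod [::] = 1.
Proof. exact: big_nil. Qed.

(** Multilinearity, used one factor at a time; the prefix [l1] collects the factors already replaced
    by generators. *)
Lemma chain_lspan (X Y : bool -> bool -> A -> Prop) :
  (forall i l, l != [::] -> chain X i l -> cexp A (lprod l) = 0) ->
  (forall i j y, Y i j y -> lspan (X i j) y) ->
  forall i l, l != [::] -> chain Y i l -> cexp A (lprod l) = 0.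
Proof.
move=> hX YX i l l0 Yl.
suff H l1 : chain Y (chain_end i l1) l -> l1 ++ l != [::] -> chain X i l1 ->
    cexp A (lprod l1 * lprod l) = 0.
  by have := H [::] Yl l0 I; rewrite /lprod big_nil mul1r.
elim: l l1 {l0 Yl} => [|[y j] l IHl] l1.
  move=> _ + X1; rewrite -lprod_cat cats0 => l10; exact: (hX i).
move=> [/YX Xy Yl] _ X1.
have -> : lprod ((y, j) :: l) = y * lprod l by rewrite /lprod big_cons.
rewrite mulrA.
move: y Xy; apply: lspan_ind; first by rewrite mulr0 mul0r linear0.
move=> c x y Xx IHy; rewrite mulrDr mulrDl linearD /= IHy addr0.
rewrite -scalerAr -scalerAl linearZ /=.
have -> : lprod l1 * x = lprod (l1 ++ [:: (x, j)]).
  by rewrite lprod_cat /lprod big_seq1.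
rewrite IHl ?scaler0 //.
- by rewrite /chain_end /unzip2 map_cat last_cat.
- by case: (l1).
- by apply/chain_cat.
Qed.

Lemma chainP (X : bool -> bool -> A -> Prop) :
  (forall (n : nat) (i : nat -> bool) (x : nat -> A), (0 < n)%N ->
      (forall k, (k < n)%N -> X (i k) (i k.+1) (x k)) ->
      cexp A (\prod_(k < n) x k) = 0) <->
  (forall i l, l != [::] -> chain X i l -> cexp A (lprod l) = 0).
Proof.
split=> [h i l l0 Xl|h n i x n0 Xx].
  pose ii k := if k is k'.+1 then (nth (0, true) l k').2 else i.
  have := h (size l) ii (fun k => (nth (0, true) l k).1).
  rewrite /lprod (big_nth (0, true)) big_mkord; apply.
    by rewrite lt0n size_eq0.
  rewrite {h l0}/ii; elim: l i Xl => [//|[x j] l IHl] i [Xx Xl] [|k] //=.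
  rewrite ltnS => /(IHl _ Xl); by case: k.
pose l m p := [seq (x k, i k.+1) | k <- iota m p].
have Xl m p : (m + p <= n)%N -> chain X (i m) (l m p).
  elim: p m => [//|p IHp] m le_n /=; split; first by apply: Xx; lia.
  by apply: IHp; lia.
have := h (i 0%N) (l 0%N n); rewrite /lprod big_map.
have -> : iota 0 n = index_iota 0 n by rewrite /index_iota subn0.
rewrite big_mkord; apply; last exact: Xl.
by rewrite /l; case: (n) n0.
Qed.

End Spans.

Section Letters.
Variables (R : realType) (D : starAlgType R[i]) (A : dprobSpace D) (a : A).
Implicit Types (x y : A) (d e : D) (w v : seq A).

Definition letter (b : bool) (x : A) :=
  exists d e, x = dincl A d * spow a b * dincl A e.

Lemma letterMl b x d : letter b x -> letter b (dincl A d * x).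
Proof. by case=> e [f ->]; exists (d * e), f; rewrite rmorphM !mulrA. Qed.

Lemma letterMr b x d : letter b x -> letter b (x * dincl A d).
Proof. by case=> e [f ->]; exists e, (f * d); rewrite rmorphM !mulrA. Qed.

Fixpoint letters (l : seq bool) w :=
  match l, w with
  | b :: l', x :: w' => letter b x /\ letters l' w'
  | [::], [::] => True
  | _, _ => False
  end.

Lemma letters_size l w : letters l w -> size w = size l.
Proof. by elim: l w => [|b l IHl] [|x w] //= [_ /IHl->]. Qed.

Lemma letters_cat l l' w w' : size w = size l ->
  letters (l ++ l') (w ++ w') <-> letters l w /\ letters l' w'.
Proof.
elim: l w => [|b l IHl] [|x w] //=; first by tauto.
by case=> /IHl; tauto.
Qed.

Lemma alt_prodS s m x : alt_prod a s m.+1 x <->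
  exists d y, alt_prod a (~~ s) m y /\ x = dincl A d * spow a s * y.
Proof.
split=> [[d ->]|[d [y [[e ->] ->]]]].
  exists (d 0%N), (dincl A (d 1%N) *
    \prod_(k < m) (spow a (~~ s (+) odd k) * dincl A (d k.+2))).
  split; first by exists (fun k => d k.+1).
  rewrite big_ord_recl /= addbF !mulrA; congr (_ * _).
  by apply: eq_bigr => k _; rewrite /= addbN addNb.
exists (fun k => if k is k'.+1 then e k' else d) => /=.
rewrite big_ord_recl /= addbF !mulrA; congr (_ * _).
by apply: eq_bigr => k _; rewrite /= addbN addNb.
Qed.

Lemma alt_prod0 s x : alt_prod a s 0 x <-> exists d, x = dincl A d.
Proof.
split=> [[d ->]|[d ->]]; first by exists (d 0%N); rewrite big_ord0 mulr1.
by exists (fun=> d); rewrite big_ord0 mulr1.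
Qed.

Lemma alt_prodMl s m x d : alt_prod a s m x -> alt_prod a s m (dincl A d * x).
Proof.
case: m => [|m].
  by move=> /alt_prod0[e ->]; apply/alt_prod0; exists (d * e); rewrite rmorphM.
move=> /alt_prodS[e [y [hy ->]]]; apply/alt_prodS; exists (d * e), y.
by rewrite rmorphM !mulrA.
Qed.

Lemma alt_prod_letters s m x : alt_prod a s m.+1 x ->
  exists w, letters (altl s m.+1) w /\ x = \prod_(y <- w) y.
Proof.
elim: m s x => [|m IHm] s x /alt_prodS[d [y [hy ->]]].
  have [e ->] := (alt_prod0 _ _).1 hy.
  exists [:: dincl A d * spow a s * dincl A e]; rewrite big_seq1.
  by split=> //=; split=> //; exists d, e.
have [w [Lw ->]] := IHm _ _ hy.
exists (dincl A d * spow a s :: w); rewrite big_cons; split=> //; split=> //.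
by exists d, 1; rewrite rmorph1 mulr1.
Qed.

Lemma letters_alt_prod s m w : letters (altl s m) w ->
  alt_prod a s m (\prod_(y <- w) y).
Proof.
elim: m s w => [|m IHm] s [|x w] //=.
  by move=> _; apply/alt_prod0; exists 1; rewrite big_nil rmorph1.
case=> -[d [e ->]] /IHm Lw; apply/alt_prodS; rewrite big_cons.
exists d, (dincl A e * \prod_(y <- w) y); split; first exact: alt_prodMl.
by rewrite !mulrA.
Qed.

(** An element with indices i, j starts with exponent [~~ i] and, unless it has no letters, ends
    with exponent [~~ j]; the parity of m makes the two ends consistent. Neighbours in a chain thus
    meet in equal exponents. *)
Definition alt_mom i j x :=
  exists m, odd m = (i == j) /\ alt_prod a (~~ i) m x.

Lemma PmxE i j x : Pmx a i j x <->
  lspan (alt_mom i j) x /\ (i != j -> cexp A x = 0).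
Proof.
have lE s (p : bool) (f : nat -> nat) : (forall k, f k = (k.*2 + p)%N) ->
    lspan (\bigcup_k alt_prod a s (f k))%classic x <->
    lspan (fun x => exists m, odd m = p /\ alt_prod a s m x) x.
  move=> fE; split; apply: lspan_sub => y.
    move=> [k _]; rewrite fE => hy; apply: lspan_mem; exists (k.*2 + p)%N.
    by rewrite oddD odd_double; case: (p) hy.
  move=> [m [om hy]]; apply: lspan_mem; exists (m./2) => //.
  by rewrite fE -om addnC odd_double_half.
have E0 k : k.*2 = (k.*2 + false)%N by rewrite addn0.
have E1 k : k.*2.+1 = (k.*2 + true)%N by rewrite addn1.
case: i; case: j; rewrite /alt_mom /=.
all: split=> [h|[/lE h e]].
- by split=> //; apply/(lE _ _ _ E1).
- exact: (h _ E1).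
- by case: h => /(lE _ _ _ E0) h e; split.
- by split; [apply: h E0 | apply: e].
- by case: h => /(lE _ _ _ E0) h e; split.
- by split; [apply: h E0 | apply: e].
- by split=> //; apply/(lE _ _ _ E1).
- exact: (h _ E1).
Qed.

Lemma nth_altl b k c i : (i < k)%N -> nth c (altl b k) i = b (+) odd i.
Proof.
elim: k b i => [//|k IHk] b [|i] /=; first by rewrite addbF.
by rewrite ltnS => /IHk->; rewrite addNb addbN.
Qed.

(** Balancedness moves the right coefficient of each letter into the left coefficient of the next;
    the last one leaves the cumulant as e. The prefix v holds the letters already normalized. *)
Lemma cumulant_letters_normal w l v : letters l w -> l != [::] ->
  exists ds e, size ds = size l /\
    cumulant (v ++ w) = cumulant (v ++
      [seq dincl A z.2 * spow a z.1 | z <- zip l ds]) * e.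
Proof.
have [HL HR HB] := cumulant_bimodular A.
elim: l w v => [//|b l IHl] [//|x w] v [[d [e ->]] Lw] _.
case: l w Lw IHl => [|b' l] [|y w] //.
  move=> _ _; exists [:: d], e; split=> //=.
  by rewrite !cats1 HR.
move=> [Ly Lw] IHl.
have [|ds [e' [sds E]]] := IHl (dincl A e * y :: w) (rcons v (dincl A d * spow a b)) _ isT.
  by split=> //; apply: letterMl.
exists (d :: ds), e'; split; first by rewrite /= sds.
by rewrite -cat_rcons HB E /= -cat_rcons.
Qed.

Lemma cumulant_letters :
  (forall n (s : nat -> bool) (d : nat -> D), (0 < n)%N ->
      ~ alternating n s ->
      cumulant [seq dincl A (d k) * spow a (s k) | k <- iota 0 n] = 0) ->
  forall w l, letters l w -> ~~ even_alt l -> cumulant w = 0.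
Proof.
move=> h w l Lw nalt.
have l0 : l != [::] by apply: contraNneq nalt => ->.
have [ds [e [sds /= ->]]] := cumulant_letters_normal [::] Lw l0.
have := h (size l) (nth true l) (nth 0 ds).
have -> : [seq dincl A (nth 0 ds k) * spow a (nth true l k) | k <- iota 0 (size l)] =
    [seq dincl A z.2 * spow a z.1 | z <- zip l ds].
  apply: (@eq_from_nth _ 0); first by rewrite !size_map size_iota size1_zip // sds.
  rewrite size_map size_iota => i lt_i; rewrite (nth_map 0%N) ?size_iota //.
  rewrite (nth_map (true, 0)) ?size1_zip ?sds // nth_iota // add0n.
  by rewrite nth_zip.
move=> -> //; first by rewrite mul0r.
  by rewrite lt0n size_eq0.
case=> ev [b hb]; move/negP: nalt; apply; rewrite /even_alt ev andbT.
apply/is_altP; exists b, (size l); apply: (@eq_from_nth _ true).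
  by rewrite size_altl.
by move=> i lt_i; rewrite hb // nth_altl.
Qed.

Lemma moment_words (YS : seq (seq A)) n : size (flatten YS) = n ->
  cexp A (\prod_(y <- YS) centered (\prod_(x <- y) x)) =
  \sum_(P | ncpart (enum 'I_n) P &&
      all (fun z => ~~ saturated P [set i in z]) (reshape (shape YS) (enum 'I_n)))
    N (@cumulant _ _ A) P (1, zip (enum 'I_n) (flatten YS)).
Proof.
move=> sn; pose W := zip (enum 'I_n) (flatten YS).
have sW : size W = n by rewrite size1_zip size_enum_ord // sn.
have W1 : unzip1 W = enum 'I_n by rewrite unzip1_zip_enum.
have W2 : unzip2 W = flatten YS by rewrite unzip2_zip // size_enum_ord sn.
have fW : flatten (reshape (shape YS) W) = W.
  by rewrite reshapeKr // sW -sn size_flatten.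
have := @moment_centered _ _ A n (reshape (shape YS) W) (1, [::]).
rewrite scatE /stval /= fW W1 rmorph1 big_nil !mul1r => /(_ (osorted_enumT n)).
have -> : \prod_(y <- reshape (shape YS) W) centered (\prod_(x <- unzip2 y) x) =
    \prod_(y <- YS) centered (\prod_(x <- y) x).
  have -> : YS = map (@unzip2 _ _) (reshape (shape YS) W).
    by rewrite /unzip2 map_reshape -/(unzip2 W) W2 flattenK.
  by rewrite big_map /unzip2 map_reshape -/(unzip2 W) W2 flattenK.
move=> ->; apply: eq_bigl => P; congr (_ && _).
by rewrite -W1 /unzip1 -map_reshape all_map.
Qed.

Section Vanish.
Variables (n : nat) (kappa : seq A -> D) (s : 'I_n -> bool).
Hypothesis kP : bimodular kappa.

(** Balancedness pushes the zero from letter to letter to the end of the word, where right linearity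
    turns it into a factor of the value. *)
Lemma Nrec_zero m (P : {set {set 'I_n}}) st t : finset.set0 \notin P ->
  uniq (unzip1 (st.2 ++ t)) -> Nrec kappa m P (scat (app st 0) t) = 0.
Proof.
elim: t st => [|[l y] t IHt] st P0 U.
  rewrite scat0 Nrec_app ?mulr0 //; by rewrite cats0 in U.
rewrite Nrec_balanced // rmorph0 mul0r.
have := IHt (scat st [:: (l, y)]) P0; rewrite app_scat //.
have -> : (app (1, [:: (l, y)]) 0).2 = [:: (l, 0)] :> seq ('I_n * A).
  by rewrite /app /= rmorph0 mulr0.
by rewrite scatA; apply; rewrite /= -catA.
Qed.

(** Before B is removed, its letters may absorb coefficients from blocks nested between them, which
    does not change their labels. Hence the assumption on [kappa] ranges over all words with the
    labels of B. *)
Lemma N_vanish (P : {set {set 'I_n}}) B g (w : seq ('I_n * A)) :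
  uniq (unzip1 w) -> finset.set0 \notin P -> B \in P ->
  (forall k x, (k, x) \in w -> letter (s k) x) ->
  (forall v, letters (map s (enum B)) v -> kappa v = 0) ->
  N kappa P (g, w) = 0.
Proof.
move=> U P0 BP Lw kB; rewrite /N.
move Em: #|P| => m; elim: m P g w Em U P0 BP Lw => [|m IHm] P g w cP U P0 BP Lw.
  by move/eqP: cP; rewrite cards_eq0 => /eqP P0'; rewrite P0' inE in BP.
rewrite NrecE; case: pickP => [C /andP[CP iC]|//].
have C0 := block_neq0 P0 CP.
have [u [v [t [wE E]]]] := split_interval iC.
rewrite /= in wE; subst w; rewrite rem_stE //.
have Uut := uniq_rem U.
have [CB|CB] := eqVneq C B.
  have -> : kappa (unzip2 v) = 0.
    apply: kB; rewrite -CB -E.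
    have : forall k x, (k, x) \in v -> letter (s k) x.
      by move=> k x kv; apply: Lw; rewrite !mem_cat kv orbT.
    elim: (v) => [//|[k x] v' IHv] h /=; split; first by apply: h; rewrite mem_head.
    by apply: IHv => k' x' h'; apply: h; rewrite inE h' orbT.
  by rewrite Nrec_zero ?set0_notinD1.
rewrite (surjective_pairing (scat _ _)); apply: IHm => //.
- by move: cP; rewrite (cardsD1 C) CP => -[].
- by rewrite /= unzip1_cat unzip1_app -unzip1_cat.
- exact: set0_notinD1.
- by rewrite in_setD1 eq_sym CB.
move=> k x; rewrite /= mem_cat => /orP[|kt]; last first.
  by apply: Lw; rewrite !mem_cat kt !orbT.
have : forall k x, (k, x) \in u -> letter (s k) x.
  by move=> k' x' ku; apply: Lw; rewrite !mem_cat ku.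
case/lastP: (u) => [//|u' [k' x']] Lu; rewrite app_rcons /= mem_rcons inE.
case/orP => [/eqP[-> ->]|ku]; last by apply: Lu; rewrite mem_rcons inE ku orbT.
by apply: letterMr; apply: Lu; rewrite mem_rcons mem_head.
Qed.
End Vanish.

End Letters.

(** * Vanishing moments against vanishing cumulants *)

Section MomentsCumulants.
Variables (R : realType) (D : starAlgType R[i]) (A : dprobSpace D) (a : A).
Implicit Types (x y : A) (d e : D) (w v : seq A).
Let kappa := @cumulant _ _ A.
Let kP : bimodular kappa := cumulant_bimodular A.

Definition words_centered (YS : seq (seq A)) : A :=
  \prod_(y <- YS) centered (\prod_(x <- y) x).

Lemma nonalternating_block n (s : 'I_n -> bool) (P : {set {set 'I_n}}) :
  ~~ [forall B in P, even_alt (map s (enum B))] ->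
  exists2 B, B \in P & ~~ even_alt (map s (enum B)).
Proof. by rewrite negb_forall_in => /exists_inP. Qed.

Lemma zip_letters n (s : 'I_n -> bool) (w : seq ('I_n * A)) :
  letters a (map s (unzip1 w)) (unzip2 w) ->
  forall k x, (k, x) \in w -> letter a (s k) x.
Proof.
elim: w => [//|[k x] w IHw] /= [Lx Lw] k' x'; rewrite inE.
by case/orP => [/eqP[-> ->]//|]; apply: IHw.
Qed.

(** The block sizes add up to n, so they are not all even. *)
Lemma odd_block n (s : 'I_n -> bool) (P : {set {set 'I_n}}) :
  ncpart (enum 'I_n) P -> odd n ->
  exists2 B, B \in P & ~~ even_alt (map s (enum B)).
Proof.
move=> /andP[partP _] on; apply: nonalternating_block.
apply: contraL on => /forall_inP alt.
rewrite -[n]card_ord -cardsT -set_of_enumT (card_partition partP) -dvdn2.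
apply: dvdn_sum => B /alt /andP[_]; by rewrite size_map -cardE dvdn2.
Qed.

Section Labels.
Variables (YS : seq (seq A)) (LS : seq (seq bool)).
Hypotheses (sYL : shape YS = shape LS) (Lw : letters a (flatten LS) (flatten YS)).
Let n := size (flatten YS).

Definition label (k : 'I_n) : bool := nth true (flatten LS) k.

Let sL : size (flatten LS) = n.
Proof. by rewrite /n (letters_size Lw). Qed.

Lemma map_label : map label (enum 'I_n) = flatten LS.
Proof.
apply: (@eq_from_nth _ true); first by rewrite size_map size_enum_ord.
move=> i; rewrite size_map size_enum_ord => lt_i.
by rewrite (nth_map (Ordinal lt_i)) ?size_enum_ord // /label nth_enum_ord.
Qed.

Lemma map_label_reshape :
  map (map label) (reshape (shape YS) (enum 'I_n)) = LS.
Proof. by rewrite map_reshape map_label sYL flattenK. Qed.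

Lemma flatten_positions : flatten (reshape (shape YS) (enum 'I_n)) = enum 'I_n.
Proof. by rewrite reshapeKr // size_enum_ord -size_flatten. Qed.

Lemma letters_positions k x :
  (k, x) \in zip (enum 'I_n) (flatten YS) -> letter a (label k) x.
Proof.
apply: zip_letters; rewrite unzip1_zip_enum // map_label unzip2_zip //.
by rewrite size_enum_ord.
Qed.

Lemma unsaturated_block P : runs LS -> LS != [::] -> ncpart (enum 'I_n) P ->
  all (fun z => ~~ saturated P [set i in z]) (reshape (shape YS) (enum 'I_n)) ->
  exists2 B, B \in P & ~~ even_alt (map label (enum B)).
Proof.
move=> rL L0 nc unsat; apply: nonalternating_block.
apply/negP => /forall_inP alt; move: unsat; apply/negP; rewrite -has_predC.
under eq_has => z do rewrite /= negbK.
apply: (@alternating_saturated _ label); rewrite ?flatten_positions //.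
- apply: contraNneq L0 => E; rewrite -size_eq0 -(size_map size) -/(shape LS) -sYL.
  by rewrite -(size_reshape _ (enum 'I_n)) E.
- exact: osorted_enumT.
- by rewrite map_label_reshape.
Qed.

Lemma N_positions_vanish P B : ncpart (enum 'I_n) P -> B \in P ->
  (forall v, letters a (map label (enum B)) v -> kappa v = 0) ->
  N kappa P (1, zip (enum 'I_n) (flatten YS)) = 0.
Proof.
move=> /andP[/and3P[_ _ P0] _] BP kB.
apply: (@N_vanish _ _ _ a _ kappa label kP P B) => //; last exact: letters_positions.
by rewrite unzip1_zip_enum // enum_uniq.
Qed.

End Labels.

Definition vanishing_cumulants := forall w l, letters a l w -> ~~ even_alt l ->
  kappa w = 0.

Definition vanishing_chains :=
  forall i l, l != [::] -> chain (Pmx a) i l -> cexp A (lprod l) = 0.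

Definition alt_centered i j x :=
  exists m (v : A), [/\ odd m = (i == j), alt_prod a (~~ i) m v & x = centered v].

Lemma words_centered_vanish YS LS : vanishing_cumulants ->
  shape YS = shape LS -> letters a (flatten LS) (flatten YS) ->
  runs LS -> LS != [::] -> cexp A (words_centered YS) = 0.
Proof.
move=> kV sYL Lw rL L0; rewrite (moment_words (erefl _)) big1 // => P /andP[nc uns].
have [B BP nalt] := unsaturated_block sYL Lw rL L0 nc uns.
by apply: (N_positions_vanish Lw nc BP) => v Lv; apply: kV Lv nalt.
Qed.

Lemma moment_odd m s x : vanishing_cumulants -> odd m -> alt_prod a s m x ->
  cexp A x = 0.
Proof.
case: m => [//|m] kV om /alt_prod_letters[w [Lw ->]].
have sw := letters_size Lw; rewrite size_altl in sw.
rewrite (moment_N sw) // big1 // => P nc.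
have Lw' : letters a (flatten [:: altl s m.+1]) (flatten [:: w]).
  by rewrite /= !cats0.
have fw : flatten [:: w] = w by rewrite /= cats0.
move: P nc; rewrite -sw -fw => P nc.
have [|B BP nalt] := odd_block (@label [:: w] [:: altl s m.+1]) nc.
  by rewrite fw sw.
by apply: (N_positions_vanish Lw' nc BP) => v Lv; apply: kV Lv nalt.
Qed.

(** Such an x has expectation 0: by definition if i and j differ, by [moment_odd] otherwise. So x
    equals its own centering, and centering is linear. *)
Lemma Pmx_alt_centered i j x : vanishing_cumulants -> Pmx a i j x ->
  lspan (alt_centered i j) x.
Proof.
move=> kV /PmxE[sx ex].
have x0 : cexp A x = 0.
  have [ij|/ex//] := eqVneq i j.
  move: x sx {ex}; apply: lspan_ind; first by rewrite linear0.
  move=> c v y [m [om av]] ey; rewrite linearD linearZ /= ey addr0.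
  by rewrite (moment_odd kV _ av) ?scaler0 // om ij eqxx.
have -> : x = centered x by rewrite /centered x0 rmorph0 subr0.
move: x sx {ex x0}; apply: lspan_ind.
  rewrite /centered linear0 rmorph0 subr0; exact: lspan0.
move=> c v y [m [om av]] ly.
have -> : centered (c *: v + y) = c *: centered v + centered y.
  by rewrite /centered linearP /= linearP scalerBr opprD addrACA.
by apply: lspan_cons ly; exists m, v.
Qed.

(** A factor with no letters is the centering of an element of D, which is 0. Otherwise the index
    shared by two neighbours gives the junction condition of [runs]; the head of the first run is
    recorded for the induction. *)
Lemma alt_centered_words i l : chain alt_centered i l -> l != [::] ->
  lprod l = 0 \/ exists YS LS, [/\ lprod l = words_centered YS,
    shape YS = shape LS, letters a (flatten LS) (flatten YS), runs LS
    & exists L LS', LS = L :: LS' /\ head true L = ~~ i].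
Proof.
elim: l i => [//|[x j] l IHl] i [[m [v [om av ->]]] cl] _.
case: m om av => [|m] om av.
  left; have [d ->] := (alt_prod0 _ _ _).1 av.
  by rewrite /lprod big_cons /centered dinclK subrr mul0r.
have [w [Lw vE]] := alt_prod_letters av.
have sw := letters_size Lw.
have altw : is_alt (altl (~~ i) m.+1) by apply/is_altP; do 2!eexists.
have [l0|l0] := eqVneq l [::].
  subst l; right; exists [:: w], [:: altl (~~ i) m.+1]; split.
  - by rewrite /lprod /words_centered !big_seq1 vE.
  - by rewrite /shape /= sw.
  - by rewrite /= !cats0.
  - by rewrite /runs /= in altw *; rewrite altw.
  - by do 2!eexists.
have [h|[YS [LS [E sYL LYS rL [L [LS' [LE hL]]]]]]] := IHl j cl l0.
  by left; rewrite /lprod big_cons -/(lprod l) h mulr0.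
right; exists (w :: YS), (altl (~~ i) m.+1 :: LS); split.
- by rewrite /lprod /words_centered !big_cons -/(lprod l) E vE.
- by rewrite /shape /= sw -/(shape LS) -sYL.
- exact: ((letters_cat a (flatten LS) (flatten YS) sw).2 (conj Lw LYS)).
- have /andP[aL jL] := rL; apply/andP; split.
    by apply/andP; split; [rewrite altw | exact: aL].
  move: jL; rewrite LE => jL.
  rewrite -[sorted _ _]/((last true (altl (~~ i) m.+1) == head true L) &&
    path (fun l l' => last true l == head true l') L LS').
  apply/andP; split; last exact: jL.
  rewrite last_altl hL; move: om => /=.
  by case: (i); case: (j); case: odd.
- by do 2!eexists.
Qed.

Lemma vanishing_cumulants_chains : vanishing_cumulants -> vanishing_chains.
Proof.
move=> kV; apply: (@chain_lspan _ _ _ alt_centered); last first.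
  by move=> i j y; apply: Pmx_alt_centered.
move=> i l l0 cl; have [->|] := alt_centered_words cl l0; first by rewrite linear0.
move=> [YS [LS [-> sYL LYS rL [L [LS' [LE _]]]]]].
by apply: (words_centered_vanish kV sYL LYS rL); rewrite LE.
Qed.

(** A prepended letter opens a new run if it equals the first letter, and extends the first run
    otherwise. *)
Lemma runs_exist l : l != [::] ->
  exists LS, [/\ flatten LS = l, runs LS & LS != [::]].
Proof.
elim: l => [//|b l IHl] _; have [->|/IHl[LS [lE rL L0]]] := eqVneq l [::].
  by exists [:: [:: b]]; split=> //; rewrite /runs /= /is_alt eqxx.
case: LS lE rL L0 => [//|r LS] lE /andP[/= /andP[/andP[r0 /is_altP[c [k rE]]] aL] jL] _.
case: k rE => [|k] rE; first by rewrite rE in r0.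
have [cb|cb] := eqVneq c b.
  exists ([:: b] :: r :: LS); split=> //; first by rewrite /= -lE.
  apply/andP; split.
    apply/andP; split; first by rewrite /is_alt eqxx.
    apply/andP; split; last exact: aL.
    by apply/andP; split; [exact: r0 | apply/is_altP; exists c, k.+1].
  by rewrite /= jL rE cb eqxx.
exists ((b :: r) :: LS); split=> //; first by rewrite /= -lE.
have E : b :: r = altl b k.+2 by rewrite rE; case: (b) (c) cb => [] [].
apply/andP; split.
  by apply/andP; split; [apply/is_altP; exists b, k.+2 | exact: aL].
by move: jL; rewrite /= rE; case: (LS).
Qed.

Lemma centered_chain YS LS L LS' : vanishing_chains ->
  shape YS = shape LS -> letters a (flatten LS) (flatten YS) -> runs LS ->
  LS = L :: LS' ->
  exists l, [/\ chain (Pmx a) (~~ head true L) l, l != [::] &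
    lprod l = words_centered YS].
Proof.
move=> cV; elim: LS YS L LS' => [//|L0 LS IHL] [//|y YS] L LS' [sy sYL] LYS rL [LL _].
subst L0.
have [Ly LYS'] := (letters_cat a (flatten LS) (flatten YS) sy).1 LYS.
have /andP[/= /andP[/andP[L0 /is_altP[b [k LE]]] aL] jL] := rL.
case: k LE => [|k] LE; first by rewrite LE in L0.
have hL : head true L = b by rewrite LE.
have av : alt_prod a (~~ ~~ head true L) k.+1 (\prod_(x <- y) x).
  by rewrite negbK hL; apply: letters_alt_prod; rewrite -LE.
pose j := ~~ last true L.
have om : odd k.+1 = (~~ head true L == j).
  by rewrite /j hL LE last_altl /=; case: (b); case: odd.
have Pj : Pmx a (~~ head true L) j (centered (\prod_(x <- y) x)).
  apply/PmxE; split; last by move=> _; apply: cexp_centered.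
  (* Odd run: (1) for a single factor shows that its expectation is already 0. Even run: the
     subtracted expectation is an alternating product with no letters. *)
  have [ij|ij] := eqVneq (~~ head true L) j.
    have Pv : Pmx a (~~ head true L) j (\prod_(x <- y) x).
      apply/PmxE; split; last by rewrite ij eqxx.
      by apply: lspan_mem; exists k.+1.
    have := cV (~~ head true L) [:: (\prod_(x <- y) x, j)] isT (conj Pv I).
    rewrite /lprod big_seq1 /centered => ->; rewrite rmorph0 subr0.
    by apply: lspan_mem; exists k.+1.
  rewrite /centered -[\prod_(x <- y) x]scale1r addrC -scaleN1r.
  rewrite scale1r -[X in _ + X]addr0 -[X in _ + (X + _)]scale1r.
  apply: lspan_cons; first by exists 0%N; rewrite (negbTE ij); split=> //; apply/alt_prod0; eexists.
  by apply: lspan_cons (lspan0 _); exists k.+1.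
case: LS IHL sYL LYS' rL jL {aL LYS} => [|M LS] IHL sYL LYS' rL jL.
  exists [:: (centered (\prod_(x <- y) x), j)]; split=> //.
  by case: YS sYL {LYS'} => // _; rewrite /lprod /words_centered !big_seq1.
have rM : runs (M :: LS).
  have /andP[/andP[_ aL] _] := rL; apply/andP; split; first exact: aL.
  by move: jL => /= /andP[].
have [l [cl l0 lE]] := IHL YS M LS sYL LYS' rM erefl.
exists ((centered (\prod_(x <- y) x), j) :: l); split=> //.
  split=> //; suff -> : j = ~~ head true M by [].
  by move: jL => /= /andP[/eqP jE _]; rewrite /j jE.
by rewrite /lprod /words_centered !big_cons -/(lprod l) lE.
Qed.

(** Every block of a partition other than the one-block partition is shorter than w, so the cumulant
    at its non-alternating block vanishes by the assumption on shorter words. *)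
Lemma cumulant_isolated (w : seq A) (q : pred {set {set 'I_(size w)}}) l :
  (0 < size w)%N -> letters a l w ->
  (forall v l', (size v < size w)%N -> letters a l' v -> ~~ even_alt l' ->
    kappa v = 0) ->
  q [set [set: 'I_(size w)]] ->
  (forall P, ncpart (enum 'I_(size w)) P -> q P -> exists2 B, B \in P &
    ~~ even_alt (map (fun k : 'I_(size w) => nth true l k) (enum B))) ->
  \sum_(P | ncpart (enum 'I_(size w)) P && q P)
    N kappa P (1, zip (enum 'I_(size w)) w) = kappa w.
Proof.
move=> w0 Lw IH qT hq; set T := [set [set: 'I_(size w)]] in qT *.
have TNC := NC_top w0.
have ncE P : (P \in NC (size w)) = ncpart (enum 'I_(size w)) P.
  by rewrite inE /ncpart set_of_enumT.
rewrite (bigD1 T) /=; last by rewrite -ncE TNC.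
rewrite -(nested_N kP) // nested_top big1 ?addr0 // => P /andP[/andP[nc qP] PT].
have [B BP nalt] := hq P nc qP.
have [partP _] := andP nc; have /and3P[_ /finset.trivIsetP tiP P0] := partP.
have BT : B != [set: 'I_(size w)].
  apply: contraNneq PT => BT; apply/eqP/setP => C; rewrite finset.in_set1 -BT.
  apply/idP/eqP => [CP|->//]; apply/eqP; apply/negP => /negP CB.
  have := tiP _ _ CP BP CB; rewrite BT -finset.setI_eq0 finset.setIT => /eqP C0.
  by rewrite -C0 CP in P0.
pose s (k : 'I_(size w)) := nth true l k.
have sE : map s (enum 'I_(size w)) = l.
  have sl := letters_size Lw.
  apply: (@eq_from_nth _ true); first by rewrite size_map size_enum_ord.
  move=> i; rewrite size_map size_enum_ord => lt_i.
  by rewrite (nth_map (Ordinal lt_i)) ?size_enum_ord // /s nth_enum_ord.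
apply: (@N_vanish _ _ _ a _ kappa s kP P B) => //.
- by rewrite unzip1_zip_enum // enum_uniq.
- by apply: zip_letters; rewrite unzip1_zip_enum // sE unzip2_zip // size_enum_ord.
move=> v Lv; apply: (IH _ _ _ Lv nalt); rewrite (letters_size Lv) size_map -cardE.
rewrite -[X in (_ < X)%N]card_ord -cardsT; apply: proper_card.
by rewrite finset.properT.
Qed.

Lemma reshape_unsaturated_top n (ss : seq (seq 'I_n)) : flatten ss = enum 'I_n ->
  (1 < size ss)%N -> all (fun z => z != [::]) ss ->
  all (fun z => ~~ saturated [set [set: 'I_n]] [set i in z]) ss.
Proof.
move=> fE s2 nz; apply/allP => z zs; apply/negP => /saturatedP/(_ [set: 'I_n]).
rewrite finset.set11 => /(_ isT); have z0 := allP nz _ zs.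
case: z zs z0 => [//|k z] zs _; case=> [/fintype.subsetP sub|]; last first.
  rewrite -finset.setI_eq0 finset.setTI => /eqP/setP/(_ k).
  by rewrite !inE eqxx.
have {}sub i : i \in k :: z by have := sub i (finset.in_setT i); rewrite inE.
have U : uniq (flatten ss) by rewrite fE enum_uniq.
case/splitPr: zs s2 nz U {fE} => s1 s3; rewrite flatten_cat size_cat.
rewrite -[flatten (_ :: _)]/((k :: z) ++ flatten s3) -[size (_ :: s3)]/(size s3).+1.
rewrite addnS ltnS => s2; rewrite all_cat => /and3P[nz1 _ nz3] U.
have [y [ys y0]] : exists y : seq 'I_n, y \in s1 ++ s3 /\ y != [::].
  case: s1 s2 nz1 {U} => [|y s1] s2 nz1.
    case: s3 s2 nz3 => [//|y s3] _ /andP[y0 _].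
    by exists y; rewrite mem_head.
  by exists y; case/andP: nz1; rewrite mem_head.
case: y y0 ys => [//|j y] _ ys.
have js : j \in flatten s1 ++ flatten s3.
  by rewrite -flatten_cat; apply/flattenP; exists (j :: y); rewrite ?mem_head.
move: U; rewrite uniq_catCA cat_uniq => /and3P[_ /hasPn/(_ _ js) + _].
by rewrite /= sub.
Qed.

Lemma vanishing_chains_cumulants : vanishing_chains -> vanishing_cumulants.
Proof.
move=> cV w l; move: {2}(size w).+1 (ltnSn (size w)) => m.
elim: m w l => [//|m IHm] w l lt_w Lw nalt.
have sl := letters_size Lw.
have l0 : l != [::] by apply: contraNneq nalt => ->.
have w0 : (0 < size w)%N by rewrite sl lt0n size_eq0.
have IH v l' : (size v < size w)%N -> letters a l' v -> ~~ even_alt l' -> kappa v = 0.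
  by move=> lt_v; apply: IHm; apply: leq_trans lt_v _.
have [LS [lE rL L0]] := runs_exist l0.
(* A single run that is not [even_alt] has odd length; its plain moment is used, since every
   partition then has an odd block. With at least two runs the moment of the centered runs is
   used. *)
have [s2|s1] := ltnP 1 (size LS); last first.
  case: LS lE rL L0 s1 => [//|L [|//]] lE /andP[/= /andP[/andP[_ /is_altP[b [k LE]]] _] _] _ _.
  rewrite /= cats0 LE in lE; subst l; rewrite size_altl in sl.
  have ok : odd k.
    move: nalt; rewrite /even_alt size_altl negb_and negbK => /orP[|//].
    by move=> /negP[]; apply/is_altP; do 2!eexists.
  have Pw : Pmx a (~~ b) (~~ b) (\prod_(x <- w) x).
    apply/PmxE; split; last by rewrite eqxx.
    apply: lspan_mem; exists k; rewrite eqxx; split=> //.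
    by rewrite negbK; apply: letters_alt_prod.
  have := cV (~~ b) [:: (\prod_(x <- w) x, ~~ b)] isT (conj Pw I).
  rewrite /lprod big_seq1 (moment_N (erefl _) w0) => <-.
  rewrite -(cumulant_isolated (q := xpredT) w0 Lw IH) //.
    by apply: eq_bigl => P; rewrite andbT.
  by move=> P nc _; apply: odd_block nc _; rewrite sl.
have [YS [fY sY]] : exists YS, flatten YS = w /\ shape YS = shape LS.
  exists (reshape (shape LS) w).
  by rewrite reshapeKr ?reshapeKl // -size_flatten lE sl.
subst w l; have [L [LS' LE]] : exists L LS', LS = L :: LS'.
  by case: (LS) L0 => // L LS' _; exists L, LS'.
have [ll [cl ll0 llE]] := centered_chain cV sY Lw rL LE.
have := cV _ _ ll0 cl; rewrite llE (moment_words (erefl _)) => <-.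
rewrite -(cumulant_isolated (q := fun P =>
  all (fun z => ~~ saturated P [set i in z]) (reshape (shape YS) (enum 'I_(size (flatten YS)))))
  w0 Lw IH) //.
- apply: reshape_unsaturated_top.
  + by rewrite reshapeKr // size_enum_ord size_flatten.
  + by rewrite size_reshape sY size_map.
  apply/allP => z zs; rewrite -size_eq0 -lt0n.
  have : size z \in shape LS.
    rewrite -sY; have <- : shape (reshape (shape YS) (enum 'I_(size (flatten YS)))) = shape YS.
      by rewrite reshapeKl // size_enum_ord size_flatten.
    exact: map_f.
  case/mapP => L1 L1S ->; have /andP[/allP/(_ L1 L1S)/andP[L10 _] _] := rL.
  by rewrite lt0n size_eq0.
by move=> P nc uns; apply: (unsaturated_block sY Lw rL L0 nc uns).
Qed.

End MomentsCumulants.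

(** * Multiplication by a free unitary *)

Lemma star1 (C : numClosedFieldType) (A : starAlgType C) : star (1 : A) = 1.
Proof.
have : star 1 * star (star 1) = 1 :> A by rewrite -starM mulr1 starK.
by rewrite starK mulr1.
Qed.

Section Alternating.
Variables (R : realType) (D : starAlgType R[i]) (B : dprobSpace D) (X Y : set B).
Hypothesis XY_free : free_pair X Y.

Definition side (t : bool) : B -> Prop :=
  gen_alg (((if t then X else Y) `|` range (dincl B))%classic).

Lemma side_dincl t d : side t (dincl B d).
Proof. by apply: gen_alg_mem; right; exists d. Qed.

Lemma side1 t : side t 1. Proof. exact: gen_alg1. Qed.

Lemma sideM t x y : side t x -> side t y -> side t (x * y).
Proof. exact: gen_algM. Qed.

Lemma side_centered t x : side t x -> side t (centered x).
Proof.
move=> sx; apply: gen_algD => //; rewrite -scaleN1r; apply: gen_algZ.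
exact: side_dincl.
Qed.

Lemma side_lspan t (Z : B -> Prop) x : (forall z, Z z -> side t z) ->
  lspan Z x -> side t x.
Proof.
move=> Zs; move: x; apply: lspan_ind.
  by rewrite -(scale0r 1); apply: gen_algZ; apply: side1.
by move=> c x y /Zs sx sy; apply: gen_algD => //; apply: gen_algZ.
Qed.

(* t is the side of the last factor. *)
Definition alternate (t : bool) (y : B) := exists n (s : nat -> bool) (x : nat -> B),
  [/\ forall j, (j <= n)%N -> side (s j) (x j) /\ cexp B (x j) = 0,
      forall j, (j < n)%N -> s j <> s j.+1, s n = t
    & y = \prod_(j < n.+1) x j].

Lemma alternate0 t y : alternate t y -> cexp B y = 0.
Proof. by case=> n [s [x [h1 h2 _ ->]]]; apply: (@XY_free n.+1 s x). Qed.

Lemma alternate_one t x : side t x -> cexp B x = 0 -> alternate t x.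
Proof.
by move=> sx ex; exists 0%N, (fun=> t), (fun=> x); split=> //; rewrite big_ord1.
Qed.

Lemma alternate_rcons t y x : alternate (~~ t) y -> side t x -> cexp B x = 0 ->
  alternate t (y * x).
Proof.
move=> [n [s [f [h1 h2 sn ->]]]] sx ex.
exists n.+1, (fun k => if k == n.+1 then t else s k),
  (fun k => if k == n.+1 then x else f k); split=> [j|j||].
- rewrite leq_eqVlt; case: eqVneq => [->|jn] /=; first by [].
  by rewrite ltnS => /h1.
- move=> lt_j; rewrite (ltn_eqF lt_j) eqSS.
  case: eqVneq => [->|jn]; first by rewrite sn; case: (t).
  by apply: h2; rewrite ltn_neqAle jn -ltnS.
- by rewrite eqxx.
- rewrite [in RHS]big_ord_recr /= eqxx; congr (_ * _).
  by apply: eq_bigr => i _; rewrite ltn_eqF.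
Qed.

End Alternating.

Section Dressing.
Variables (R : realType) (D : starAlgType R[i]) (B : dprobSpace D) (b u : B).
Hypotheses (u_comm : forall d, u * dincl B d = dincl B d * u)
  (u_unit : unitary u)
  (ub_free : free_pair [set b; star b]%classic [set u; star u]%classic).
Variable alpha : R[i].
Hypothesis u_mean : cexp B u = alpha%:A.

Implicit Types (p l : seq (B * bool)) (y z : B).

Local Notation Gb := (side [set b; star b]%classic [set u; star u]%classic true).
Local Notation Gu := (side [set b; star b]%classic [set u; star u]%classic false).
Local Notation alt := (alternate [set b; star b]%classic [set u; star u]%classic).

(* An alternating word x in b, b^* with end types i, j becomes the same word
   [dl i * x * dr j] in ub, (ub)^*; neighbours multiply to [ju j]. *)
Definition dl (i : bool) : B := if i then u else 1.
Definition dr (j : bool) : B := if j then 1 else star u.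
Definition ju (j : bool) : B := if j then u else star u.

Lemma dr_dl j : dr j * dl j = ju j.
Proof. by case: j; rewrite /= ?mul1r ?mulr1. Qed.

Fixpoint dress (i : bool) (l : seq (B * bool)) : B :=
  if l is (z, j) :: l' then dl i * z * dr j * dress j l' else 1.

Lemma dress_cons i z j l : dress i ((z, j) :: l) = dl i * z * dr j * dress j l.
Proof. by []. Qed.

Lemma dress_cat i l1 l2 :
  dress i (l1 ++ l2) = dress i l1 * dress (chain_end i l1) l2.
Proof.
elim: l1 i => [|[z j] l1 IHl1] i /=; first by rewrite mul1r.
by rewrite IHl1 !mulrA.
Qed.

(** The mean of [star u] is the conjugate of [alpha] because the expectation respects the
    involution. *)
Definition jmean (j : bool) : R[i] := if j then alpha else alpha^*.

Lemma ju_mean j : cexp B (ju j) = (jmean j)%:A.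
Proof. by case: j => //=; rewrite cexp_star u_mean starZ star1. Qed.

Lemma dincl_scalar (c : R[i]) : dincl B c%:A = c%:A.
Proof. by rewrite linearZ /= rmorph1. Qed.

Lemma ju_split j : ju j = (jmean j)%:A + centered (ju j).
Proof. by rewrite /centered ju_mean dincl_scalar addrC subrK. Qed.

Lemma Gu_ju j : Gu (ju j).
Proof. by apply: gen_alg_mem; left; case: j; [left|right]. Qed.

Lemma alt_ju y j : alt true y -> alt false (y * centered (ju j)).
Proof.
move=> ay; apply: (alternate_rcons (t := false)); first exact: ay.
  exact: side_centered (Gu_ju j).
exact: cexp_centered.
Qed.

Lemma alt_juE y j : alt true y -> cexp B (y * ju j) = 0.
Proof.
move=> ay; rewrite ju_split mulrDr linearD /= -scalerAr mulr1 linearZ /=.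
rewrite (alternate0 ub_free ay) (alternate0 ub_free (alt_ju j ay)).
by rewrite scaler0 addr0.
Qed.

Lemma ju_centered j : exists2 c, ju j = (jmean j)%:A + c & alt false c.
Proof.
exists (centered (ju j)); first exact: ju_split.
by apply: alternate_one; [exact: side_centered (Gu_ju j) | exact: cexp_centered].
Qed.

Lemma alt_cons_juE j y : alt true y -> (forall c, alt false c -> alt true (c * y)) ->
  cexp B (ju j * y) = 0.
Proof.
move=> ay acy; have [c -> ac] := ju_centered j.
rewrite mulrDl linearD /= -scalerAl mul1r linearZ /=.
by rewrite (alternate0 ub_free ay) (alternate0 ub_free (acy _ ac)) scaler0 addr0.
Qed.

(** The centered part of x contributes 0 by freeness. The part in D commutes with u, which leaves a
    mean of u or [star u] when only one of them is present, and nothing when they cancel or both are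
    absent. *)
Lemma cexp_boundary i j x : Gb x -> cexp B (dl i * x * dr j) =
  (if i == j then jmean i else 1) *: cexp B x.
Proof.
move=> Gx; have ax : alt true (centered x).
  by apply: alternate_one; [exact: side_centered | exact: cexp_centered].
have acx c : alt false c -> alt true (c * centered x).
  move=> ac; apply: (alternate_rcons (t := true)) => //.
    exact: side_centered.
  exact: cexp_centered.
have xE : x = centered x + dincl B (cexp B x) by rewrite /centered subrK.
have uxu : cexp B (u * centered x * star u) = 0.
  have [c cE ac] := ju_centered true; rewrite -{1}[u]/(ju true) cE.
  rewrite !mulrDl linearD /= -!scalerAl mul1r linearZ /=.
  by rewrite (alt_juE false ax) (alt_juE false (acx c ac)) scaler0 addr0.
case: i; case: j => /=; rewrite ?mulr1 ?mul1r ?scale1r //.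
- rewrite {1}xE mulrDr linearD /= (alt_cons_juE true ax acx) add0r.
  by rewrite cexpMr u_mean -scalerAl mul1r.
- rewrite {1}xE mulrDr mulrDl linearD /= uxu add0r u_comm -mulrA u_unit.1 mulr1.
  exact: dinclK.
- rewrite {1}xE mulrDl linearD /= (alt_juE false ax) add0r cexpMl.
  by rewrite (ju_mean false) -scalerAr mulr1.
Qed.

Variable (X : bool -> bool -> B -> Prop).
Hypothesis XGb : forall i j x, X i j x -> Gb x.

Lemma chain_Gb i l : chain X i l -> Gb (lprod l).
Proof.
elim: l i => [|[z j] l IHl] i; first by rewrite /lprod big_nil => _; apply: side1.
move=> [/XGb Gz /IHl]; rewrite /lprod big_cons; exact: sideM.
Qed.

Variable m : nat.
Hypothesis short : forall i l, l != [::] -> chain X i l -> (size l < m)%N ->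
  cexp B (lprod l) = 0.

(** The product [dress] without its leading [dl], where each adjacent [dr], [dl] is merged into one
    [ju]. *)
Fixpoint tail (l : seq (B * bool)) : B :=
  if l is (z, j) :: l' then
    if l' is [::] then z * dr j else z * ju j * tail l'
  else 1.

Lemma tail_cons z j l : l != [::] -> tail ((z, j) :: l) = z * ju j * tail l.
Proof. by case: l. Qed.

Lemma dress_tail i l : l != [::] -> dress i l = dl i * tail l.
Proof.
elim: l i => [//|[z j] [|y l] IHl] i _; first by rewrite /= mulr1 mulrA.
by rewrite tail_cons // dress_cons IHl // -dr_dl !mulrA.
Qed.

Lemma lprod_rcons p z j : lprod (p ++ [:: (z, j)]) = lprod p * z.
Proof. by rewrite lprod_cat /lprod big_seq1. Qed.

Lemma chain_prefix i p z j l : chain X i (p ++ (z, j) :: l) ->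
  chain X i (p ++ [:: (z, j)]).
Proof. by move=> /chain_cat[cp [cz _]]; apply/chain_cat. Qed.

(** Here y ends in a centered element on the side of u, and p holds factors not yet separated by u.
    Splitting the next [ju], its mean merges one more factor into p, while its centered part closes
    p and the induction restarts with an empty prefix. The product of p with the next factor is
    centered by [short], as its length is below m. *)
Lemma alternate_tail y i p l : alt false y -> chain X i (p ++ l) ->
  l != [::] -> (size (p ++ l) < m)%N -> cexp B (y * lprod p * tail l) = 0.
Proof.
elim: l y i p => [//|[z j] l IHl] y i p ay cpl _ sz.
have cp := chain_prefix cpl.
have az : alt true (y * (lprod (p ++ [:: (z, j)]))).
  apply: (alternate_rcons (t := true)); [exact: ay | exact: chain_Gb cp |].
  apply: short cp _; first by case: (p).
  by apply: leq_ltn_trans sz; rewrite !size_cat leq_add2l.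
have [->|l0] := eqVneq l [::].
  rewrite /= mulrA -(mulrA y) -(lprod_rcons p z j); case: j cp az {cpl sz} => /= cp az.
    by rewrite mulr1 (alternate0 ub_free az).
  exact: (alt_juE false az).
rewrite tail_cons // !mulrA -(mulrA y) -(lprod_rcons p z j) ju_split.
rewrite mulrDr mulrDl linearD /= -scalerAr mulr1 -scalerAl linearZ /=.
rewrite (IHl _ i) ?scaler0 ?add0r -?catA //.
have := IHl (y * lprod (p ++ [:: (z, j)]) * centered (ju j)) j [::] (alt_ju j az).
rewrite lprod_nil mulr1; apply=> //.
  by have /chain_cat[_ [_ cl]] := cpl.
by apply: leq_ltn_trans sz; rewrite cat0s size_cat /= addnS leqW // leq_addl.
Qed.

Fixpoint jmean_prod (l : seq (B * bool)) : R[i] :=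
  if l is (_, j) :: l' then
    if l' is [::] then 1 else jmean j * jmean_prod l'
  else 1.

(** In the same expansion from the left, every term that takes the centered part of some [ju] is
    killed by [alternate_tail]. Only the term with all means survives; its product may reach length
    m and need not be centered. *)
Lemma cexp_tail i0 i p l : chain X i (p ++ l) -> l != [::] ->
  (size (p ++ l) <= m)%N ->
  cexp B (dl i0 * lprod p * tail l) =
  jmean_prod l *: cexp B (dl i0 * lprod (p ++ l) * dr (chain_end i (p ++ l))).
Proof.
elim: l i p => [//|[z j] l IHl] i p cpl _ sz.
have [l0|l0] := eqVneq l [::].
  rewrite l0 /= scale1r lprod_rcons /chain_end /unzip2 map_cat last_cat /=.
  by rewrite !mulrA.
have -> : jmean_prod ((z, j) :: l) = jmean j * jmean_prod l by case: (l) l0.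
have cp := chain_prefix cpl.
have lt_p : (size (p ++ [:: (z, j)]) < m)%N.
  apply: leq_trans sz; rewrite !size_cat /= ltn_add2l ltnS.
  by rewrite lt0n size_eq0.
have ep : cexp B (lprod (p ++ [:: (z, j)])) = 0.
  by apply: short cp lt_p; case: (p).
have cl : chain X j l by have /chain_cat[_ [_ cl]] := cpl.
have lt_l : (size l < m)%N.
  by apply: leq_trans sz; rewrite size_cat /= addnS ltnS leq_addl.
have a1 : alt true (lprod (p ++ [:: (z, j)])).
  by apply: alternate_one => //; exact: chain_Gb cp.
have vanish y : alt true y -> cexp B (y * centered (ju j) * tail l) = 0.
  move=> ay; have := alternate_tail (p := [::]) (alt_ju j ay) cl l0 lt_l.
  by rewrite lprod_nil mulr1.
rewrite tail_cons // !mulrA -(mulrA (dl i0)) -(lprod_rcons p z j) ju_split.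
rewrite mulrDr mulrDl linearD /= -scalerAr mulr1 -scalerAl linearZ /=.
rewrite (IHl i) -?catA //.
rewrite scalerA; set w := (X in _ + X); suff -> : w = 0 by rewrite addr0.
(* If [i0] is true, the leading u is split too; in both terms an alternating product ending on the
   side of b precedes the centered letter. *)
rewrite /w; case: (i0) => /=; last by rewrite mul1r vanish.
have [c [cE ac]] : exists c, ju true = (jmean true)%:A + c /\ alt false c.
  exists (centered (ju true)); split; first exact: ju_split.
  by apply: alternate_one; [exact: side_centered (Gu_ju true) | exact: cexp_centered].
rewrite -[u]/(ju true) cE.
rewrite !mulrDl linearD /= -!scalerAl !mul1r linearZ /= (vanish _ a1).
rewrite scaler0 add0r vanish //.
by apply: (alternate_rcons (t := true)); [exact: ac|exact: chain_Gb cp|exact: ep].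
Qed.

Lemma cexp_dress i l : chain X i l -> l != [::] -> (size l <= m)%N ->
  cexp B (dress i l) =
  (jmean_prod l * (if i == chain_end i l then jmean i else 1)) *:
    cexp B (lprod l).
Proof.
move=> cl l0 sz; rewrite dress_tail // -(mulr1 (dl i)) -(lprod_nil B).
by rewrite (@cexp_tail i i [::] l cl l0 sz) cexp_boundary ?scalerA //; apply: chain_Gb cl.
Qed.

Lemma norm_jmean j : `|jmean j| = `|alpha|.
Proof. by case: j; rewrite //= norm_conjC. Qed.

Lemma norm_jmean_prod l : l != [::] -> `|jmean_prod l| = `|alpha| ^+ (size l).-1.
Proof.
elim: l => [//|[z j] [|y l] IHl] _; first by rewrite normr1.
rewrite -[jmean_prod _]/(jmean j * jmean_prod (y :: l)) normrM norm_jmean IHl //.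
by rewrite -exprS.
Qed.
End Dressing.

(** * Invariance of the distribution under b to ub *)

Section Rotation.
Variables (R : realType) (D : starAlgType R[i]) (B : dprobSpace D) (b u : B).
Hypotheses (u_rv : scalar_rv u) (u_unit : unitary u).
Implicit Types (x y z : B) (d e : D) (l : seq (B * bool)).

Let u_comm d : u * dincl B d = dincl B d * u.
Proof. by case: u_rv. Qed.

Let us_comm d : star u * dincl B d = dincl B d * star u.
Proof. by case: u_rv. Qed.

Let c := u * b.

(* Pairs of values of the same noncommutative D-polynomial at b and at ub. *)
Inductive mono_rel : B -> B -> Prop :=
| mono_rel0 d : mono_rel (dincl B d) (dincl B d)
| mono_relS d s x y : mono_rel x y ->
    mono_rel (dincl B d * spow b s * x) (dincl B d * spow c s * y).

Inductive poly_rel : B -> B -> Prop :=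
| poly_rel0 : poly_rel 0 0
| poly_relD (k : R[i]) x y x' y' : mono_rel x y -> poly_rel x' y' ->
    poly_rel (k *: x + x') (k *: y + y').

Lemma mono_relMl d x y : mono_rel x y ->
  mono_rel (dincl B d * x) (dincl B d * y).
Proof.
case=> [e|e s x' y' xy]; first by rewrite -rmorphM; apply: mono_rel0.
by rewrite !mulrA -rmorphM; apply: mono_relS.
Qed.

Lemma mono_relM x y x' y' : mono_rel x y -> mono_rel x' y' ->
  mono_rel (x * x') (y * y').
Proof.
elim=> [d|d s {}x {}y _ IH] h; first exact: mono_relMl.
by rewrite -!mulrA !(mulrA (dincl B d)); apply: mono_relS; apply: IH.
Qed.

Lemma poly_rel_mono x y : mono_rel x y -> poly_rel x y.
Proof.
move=> h; rewrite -[x]scale1r -[y]scale1r -[_ *: x]addr0 -[_ *: y]addr0.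
by apply: poly_relD h poly_rel0.
Qed.

Lemma poly_rel_add x y x' y' : poly_rel x y -> poly_rel x' y' ->
  poly_rel (x + x') (y + y').
Proof.
elim=> [|k {}x {}y x1 y1 h _ IH] h'; first by rewrite !add0r.
by rewrite -!addrA; apply: poly_relD h (IH h').
Qed.

Lemma poly_relM x y x' y' : poly_rel x y -> poly_rel x' y' ->
  poly_rel (x * x') (y * y').
Proof.
elim=> [|k {}x {}y x1 y1 h _ IH] h'; first by rewrite !mul0r; apply: poly_rel0.
rewrite !mulrDl; apply: poly_rel_add (IH h'); rewrite -!scalerAl.
elim: h' => [|e x2 y2 x3 y3 h2 _ IH']; first by rewrite !mulr0 !scaler0; apply: poly_rel0.
rewrite !mulrDr !scalerDr; apply: poly_rel_add IH'.
rewrite -!scalerAr !scalerA -[X in poly_rel X]addr0 -[X in poly_rel _ X]addr0.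
by apply: poly_relD poly_rel0; apply: mono_relM.
Qed.

Lemma mono_rel_dword x y : mono_rel x y -> (exists d, x = dincl B d /\ y = dincl B d) \/
  exists d n s f e, x = dincl B d * dword b n s f * dincl B e /\
    y = dincl B d * dword c n s f * dincl B e.
Proof.
elim=> [d|d s {}x {}y _ [[e [-> ->]]|]]; first by left; exists d.
  right; exists d, 0%N, (fun=> s), (fun=> 1), e.
  by rewrite /dword !big_ord0 !mulr1.
move=> [e [n [t [f [g [-> ->]]]]]]; right.
exists d, n.+1, (fun k => if k is k'.+1 then t k' else s),
  (fun k => if k is k'.+1 then f k' else e), g.
by rewrite /dword !big_ord_recl /= !mulrA.
Qed.

Lemma same_ddistr_poly : same_ddistr b c ->
  forall x y, poly_rel x y -> cexp B x = cexp B y.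
Proof.
move=> h x y; elim=> [//|k {}x {}y x' y' xy _ IH].
rewrite !linearP /= IH; congr (_ *: _ + _).
have [[d [-> ->]//]|[d [n [s [f [e [-> ->]]]]]]] := mono_rel_dword xy.
by rewrite !cexpM h.
Qed.

(** Crossing a letter turns the index of [dl] into the one that the next letter of an alternating
    word asks for. Inside such a word all factors u and [star u] therefore cancel. *)
Lemma dl_spow s : dl u (~~ s) * spow b s = spow c s * dl u s.
Proof.
case: s => /=; rewrite ?mulr1 ?mul1r //.
by rewrite /c starM -mulrA u_unit.2 mulr1.
Qed.

Lemma dr_spow s : dr u s * spow c s = spow b s * dr u (~~ s).
Proof.
case: s => /=; rewrite ?mulr1 ?mul1r /c ?starM //.
by rewrite mulrA u_unit.2 mul1r.
Qed.

Lemma dl_dincl i d : dl u i * dincl B d = dincl B d * dl u i.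
Proof. by case: i => /=; rewrite ?mul1r ?mulr1. Qed.

Lemma dr_dincl i d : dr u i * dincl B d = dincl B d * dr u i.
Proof. by case: i => /=; rewrite ?mul1r ?mulr1. Qed.

Lemma dl_dr i j d : i != j -> dl u i * dincl B d * dr u j = dincl B d.
Proof.
case: i; case: j => //= _; last by rewrite mul1r mulr1.
by rewrite u_comm -mulrA u_unit.1 mulr1.
Qed.

Lemma mono_rel_alt_prod s m v j : alt_prod b s m v -> odd m = (~~ s == j) ->
  mono_rel v (dl u (~~ s) * v * dr u j).
Proof.
elim: m s v => [|m IHm] s v.
  move=> /alt_prod0[d ->] sj; rewrite dl_dr; first exact: mono_rel0.
  by rewrite -sj.
move=> /alt_prodS[d [y [hy ->]]] om.
have -> : dl u (~~ s) * (dincl B d * spow b s * y) * dr u j =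
    dincl B d * spow c s * (dl u (~~ ~~ s) * y * dr u j).
  by rewrite negbK !mulrA dl_dincl -(mulrA (dincl B d)) dl_spow !mulrA.
apply: mono_relS; apply: IHm hy _.
by move: om => /=; case: (s); case: (j); case: odd.
Qed.

Lemma poly_rel_alt_mom i j x : lspan (alt_mom b i j) x ->
  poly_rel x (dl u i * x * dr u j).
Proof.
move: x; apply: lspan_ind; first by rewrite mulr0 mul0r; apply: poly_rel0.
move=> k x y [m [om ax]] hy.
rewrite mulrDr mulrDl -scalerAr -scalerAl; apply: poly_relD hy.
by rewrite -[in dl u i](negbK i); apply: mono_rel_alt_prod ax _; rewrite negbK.
Qed.

Lemma poly_rel_dress i l : chain (Pmx b) i l -> poly_rel (lprod l) (dress u i l).
Proof.
elim: l i => [|[x j] l IHl] i.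
  by rewrite lprod_nil => _; have := poly_rel_mono (mono_rel0 1); rewrite rmorph1.
move=> [/PmxE[sx _] cl]; rewrite /lprod big_cons dress_cons.
by apply: poly_relM (IHl _ cl); apply: poly_rel_alt_mom.
Qed.

Hypothesis ub_free : free_pair [set b; star b]%classic [set u; star u]%classic.

Local Notation Gb := (side [set b; star b]%classic [set u; star u]%classic true).

Lemma Gb_alt_prod s m x : alt_prod b s m x -> Gb x.
Proof.
elim: m s x => [|m IHm] s x.
  by move=> /alt_prod0[d ->]; apply: side_dincl.
move=> /alt_prodS[d [y [/IHm Gy ->]]]; apply: sideM Gy.
apply: sideM; first exact: side_dincl.
by apply: gen_alg_mem; left; case: s; [right|left].
Qed.

Lemma Gb_Pmx i j x : Pmx b i j x -> Gb x.
Proof.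
move=> /PmxE[sx _]; apply: side_lspan sx => z [m [_ az]].
exact: Gb_alt_prod az.
Qed.

Lemma u_mean_exists : exists alpha : R[i], cexp B u = alpha%:A.
Proof.
case: u_rv => _ _ _ /(_ 1%N 0%N)[alpha]; rewrite expr1 expr0 mulr1 => h.
by exists alpha.
Qed.

(** By induction on length, invariance gives E(x) = k E(x) where |k| is a positive power of |alpha|,
    so 1 - k is invertible. *)
Lemma rotation_vanishing (alpha : R[i]) : cexp B u = alpha%:A -> `|alpha| < 1 ->
  same_ddistr b c -> vanishing_chains b.
Proof.
move=> um a1 hd i l; move: {2}(size l) (leqnn (size l)) => m.
elim: m i l => [|m IHm] i l; first by case: l.
move=> sz l0 cl.
have short i' l' : l' != [::] -> chain (Pmx b) i' l' -> (size l' < m.+1)%N ->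
    cexp B (lprod l') = 0.
  by move=> l'0 cl' sz'; apply: IHm l'0 cl'; rewrite -ltnS.
(* The number of means picked up: one per junction, plus one if the end indices agree. It is 0 only
   for a single factor with different indices, which is centered by definition. *)
pose p := ((size l).-1 + (i == chain_end i l))%N.
have [p0|p0] := eqVneq p 0%N.
  case: l sz l0 cl @p p0 => [//|[x j] [|//]] _ _ [/PmxE[_ ex] _] p.
  rewrite /p /chain_end /= add0n => /eqP; rewrite eqb0 => /ex.
  by rewrite /lprod big_seq1.
have := cexp_dress u_comm u_unit ub_free um Gb_Pmx short cl l0 sz.
rewrite -(same_ddistr_poly hd (poly_rel_dress cl)).
set k := _ * _ => E.
have k1 : `|k| < 1.
  have -> : `|k| = `|alpha| ^+ p.
    rewrite /k normrM norm_jmean_prod // exprD; congr (_ * _).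
    by case: eqP; rewrite ?normr1 ?norm_jmean ?expr1.
  by rewrite exprn_ilt1.
have : (1 - k) *: cexp B (lprod l) = 0.
  by rewrite scalerBl scale1r -E subrr.
have k0 : 1 - k != 0 by apply: contraTneq k1 => /subr0_eq<-; rewrite normr1 ltxx.
move=> h; rewrite -[LHS]scale1r -(mulVf k0) -scalerA h scaler0 //.
Qed.

Lemma dress_vanishing i l : vanishing_chains b -> chain (Pmx b) i l ->
  l != [::] -> cexp B (dress u i l) = 0.
Proof.
move=> V cl l0; have [alpha um] := u_mean_exists.
have short i' l' : l' != [::] -> chain (Pmx b) i' l' -> (size l' < size l)%N ->
    cexp B (lprod l') = 0.
  by move=> l'0 cl' _; apply: V l'0 cl'.
have := cexp_dress u_comm u_unit ub_free um Gb_Pmx short cl l0 (leqnn _).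
by rewrite (V _ _ l0 cl) scaler0.
Qed.

Definition word (x : B) (r : seq (D * bool)) : B :=
  \prod_(z <- r) (dincl B z.1 * spow x z.2).

Lemma dwordE x n s f : dword x n s f =
  spow x (s 0%N) * word x [seq (f k, s k.+1) | k <- iota 0 n].
Proof.
rewrite /dword /word big_map; congr (_ * _).
have -> : iota 0 n = index_iota 0 n by rewrite /index_iota subn0.
by rewrite big_mkord.
Qed.

Lemma centered_Pmx i j x : vanishing_chains b -> lspan (alt_mom b i j) x ->
  Pmx b i j (centered x) /\ (i = j -> cexp B x = 0).
Proof.
move=> V sx; have [ij|ij] := eqVneq i j.
  have Px : Pmx b i j x by apply/PmxE; split; rewrite // ij eqxx.
  have := V i [:: (x, j)] isT (conj Px I); rewrite /lprod big_seq1 => x0.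
  by rewrite /centered x0 rmorph0 subr0.
split; last by move=> ijE; rewrite ijE eqxx in ij.
apply/PmxE; split; last by move=> _; apply: cexp_centered.
rewrite /centered addrC -scaleN1r; apply: lspan_cons sx.
exists 0%N; rewrite (negbTE ij); split=> //.
by apply/alt_prod0; eexists.
Qed.

Lemma alt_mom_rcons i s d x : lspan (alt_mom b i s) x ->
  lspan (alt_mom b i (~~ s)) (x * (dincl B d * spow b s)).
Proof.
move: x; apply: lspan_ind; first by rewrite mul0r; apply: lspan0.
move=> k x y [m [om ax]] hy; rewrite mulrDl -scalerAl; apply: lspan_cons hy.
exists m.+1; split; first by rewrite /= om; case: (i); case: (s).
elim: m i x om ax => [|m IHm] i x om ax.
  have [e ->] := (alt_prod0 _ _ _).1 ax.
  have -> : s = ~~ i by move: om; case: (i); case: (s).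
  apply/alt_prodS; exists (e * d), 1; split; last by rewrite rmorphM mulr1 mulrA.
  by apply/alt_prod0; exists 1; rewrite rmorph1.
have [e [y' [ay ->]]] := (alt_prodS _ _ _ _).1 ax.
apply/alt_prodS; exists e, (y' * (dincl B d * spow b s)); split; last by rewrite !mulrA.
apply: IHm ay; by move: om; rewrite /=; case: (i); case: (s); case: odd.
Qed.

Lemma dress_extend i x d s : dl u i * x * dr u s * (dincl B d * spow c s) =
  dl u i * (x * (dincl B d * spow b s)) * dr u (~~ s).
Proof.
rewrite !mulrA -(mulrA _ (dr u s)) dr_dincl !mulrA -(mulrA _ (dr u s)) dr_spow.
by rewrite !mulrA.
Qed.

Lemma dress_letter d s :
  dl u (~~ s) * (dincl B d * spow b s) * dr u (~~ s) = dincl B d * spow c s.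
Proof.
rewrite mulrA dl_dincl -(mulrA (dincl B d)) dl_spow -!mulrA; congr (_ * _).
by case: s; rewrite /= ?mulr1 // u_unit.1 mulr1.
Qed.

Lemma word_cons x d s r : word x ((d, s) :: r) = dincl B d * spow x s * word x r.
Proof. exact: big_cons. Qed.

Lemma alt_mom_letter d s : lspan (alt_mom b (~~ s) (~~ s)) (dincl B d * spow b s).
Proof.
apply: lspan_mem; exists 1%N; rewrite eqxx negbK; split=> //.
apply/alt_prodS; exists d, 1; split; last by rewrite mulr1.
by apply/alt_prod0; exists 1; rewrite rmorph1.
Qed.

(** The word is read from left to right: l holds the finished centered factors, x the current
    alternating product, r the unread letters. An arbitrary word thereby becomes a sum of chain
    products and terms of D, and the dressed expression in ub is rewritten in parallel. *)
Lemma rotation_words r l i0 j x : vanishing_chains b ->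
  chain (Pmx b) i0 l -> lspan (alt_mom b (chain_end i0 l) j) x ->
  cexp B (lprod l * x * word b r) =
  cexp B (dress u i0 l * (dl u (chain_end i0 l) * x * dr u j) * word c r).
Proof.
move=> V; elim: r l i0 j x => [|[d s] r IHr] l i0 j x cl sx.
all: set i := chain_end i0 l in sx *.
all: have [Px x0] := centered_Pmx V sx.
all: have cx : chain (Pmx b) i0 (l ++ [:: (centered x, j)]) by apply/chain_cat.
all: have cx0 : l ++ [:: (centered x, j)] != [::] by case: (l).
all: have xE : x = centered x + dincl B (cexp B x) by rewrite /centered subrK.
all: move: (centered x) (cexp B x) xE Px x0 cx cx0 => xc e xE Px x0 cx cx0.
  rewrite /word !big_nil !mulr1 xE !(mulrDr, mulrDl) !linearD /=.
  have -> : lprod l * xc = lprod (l ++ [:: (xc, j)]).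
    by rewrite lprod_rcons.
  have -> : dress u i0 l * (dl u i * xc * dr u j) =
      dress u i0 (l ++ [:: (xc, j)]).
    by rewrite dress_cat /= mulr1.
  rewrite (V _ _ cx0 cx) (dress_vanishing V cx cx0) !add0r.
  have [ij|ij] := eqVneq i j; first by rewrite (x0 ij) rmorph0 !(mulr0, mul0r).
  rewrite dl_dr // !cexpMr; congr (_ * _).
  have [->|l0] := eqVneq l [::]; first by rewrite lprod_nil.
  by rewrite (V _ _ l0 cl) (dress_vanishing V cl l0).
rewrite !word_cons; set y := _ * spow b s; set yc := _ * spow c s.
set w := word b r; set wc := word c r.
have assoc p q z t : p * q * (z * t) = p * (q * z) * t :> B by rewrite !mulrA.
(* If the next letter continues the alternation, it is appended to x. Otherwise x is split into its
   centered part, which joins l, and its expectation e. *)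
rewrite (assoc (lprod l)) (assoc (dress u i0 l)); have [js|js] := eqVneq j s.
  by subst j; rewrite /y /yc dress_extend; apply: IHr cl _; apply: alt_mom_rcons.
have jE : j = ~~ s by move: js; case: (j); case: (s).
have step1 : cexp B (lprod l * xc * y * w) =
    cexp B (dress u i0 l * (dl u i * xc * dr u j) * yc * wc).
  have := IHr (l ++ [:: (xc, j)]) i0 (~~ s) y cx.
  rewrite /chain_end /unzip2 map_cat last_cat /= jE => /(_ (alt_mom_letter d s)).
  by rewrite dress_letter lprod_rcons dress_cat /= mulr1 => ->.
have step2 : cexp B (lprod l * dincl B e * y * w) =
    cexp B (dress u i0 l * (dl u i * dincl B e * dr u j) * yc * wc).
  (* For equal indices e is 0. Otherwise the new letter has the exponent that continues the last
     factor of l. *)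
  have [ij|ij] := eqVneq i j.
    by rewrite (x0 ij) rmorph0 !(mulr0, mul0r).
  have is_ : i = s by move: ij; rewrite jE; case: (i); case: (s).
  rewrite dl_dr //.
  have eyE : dincl B e * y = dincl B (e * d) * spow b s.
    by rewrite /y rmorphM mulrA.
  have eycE : dincl B e * yc = dincl B (e * d) * spow c s.
    by rewrite /yc rmorphM mulrA.
  rewrite -(mulrA _ _ y) -(mulrA _ _ yc) eyE eycE.
  (* With l empty, a new product starts from e times the letter, and its initial index may be chosen
     afresh. Otherwise the last factor of l is reopened as the current product and absorbs both. *)
  case/lastP: l @i is_ cl {sx xE Px x0 cx cx0 step1 ij} => [|l [x' i']] i is_ cl.
    have := IHr [::] (~~ s) (~~ s) _ I (alt_mom_letter (e * d) s).
    by rewrite [chain_end _ _]/= dress_letter lprod_nil.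
  have i'E : i' = s by rewrite -is_ /i /chain_end /unzip2 map_rcons last_rcons.
  subst i'; rewrite -cats1 in cl *.
  have [cl1 [/PmxE[sx' _] _]] := (chain_cat _ _ _ _).1 cl.
  have := IHr l i0 (~~ s) _ cl1 (alt_mom_rcons (e * d) sx').
  rewrite lprod_rcons dress_cat /= mulr1 -dress_extend !mulrA => -> //.
rewrite xE.
have E1 : lprod l * ((xc + dincl B e) * y) * w =
  lprod l * xc * y * w + lprod l * dincl B e * y * w.
  by rewrite !(mulrDr, mulrDl) !mulrA.
have E2 : dress u i0 l * (dl u i * (xc + dincl B e) * dr u j * yc) * wc =
  dress u i0 l * (dl u i * xc * dr u j) * yc * wc +
  dress u i0 l * (dl u i * dincl B e * dr u j) * yc * wc.
  by rewrite !(mulrDr, mulrDl) !mulrA.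
by rewrite E1 E2 !linearD /= step1 step2.
Qed.

Theorem vanishing_rotation : vanishing_chains b -> same_ddistr b c.
Proof.
move=> V n s f; rewrite !dwordE; set r := [seq _ | _ <- _].
have := @rotation_words r [::] (~~ s 0%N) (~~ s 0%N) (dincl B 1 * spow b (s 0%N)) V I
  (alt_mom_letter 1 (s 0%N)).
by rewrite [chain_end _ _]/= dress_letter lprod_nil [dress _ _ _]/= !mul1r rmorph1 !mul1r.
Qed.

End Rotation.

Section Transfer.
Variables (R : realType) (D : starAlgType R[i]) (A B : dprobSpace D).
Variables (j : {lrmorphism A -> B}) (a : A).
Hypothesis enl : enlargement j.

Lemma enl_alt_prod s m (d : nat -> D) :
  j (dincl A (d 0%N) * \prod_(k < m) (spow a (s (+) odd k) * dincl A (d k.+1))) =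
  dincl B (d 0%N) * \prod_(k < m) (spow (j a) (s (+) odd k) * dincl B (d k.+1)).
Proof.
case: enl => _ js jd _; rewrite rmorphM /= jd rmorph_prod; congr (_ * _).
by apply: eq_bigr => k _; rewrite rmorphM /= jd; case: (_ (+) _) => //=; rewrite js.
Qed.

Lemma enl_alt_mom i k y : lspan (alt_mom (j a) i k) y <->
  exists2 x, lspan (alt_mom a i k) x & y = j x.
Proof.
split=> [|[x + ->]].
  move: y; apply: lspan_ind; first by exists 0; [exact: lspan0 | rewrite rmorph0].
  move=> c x y [m [om [d ->]]] [y' ly ->]; rewrite -enl_alt_prod.
  eexists; last by rewrite -linearP.
  by apply: lspan_cons ly; exists m; split=> //; exists d.
move: x; apply: lspan_ind; first by rewrite rmorph0; apply: lspan0.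
move=> c x z [m [om [d ->]]] lz; rewrite linearP /= enl_alt_prod.
by apply: lspan_cons lz; exists m; split=> //; exists d.
Qed.

Lemma enl_Pmx i k y : Pmx (j a) i k y <-> exists2 x, Pmx a i k x & y = j x.
Proof.
case: (enl) => _ _ _ je; split=> [/PmxE[/enl_alt_mom[x lx ->]]|[x /PmxE[lx ex] ->]].
  by rewrite je => ex; exists x => //; apply/PmxE.
by apply/PmxE; rewrite je; split=> //; apply/enl_alt_mom; exists x.
Qed.

(** Both sides speak only of words in a and of their expectations, which j preserves. *)
Lemma enl_chains : vanishing_chains a <-> vanishing_chains (j a).
Proof.
case: (enl) => _ _ _ je; split=> V i l l0 cl.
  suff [l' [cl' l'0 ->]] : exists l', [/\ chain (Pmx a) i l', l' != [::]
      & lprod l = j (lprod l')] by rewrite je; apply: V cl'.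
  elim: l i cl {l0} (l0) => [//|[y k] l IHl] i [/enl_Pmx[x Px ->] cl] _.
  have [->|l0] := eqVneq l [::].
    by exists [:: (x, k)]; split=> //; rewrite /lprod !big_seq1.
  have [l' [cl' l'0 E]] := IHl k cl l0.
  exists ((x, k) :: l'); split=> //.
  by rewrite /lprod !big_cons rmorphM -/(lprod l) E.
rewrite -je; pose l' := [seq (j z.1, z.2) | z <- l].
have -> : j (lprod l) = lprod l' by rewrite rmorph_prod /lprod big_map.
apply: (V i); first by rewrite /l'; case: (l) l0.
elim: l i cl {l0} @l' => [//|[x k] l IHl] i [Px cl] /=; split; last exact: IHl.
by apply/enl_Pmx; exists x.
Qed.
End Transfer.

(** * Free product with a symmetry *)

Lemma star0 (C : numClosedFieldType) (A : starAlgType C) : star (0 : A) = 0.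
Proof. by have := starZ 0 (0 : A); rewrite !scale0r rmorph0 scale0r. Qed.

Lemma star_sum (C : numClosedFieldType) (A : starAlgType C) (I : Type) (s : seq I)
    (F : I -> A) :
  star (\sum_(z <- s) F z) = \sum_(z <- s) star (F z).
Proof. by elim: s => [|z s IHs]; rewrite ?big_nil ?star0 // !big_cons starD IHs. Qed.

Section FreeSymmetry.
Variables (R : realType) (D : starAlgType R[i]) (A : dprobSpace D).
Implicit Types (x y t : A) (d e : D) (st r p q m w : seq A) (k : R[i]).
Local Notation E := (cexp A).

(* E (t_k u ... u t_1 u t_0 u x_1 u ... u x_n) for a symmetry u free from A over
   D with E u = 0, where st = [t_0; ...; t_k], r = [x_1; ...; x_n] and
   t_1, ..., t_(k-1) are centered: t_0 is split into its centered part and its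
   expectation, which commutes with u. *)
Fixpoint theta st r : D :=
  match r with
  | [::] => if st is [:: t] then E t else 0
  | x :: r' =>
      match st with
      | [::] => 0
      | [:: t0] => theta [:: x; t0] r'
      | t0 :: t1 :: st' =>
          theta [:: x, centered t0, t1 & st'] r' +
          theta (t1 * dincl A (E t0) * x :: st') r'
      end
  end.

(** The expectation of x_0 u x_1 u ... u x_k; the empty word is a formal unit. *)
Definition Phi w : D := if w is x :: r then theta [:: x] r else 1.

Lemma theta_nil st : (1 < size st)%N -> theta st [::] = 0.
Proof. by case: st => [|? []]. Qed.

Lemma centeredP k x y : centered (k *: x + y) = k *: centered x + centered y.
Proof. by rewrite /centered linearP /= linearP scalerBr opprD addrACA. Qed.

Lemma centeredMl d x : centered (dincl A d * x) = dincl A d * centered x.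
Proof. by rewrite /centered cexpMl rmorphM mulrBr. Qed.

Lemma centeredMr x d : centered (x * dincl A d) = centered x * dincl A d.
Proof. by rewrite /centered cexpMr rmorphM mulrBl. Qed.

Lemma centered_dincl d : centered (dincl A d) = 0.
Proof. by rewrite /centered dinclK subrr. Qed.

Lemma centered_id x : E x = 0 -> centered x = x.
Proof. by move=> x0; rewrite /centered x0 rmorph0 subr0. Qed.

Lemma centered_split x : x = centered x + dincl A (E x).
Proof. by rewrite /centered subrK. Qed.

Lemma theta_linear_stack k p x y q r : theta (p ++ (k *: x + y) :: q) r =
  k *: theta (p ++ x :: q) r + theta (p ++ y :: q) r.
Proof.
elim: r p x y q => [|z r IHr] p x y q.
  case: p => [|t p]; last by rewrite !theta_nil ?scaler0 ?addr0 //= size_cat addnS.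
  case: q => [|t q]; first by rewrite /= linearP.
  by rewrite !theta_nil // scaler0 addr0.
case: p => [|t0 [|t1 p]].
- case: q => [|t1 q]; first exact: (IHr [:: z]).
  rewrite /= centeredP (IHr [:: z]) linearP /= linearP /= mulrDr mulrDl.
  rewrite -scalerAr -scalerAl (IHr [::]) scalerDr !addrA; congr (_ + _).
  by rewrite -!addrA; congr (_ + _); rewrite addrC.
- rewrite /= (IHr [:: z; centered t0]) mulrDl mulrDl -!scalerAl (IHr [::]).
  by rewrite scalerDr addrACA.
rewrite /= (IHr [:: z, centered t0, t1 & p]).
by rewrite (IHr (_ :: p)) scalerDr addrACA.
Qed.

Lemma theta_linear_rest k st p x y q : theta st (p ++ (k *: x + y) :: q) =
  k *: theta st (p ++ x :: q) + theta st (p ++ y :: q).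
Proof.
elim: p st => [|z p IHp] st.
  case: st => [|t0 [|t1 st]] /=; first by rewrite scaler0 addr0.
    exact: (theta_linear_stack _ [::]).
  rewrite (theta_linear_stack _ [::]) mulrDr -scalerAr.
  by rewrite (theta_linear_stack _ [::]) scalerDr addrACA.
case: st => [|t0 [|t1 st]] /=; first by rewrite scaler0 addr0.
  exact: IHp.
by rewrite !IHp scalerDr addrACA.
Qed.

(** The stack lists the word from right to left: y comes before x, and d commutes with the u between
    them. *)
Lemma theta_balanced_stack p x y d q r :
  theta (p ++ x :: (y * dincl A d) :: q) r = theta (p ++ dincl A d * x :: y :: q) r.
Proof.
elim: r p x y q => [|z r IHr] p x y q.
  by rewrite !theta_nil // size_cat /= !addnS.
case: p => [|t0 [|t1 p]].
- rewrite /= (IHr [:: z]) centeredMl; congr (theta _ _ + theta (_ :: _) _).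
  by rewrite cexpMl rmorphM !mulrA.
- rewrite /= (IHr [:: z; centered t0]); congr (_ + _).
  by rewrite (IHr [::]) !mulrA.
by rewrite /= (IHr [:: z, centered t0, t1 & p]) (IHr (_ :: p)).
Qed.

Lemma theta_balanced_head t0 d st x r :
  theta (t0 * dincl A d :: st) (x :: r) = theta (t0 :: st) (dincl A d * x :: r).
Proof.
case: st => [|t1 st] /=; first exact: (theta_balanced_stack [::]).
rewrite centeredMr (theta_balanced_stack [::]); congr (_ + theta (_ :: _) _).
by rewrite cexpMr rmorphM !mulrA.
Qed.

Lemma theta_balanced_rest st p x y d q :
  theta st (p ++ x * dincl A d :: y :: q) = theta st (p ++ x :: dincl A d * y :: q).
Proof.
elim: p st => [|z p IHp] st.
  case: st => [|t0 [|t1 st]] //.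
    exact: (theta_balanced_head x d [:: t0] y q).
  rewrite -![theta _ _]/(theta [:: _, centered t0, t1 & st] (_ :: _) +
    theta (_ :: st) (_ :: _)).
  by rewrite mulrA !theta_balanced_head.
by case: st => [|t0 [|t1 st]] //=; rewrite !IHp.
Qed.

(** The invariant of the stack below its top. The bottom entry is exempt, being the left end of the
    word. *)
Fixpoint interior0 st : Prop :=
  if st is t :: st' then
    if st' is [::] then True else E t = 0 /\ interior0 st'
  else True.

Lemma theta0 st r : theta (0 :: st) r = 0.
Proof.
have := theta_linear_stack 0 [::] 0 0 st r; rewrite scaler0 addr0 /= scale0r add0r.
by have := theta_linear_stack 1 [::] 0 0 st r;
  rewrite scaler0 addr0 scale1r /= => /eqP; rewrite -subr_eq0 opprD addrA subrr
  sub0r oppr_eq0 => /eqP.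
Qed.

Lemma theta0_second z st r : theta (z :: 0 :: st) r = 0.
Proof.
have := theta_linear_stack 1 [:: z] 0 0 st r; rewrite scaler0 addr0 scale1r /=.
by move=> /eqP; rewrite -subr_eq0 opprD addrA subrr sub0r oppr_eq0 => /eqP.
Qed.

(** This is the relation u d u = d. An element of D just pushed on the stack has centered part 0, so
    the next step merges it with its neighbours. *)
Lemma theta_merge_head t0 d x st r : interior0 st ->
  theta (t0 :: st) (dincl A d :: x :: r) = theta (t0 * dincl A d * x :: st) r.
Proof.
move=> ist; case: st ist => [|t1 st] ist.
  by rewrite /= centered_dincl theta0_second add0r dinclK.
have -> : theta (t0 :: t1 :: st) [:: dincl A d, x & r] =
    theta [:: dincl A d, centered t0, t1 & st] (x :: r) +
    theta (t1 * dincl A (E t0) * dincl A d :: st) (x :: r) by [].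
have -> : theta [:: dincl A d, centered t0, t1 & st] (x :: r) =
    theta [:: centered t0 * dincl A d * x, t1 & st] r.
  by rewrite /= centered_dincl theta0_second add0r dinclK.
suff -> : theta (t1 * dincl A (E t0) * dincl A d :: st) (x :: r) =
    theta [:: dincl A (E t0) * dincl A d * x, t1 & st] r.
  have := theta_linear_stack 1 [::] (centered t0 * dincl A d * x)
    (dincl A (E t0) * dincl A d * x) (t1 :: st) r.
  rewrite /= scale1r scale1r => <-.
  by rewrite -!mulrDl -centered_split.
rewrite -mulrA -rmorphM; case: st ist => [|t2 st] ist.
  by rewrite /= (theta_balanced_stack [::]).
case: ist => e1 ist; rewrite theta_balanced_head /= e1 rmorph0 mulr0 mul0r theta0.
by rewrite addr0 centered_id.
Qed.

Lemma theta_merge t0 st p y d x q : interior0 st ->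
  theta (t0 :: st) (p ++ y :: dincl A d :: x :: q) =
  theta (t0 :: st) (p ++ y * dincl A d * x :: q).
Proof.
elim: p t0 st => [|z p IHp] t0 st ist.
  case: st ist => [|t1 st] ist; first exact: (@theta_merge_head y d x [:: t0] q).
  have -> : theta (t0 :: t1 :: st) [:: y, dincl A d, x & q] =
    theta [:: y, centered t0, t1 & st] [:: dincl A d, x & q] +
    theta (t1 * dincl A (E t0) * y :: st) [:: dincl A d, x & q] by [].
  have ist' : interior0 st by case: st ist => // ? ? [].
  have ist0 : interior0 [:: centered t0, t1 & st].
    by split=> //; apply: cexp_centered.
  by rewrite !theta_merge_head //= !mulrA.
case: st ist => [|t1 st] ist; first by rewrite /= IHp.
have ist' : interior0 st by case: st ist => // ? ? [].
have ist0 : interior0 [:: centered t0, t1 & st].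
  by split=> //; apply: cexp_centered.
by rewrite /= !IHp.
Qed.

(** Every merging term carries a factor E of a centered letter, so only pushing contributes; the
    final stack has more than one entry, where [theta] is 0. *)
Lemma theta_vanish t0 st m y : (st <> [::] -> E t0 = 0) -> interior0 st ->
  (forall x, x \in m -> E x = 0) -> theta (t0 :: st) (rcons m y) = 0.
Proof.
elim: m t0 st => [|z m IHm] t0 st e0 ist em.
  case: st e0 ist => [//|t1 st] e0 ist.
  by rewrite /= e0 // rmorph0 mulr0 mul0r add0r; case: (st); rewrite ?linear0.
have ez : E z = 0 by apply: em; rewrite mem_head.
have em' x : x \in m -> E x = 0 by move=> xm; apply: em; rewrite inE xm orbT.
case: st e0 ist => [|t1 st] e0 ist; first by rewrite /= IHm.
rewrite /= IHm //; last by split=> //; apply: cexp_centered.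
by rewrite e0 // rmorph0 mulr0 mul0r theta0 addr0.
Qed.

Lemma theta_mull st d x r :
  theta (rcons st (dincl A d * x)) r = d * theta (rcons st x) r.
Proof.
elim: r st x => [|z r IHr] st x.
  case: st => [|t st]; first by rewrite /= cexpMl.
  by rewrite !theta_nil ?mulr0 //= size_rcons.
case: st => [|t0 [|t1 st]]; first exact: (IHr [:: z]).
  rewrite /= (IHr [:: z; centered t0]) mulrDr -!mulrA; congr (_ + _).
  exact: (IHr [::]).
by rewrite /= (IHr [:: z, centered t0, t1 & st]) (IHr (_ :: st)) mulrDr.
Qed.

Lemma theta_mulr_head t st d : theta (t * dincl A d :: st) [::] = theta (t :: st) [::] * d.
Proof. by case: st => [|? ?] /=; rewrite ?cexpMr ?mul0r. Qed.

Lemma theta_mulr st r x d :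
  theta st (rcons r (x * dincl A d)) = theta st (rcons r x) * d.
Proof.
elim: r st => [|z r IHr] st.
  case: st => [|t0 [|t1 st]]; first by rewrite /= mul0r.
    exact: (theta_mulr_head x [:: t0] d).
  have thE y : theta [:: t0, t1 & st] (rcons [::] y) =
      theta [:: y, centered t0, t1 & st] [::] +
      theta (t1 * dincl A (E t0) * y :: st) [::] by [].
  by rewrite !thE mulrA !theta_mulr_head mulrDl.
case: st => [|t0 [|t1 st]]; rewrite /= ?mul0r // !IHr //.
by rewrite mulrDl.
Qed.

Lemma Phi_linear k p x y q : Phi (p ++ (k *: x + y) :: q) =
  k *: Phi (p ++ x :: q) + Phi (p ++ y :: q).
Proof.
case: p => [|z p]; first exact: (theta_linear_stack _ [::]).
exact: theta_linear_rest.
Qed.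

Lemma Phi_balanced p x y d q :
  Phi (p ++ x * dincl A d :: y :: q) = Phi (p ++ x :: dincl A d * y :: q).
Proof.
case: p => [|z p]; last exact: theta_balanced_rest.
exact: (theta_balanced_head x d [::] y q).
Qed.

Lemma Phi_merge p y d x q :
  Phi (p ++ y :: dincl A d :: x :: q) = Phi (p ++ y * dincl A d * x :: q).
Proof.
case: p => [|z p]; last exact: theta_merge.
exact: (@theta_merge_head y d x [::] q).
Qed.

Lemma Phi_vanish x m y : (forall z, z \in m -> E z = 0) -> Phi (x :: rcons m y) = 0.
Proof. by move=> em; apply: theta_vanish. Qed.

Lemma Phi_mulr p x d : Phi (rcons p (x * dincl A d)) = Phi (rcons p x) * d.
Proof. by case: p => [|z p] /=; [rewrite cexpMr | rewrite theta_mulr]. Qed.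

(** These rules determine every value: split a letter into its centered part and its expectation,
    contract u d u, and stop at a single letter or at a word with centered interior. *)
Lemma Phi_unique (f : seq A -> D) :
  (forall x, f [:: x] = E x) ->
  (forall p x y q, f (p ++ (x + y) :: q) = f (p ++ x :: q) + f (p ++ y :: q)) ->
  (forall p y d x q, f (p ++ y :: dincl A d :: x :: q) =
    f (p ++ y * dincl A d * x :: q)) ->
  (forall x m y, (forall z, z \in m -> E z = 0) -> f (x :: rcons m y) = 0) ->
  forall x r, f (x :: r) = Phi (x :: r).
Proof.
move=> f1 fD fM fV x r.
(* The list [rev (t :: st) ++ r'] is the word for which the arguments of [theta] stand; f is shown
   to obey the recursion of [theta]. *)
suff H t st r' : interior0 st -> f (rev (t :: st) ++ r') = theta (t :: st) r'.
  exact: (H x [::]).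
elim: r' t st => [|z r' IHr] t st ist.
  rewrite cats0; case: st ist => [|t1 st] ist; first by rewrite f1.
  rewrite theta_nil //; case/lastP: st ist => [|st b] ist.
    exact: (fV _ [::]).
  rewrite -rcons_cons rev_cons rev_rcons rcons_cons fV // => y.
  rewrite mem_rev inE => ys; move: ist.
  have : y \in t1 :: st by rewrite inE.
  elim: (st) (t1) {ys} => [|s2 st' IHst] s1 /=; first by rewrite inE => /eqP-> [].
  by rewrite inE => /orP[/eqP->|ys] [e1 ist]; [|apply: IHst ist].
case: st ist => [|t1 st] ist; first exact: (IHr z [:: t]).
have ist' : interior0 st by case: st ist => // ? ? [].
rewrite /= -IHr; last by split=> //; apply: cexp_centered.
rewrite -IHr // !rev_cons -!cats1 -!catA /=.
rewrite {1}(centered_split t) -cat_rcons fD !cat_rcons fM; congr (_ + _).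
Qed.

(** The recursion reads words from the left, so its symmetry under reversal is not visible. The
    reversed and starred functional obeys the rules of [Phi_unique]. *)
Lemma Phi_star w : star (Phi w) = Phi (rev (map star w)).
Proof.
case/lastP: w => [|w x]; first by rewrite /= star1.
rewrite map_rcons rev_rcons; set f := fun l => star (Phi (rev (map star l))).
have fE : f =1 Phi.
  case=> [|y r]; first by rewrite /f /= star1.
  apply: Phi_unique => [z|p z t q|p z d t q|z m t em].
  - by rewrite /f /= cexp_star starK.
  - rewrite /f !map_cat !rev_cat /= !rev_cons -!cats1 -!catA /= starD.
    have := Phi_linear 1 (rev (map star q)) (star z) (star t) (rev (map star p)).
    by rewrite !scale1r => ->; rewrite starD.
  - rewrite /f !map_cat !rev_cat /= !rev_cons -!cats1 -!catA /= !starM.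
    by rewrite -!dincl_star Phi_merge mulrA.
  - rewrite /f map_cons map_rcons rev_cons rev_rcons rcons_cons Phi_vanish ?star0 //.
    move=> u; rewrite mem_rev => /mapP[v vm ->].
    by rewrite cexp_star em // star0.
have := fE (star x :: rev (map star w)).
rewrite /f map_cons map_rev -map_comp rev_cons revK starK => <-.
by rewrite (eq_map (g := id)) ?map_id //; apply: starK.
Qed.

(** The product of two words in A and u: no u stands between them, so the last letter of one is
    multiplied by the first letter of the other. *)
Fixpoint wglue w w' :=
  match w with
  | [::] => w'
  | x :: v =>
      if v is [::] then (if w' is y :: v' then x * y :: v' else [:: x])
      else x :: wglue v w'
  end.

Lemma glues0 w : wglue w [::] = w.
Proof. elim: w => [//|x v IHv]; case: v IHv => [//|y v] IHv.
by rewrite -[in RHS]IHv. Qed.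

Lemma glue_rcons_cons p x y q : wglue (rcons p x) (y :: q) = p ++ x * y :: q.
Proof.
elim: p => [//|z p IHp]; rewrite rcons_cons cat_cons -IHp.
by case: p {IHp}.
Qed.

Lemma glueA w1 w2 w3 : wglue w1 (wglue w2 w3) = wglue (wglue w1 w2) w3.
Proof.
case/lastP: w1 => [//|p x].
case: w2 => [|y q]; first by rewrite glues0.
case: w3 => [|z r]; first by rewrite !glues0.
case/lastP: q => [|q y'].
  by rewrite /= !glue_rcons_cons cats1 glue_rcons_cons mulrA.
have -> : wglue (y :: rcons q y') (z :: r) = y :: (q ++ y' * z :: r).
  by rewrite -rcons_cons glue_rcons_cons.
rewrite !glue_rcons_cons.
have -> : p ++ x * y :: rcons q y' = rcons (p ++ x * y :: q) y' by rewrite rcons_cat.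
by rewrite glue_rcons_cons -catA.
Qed.

Lemma glue_star w w' : rev (map star (wglue w w')) =
  wglue (rev (map star w')) (rev (map star w)).
Proof.
case/lastP: w => [|p x]; first by rewrite glues0.
case: w' => [|y q]; first by rewrite glues0.
rewrite glue_rcons_cons map_cat rev_cat map_rcons rev_rcons /= !rev_cons.
by rewrite glue_rcons_cons starM cat_rcons.
Qed.

Lemma prod_glue w w' : \prod_(x <- wglue w w') x =
  (\prod_(x <- w) x) * \prod_(x <- w') x.
Proof.
case/lastP: w => [|p x]; first by rewrite big_nil mul1r.
case: w' => [|y q]; first by rewrite glues0 big_nil mulr1.
by rewrite glue_rcons_cons big_cat big_rcons !big_cons /= !mulrA.
Qed.

Lemma Phi_gluel d w : Phi (wglue [:: dincl A d] w) = d * Phi w.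
Proof.
by case: w => [|x w]; rewrite /= ?dinclK ?mulr1 // (theta_mull [::]).
Qed.

Lemma Phi_gluer d w : Phi (wglue w [:: dincl A d]) = Phi w * d.
Proof.
case/lastP: w => [|p x]; first by rewrite /= dinclK mul1r.
by rewrite glue_rcons_cons cats1 Phi_mulr.
Qed.

(** A two-sided context acts on a word only by l on its first letter and r on its last one. This
    lifts the relations for [Phi] to relations tested in every context; an empty side gives l or r
    equal to 1. *)
Lemma glue_context w w' : exists p (l r : A) q,
  [/\ forall x, wglue w (wglue [:: x] w') = p ++ l * x * r :: q,
      forall x m y, wglue w (wglue (x :: rcons m y) w') =
        p ++ l * x :: m ++ y * r :: q
    & Phi (wglue w w') = Phi (p ++ l * r :: q)].
Proof.
have [p [l [wE wE']]] : exists p (l : A), (forall y q, wglue w (y :: q) = p ++ l * y :: q) /\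
    Phi (wglue w [::]) = Phi (p ++ [:: l]).
  case/lastP: w => [|p l]; last by exists p, l; split=> [y q|];
    rewrite ?glues0 ?cats1 // glue_rcons_cons.
  by exists [::], 1; split=> [y q|/=]; rewrite ?mul1r ?cexp1.
have [r [q [w'E w'E']]] : exists (r : A) q, (forall x m, wglue (rcons m x) w' = m ++ x * r :: q) /\
    (w' = r :: q \/ [/\ w' = [::], r = 1 & q = [::]]).
  case: w' => [|r q]; last by exists r, q; split; [move=> *; rewrite glue_rcons_cons | left].
  by exists 1, [::]; split; [move=> *; rewrite glues0 mulr1 cats1 | right].
exists p, l, r, q; split=> [x|x m y|].
- by rewrite (w'E x [::]) /= wE mulrA.
- by rewrite -rcons_cons w'E wE.
case: w'E' => [->|[-> -> ->]]; first by rewrite wE.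
by rewrite wE' mulr1.
Qed.
End FreeSymmetry.

(** * The quotient algebra of words *)

Section Model.
Variables (R : realType) (D : starAlgType R[i]) (A : dprobSpace D).
Implicit Types (p q r : seq (R[i] * seq A)) (w m : seq A).

(* The list [(c_1, m_1); ...] stands for the sum of the c_i m_i, where the word
   m = [x_0; ...; x_k] stands for x_0 u x_1 u ... u x_k. *)
Definition fpoly := seq (R[i] * seq A).

(** Testing p in every context makes the zero set a two-sided ideal, the largest one on which the
    expectation vanishes. *)
Definition ev_fun p w w' : D :=
  \sum_(z <- p) z.1 *: Phi (wglue w (wglue z.2 w')).

Definition ev_val p : A := \sum_(z <- p) z.1 *: \prod_(x <- z.2) x.

Definition ev p := (ev_fun p, ev_val p).

(* The algebra generated by A and u, modulo the kernel of the expectation on the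
   first component; the second component (u = 1) keeps A embedded. *)
Record freeSym := FreeSym {
  fs_val : (seq A -> seq A -> D) * A;
  fs_prop : exists p, fs_val = ev p
}.

HB.instance Definition _ := gen_eqMixin freeSym.
HB.instance Definition _ := gen_choiceMixin freeSym.

Definition cls p : freeSym := FreeSym (ex_intro _ p (erefl (ev p))).
Definition rep (b : freeSym) : fpoly := projT1 (cid (fs_prop b)).

Lemma fs_inj (b c : freeSym) : fs_val b = fs_val c -> b = c.
Proof.
case: b c => [f hf] [g hg] /= E; subst g; congr FreeSym; exact: Prop_irrelevance.
Qed.

Lemma clsP p q : cls p = cls q <->
  (forall w w', ev_fun p w w' = ev_fun q w w') /\ ev_val p = ev_val q.
Proof.
split=> [E|[E1 E2]]; last first.
  apply: fs_inj; rewrite /= /ev E2; congr pair.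
  by apply/funext => w; apply/funext => w'.
have : ev p = ev q := congr1 fs_val E.
by case=> E1 E2; split=> // w w'; rewrite E1.
Qed.

Lemma repK b : cls (rep b) = b.
Proof. by apply: fs_inj; rewrite /= /rep; case: cid => p /= ->. Qed.

Lemma cls_ind (Q : freeSym -> Prop) : (forall p, Q (cls p)) -> forall b, Q b.
Proof. by move=> h b; rewrite -(repK b). Qed.

Lemma rep_cls p : (forall w w', ev_fun (rep (cls p)) w w' = ev_fun p w w') /\
  ev_val (rep (cls p)) = ev_val p.
Proof. by apply/clsP; rewrite repK. Qed.

Definition pscale (k : R[i]) p : fpoly := [seq (k * z.1, z.2) | z <- p].
Definition pmul p q : fpoly :=
  [seq (z.1 * t.1, wglue z.2 t.2) | z <- p, t <- q].
Definition pstar p : fpoly := [seq ((z.1)^*, rev (map star z.2)) | z <- p].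

Lemma ev_fun_cat p q w w' : ev_fun (p ++ q) w w' = ev_fun p w w' + ev_fun q w w'.
Proof. exact: big_cat. Qed.

Lemma ev_val_cat p q : ev_val (p ++ q) = ev_val p + ev_val q.
Proof. exact: big_cat. Qed.

Lemma ev_fun_scale k p w w' : ev_fun (pscale k p) w w' = k *: ev_fun p w w'.
Proof.
by rewrite /ev_fun big_map scaler_sumr; apply: eq_bigr => z _; rewrite scalerA.
Qed.

Lemma ev_val_scale k p : ev_val (pscale k p) = k *: ev_val p.
Proof.
by rewrite /ev_val big_map scaler_sumr; apply: eq_bigr => z _; rewrite scalerA.
Qed.

(** Together with [ev_fun_mulr], this expresses the functional of a product through that of either
    factor alone, so the product is well defined on classes. *)
Lemma ev_fun_mull p q w w' : ev_fun (pmul p q) w w' =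
  \sum_(t <- q) t.1 *: ev_fun p w (wglue t.2 w').
Proof.
rewrite /ev_fun /pmul big_allpairs_dep exchange_big /=; apply: eq_bigr => t _.
rewrite scaler_sumr; apply: eq_bigr => z _.
by rewrite scalerA mulrC -glueA.
Qed.

Lemma ev_fun_mulr p q w w' : ev_fun (pmul p q) w w' =
  \sum_(z <- p) z.1 *: ev_fun q (wglue w z.2) w'.
Proof.
rewrite /ev_fun /pmul big_allpairs_dep /=; apply: eq_bigr => t _.
rewrite scaler_sumr; apply: eq_bigr => z _.
by rewrite scalerA -!glueA.
Qed.

Lemma ev_val_mul p q : ev_val (pmul p q) = ev_val p * ev_val q.
Proof.
rewrite /ev_val /pmul big_allpairs_dep /= mulr_suml; apply: eq_bigr => z _.
rewrite mulr_sumr; apply: eq_bigr => t _.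
by rewrite prod_glue -scalerAl -scalerAr scalerA.
Qed.

Lemma rev_starK w : rev (map star (rev (map star w))) = w.
Proof.
rewrite map_rev revK -map_comp -[RHS]map_id; apply: eq_map => x /=.
by rewrite starK.
Qed.

Lemma ev_fun_star p w w' : ev_fun (pstar p) w w' =
  star (ev_fun p (rev (map star w')) (rev (map star w))).
Proof.
rewrite /ev_fun star_sum big_map; apply: eq_bigr => z _.
by rewrite starZ Phi_star /= !glue_star !rev_starK glueA.
Qed.

Lemma ev_val_star p : ev_val (pstar p) = star (ev_val p).
Proof.
rewrite /ev_val star_sum big_map; apply: eq_bigr => z _.
rewrite starZ /=; congr (_ *: _); elim: (z.2) => [|x v IHv].
  by rewrite !big_nil star1.
by rewrite /= rev_cons big_rcons big_cons /= starM IHv.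
Qed.

Definition fs_zero := cls [::].
Definition fs_add b c := cls (rep b ++ rep c).
Definition fs_scale k b := cls (pscale k (rep b)).
Definition fs_opp b := fs_scale (- 1) b.
Definition fs_one := cls [:: (1, [::])].
Definition fs_mul b c := cls (pmul (rep b) (rep c)).
Definition fs_star b := cls (pstar (rep b)).

Lemma add_cls p q : fs_add (cls p) (cls q) = cls (p ++ q).
Proof.
have [p1 p2] := rep_cls p; have [q1 q2] := rep_cls q; apply/clsP; split=> [w w'|].
  by rewrite !ev_fun_cat p1 q1.
by rewrite !ev_val_cat p2 q2.
Qed.

Lemma scale_cls k p : fs_scale k (cls p) = cls (pscale k p).
Proof.
have [p1 p2] := rep_cls p; apply/clsP; split=> [w w'|].
  by rewrite !ev_fun_scale p1.
by rewrite !ev_val_scale p2.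
Qed.

Lemma mul_cls p q : fs_mul (cls p) (cls q) = cls (pmul p q).
Proof.
have [p1 p2] := rep_cls p; have [q1 q2] := rep_cls q; apply/clsP; split=> [w w'|].
  rewrite ev_fun_mulr (eq_bigr (fun z => z.1 *: ev_fun q (wglue w z.2) w')).
    rewrite -ev_fun_mulr !ev_fun_mull; by apply: eq_bigr => z _; rewrite p1.
  by move=> z _; rewrite q1.
by rewrite !ev_val_mul p2 q2.
Qed.

Lemma star_cls p : fs_star (cls p) = cls (pstar p).
Proof.
have [p1 p2] := rep_cls p; apply/clsP; split=> [w w'|].
  by rewrite !ev_fun_star p1.
by rewrite !ev_val_star p2.
Qed.

Lemma fs_addA : associative fs_add.
Proof.
elim/cls_ind=> p; elim/cls_ind=> q; elim/cls_ind=> r.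
by rewrite !add_cls catA.
Qed.

Lemma fs_addC : commutative fs_add.
Proof.
elim/cls_ind=> p; elim/cls_ind=> q; rewrite !add_cls; apply/clsP.
by split=> [w w'|]; rewrite ?ev_fun_cat ?ev_val_cat addrC.
Qed.

Lemma fs_add0 : left_id fs_zero fs_add.
Proof. by elim/cls_ind=> p; rewrite add_cls. Qed.

Lemma fs_addN : left_inverse fs_zero fs_opp fs_add.
Proof.
elim/cls_ind=> p; rewrite /fs_opp scale_cls add_cls; apply/clsP; split=> [w w'|].
  by rewrite ev_fun_cat ev_fun_scale scaleN1r addNr /ev_fun big_nil.
by rewrite ev_val_cat ev_val_scale scaleN1r addNr /ev_val big_nil.
Qed.

HB.instance Definition _ :=
  GRing.isZmodule.Build freeSym fs_addA fs_addC fs_add0 fs_addN.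

Lemma fs_mulA : associative fs_mul.
Proof.
elim/cls_ind=> p; elim/cls_ind=> q; elim/cls_ind=> r; rewrite !mul_cls.
apply/clsP; split=> [w w'|]; last by rewrite !ev_val_mul mulrA.
rewrite ev_fun_mull big_allpairs_dep /= [RHS]ev_fun_mull [RHS](eq_bigr (fun t =>
  \sum_(z <- q) (z.1 * t.1) *: ev_fun p w (wglue (wglue z.2 t.2) w'))).
  by rewrite exchange_big.
move=> t _; rewrite ev_fun_mull scaler_sumr; apply: eq_bigr => z _.
by rewrite scalerA mulrC glueA.
Qed.

Lemma fs_mul1 : left_id fs_one fs_mul.
Proof.
elim/cls_ind=> p; rewrite mul_cls; apply/clsP; split=> [w w'|].
  by rewrite ev_fun_mulr big_seq1 scale1r glues0.
by rewrite ev_val_mul /ev_val big_seq1 big_nil scale1r mul1r.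
Qed.

Lemma fs_mulr1 : right_id fs_one fs_mul.
Proof.
elim/cls_ind=> p; rewrite mul_cls; apply/clsP; split=> [w w'|].
  by rewrite ev_fun_mull big_seq1 scale1r.
by rewrite ev_val_mul /ev_val big_seq1 big_nil scale1r mulr1.
Qed.

Lemma fs_mulDl : left_distributive fs_mul +%R.
Proof.
elim/cls_ind=> p; elim/cls_ind=> q; elim/cls_ind=> r.
rewrite /GRing.add /= !(add_cls, mul_cls); apply/clsP; split=> [w w'|].
  by rewrite ev_fun_cat !ev_fun_mulr big_cat.
by rewrite ev_val_cat !ev_val_mul ev_val_cat mulrDl.
Qed.

Lemma fs_mulDr : right_distributive fs_mul +%R.
Proof.
elim/cls_ind=> p; elim/cls_ind=> q; elim/cls_ind=> r.
rewrite /GRing.add /= !(add_cls, mul_cls); apply/clsP; split=> [w w'|].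
  by rewrite ev_fun_cat !ev_fun_mull big_cat.
by rewrite ev_val_cat !ev_val_mul ev_val_cat mulrDr.
Qed.

Lemma fs_one_neq0 : fs_one != 0.
Proof.
apply/eqP => /clsP[_]; rewrite /ev_val big_seq1 !big_nil scale1r => /eqP.
by rewrite oner_eq0.
Qed.

HB.instance Definition _ := GRing.Zmodule_isNzRing.Build freeSym
  fs_mulA fs_mul1 fs_mulr1 fs_mulDl fs_mulDr fs_one_neq0.

Lemma fs_scaleA k l b : fs_scale k (fs_scale l b) = fs_scale (k * l) b.
Proof.
move: b; elim/cls_ind=> p; rewrite !scale_cls; apply/clsP.
by split=> [w w'|]; rewrite ?ev_fun_scale ?ev_val_scale scalerA.
Qed.

Lemma fs_scale1 : left_id 1 fs_scale.
Proof.
elim/cls_ind=> p; rewrite !scale_cls; apply/clsP.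
by split=> [w w'|]; rewrite ?ev_fun_scale ?ev_val_scale scale1r.
Qed.

Lemma fs_scaleDr : right_distributive fs_scale +%R.
Proof.
move=> k; elim/cls_ind=> p; elim/cls_ind=> q.
rewrite /GRing.add /= !(add_cls, scale_cls); apply/clsP.
by split=> [w w'|]; rewrite ?(ev_fun_scale, ev_fun_cat) ?(ev_val_scale, ev_val_cat) scalerDr.
Qed.

Lemma fs_scaleDl b : {morph fs_scale^~ b : k l / k + l}.
Proof.
move=> k l; move: b; elim/cls_ind=> p.
rewrite /= -[RHS]/(fs_add (fs_scale k (cls p)) (fs_scale l (cls p))).
rewrite !(add_cls, scale_cls); apply/clsP.
by split=> [w w'|]; rewrite ?(ev_fun_scale, ev_fun_cat) ?(ev_val_scale, ev_val_cat) scalerDl.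
Qed.

HB.instance Definition _ := GRing.Zmodule_isLmodule.Build R[i] freeSym
  fs_scaleA fs_scale1 fs_scaleDr fs_scaleDl.

Lemma fs_scaleAl k (b c : freeSym) : k *: (b * c) = k *: b * c.
Proof.
rewrite -[LHS]/(fs_scale k (fs_mul b c)) -[RHS]/(fs_mul (fs_scale k b) c).
move: b c; elim/cls_ind=> p; elim/cls_ind=> q.
rewrite !(mul_cls, scale_cls); apply/clsP; split=> [w w'|].
  rewrite ev_fun_scale !ev_fun_mull scaler_sumr; apply: eq_bigr => z _.
  by rewrite ev_fun_scale !scalerA mulrC.
by rewrite ev_val_scale !ev_val_mul ev_val_scale scalerAl.
Qed.

HB.instance Definition _ :=
  GRing.Lmodule_isLalgebra.Build R[i] freeSym fs_scaleAl.

Lemma fs_scaleAr k (b c : freeSym) : k *: (b * c) = b * (k *: c).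
Proof.
rewrite -[LHS]/(fs_scale k (fs_mul b c)) -[RHS]/(fs_mul b (fs_scale k c)).
move: b c; elim/cls_ind=> p; elim/cls_ind=> q.
rewrite !(mul_cls, scale_cls); apply/clsP; split=> [w w'|].
  rewrite ev_fun_scale !ev_fun_mulr scaler_sumr; apply: eq_bigr => z _.
  by rewrite ev_fun_scale !scalerA mulrC.
by rewrite ev_val_scale !ev_val_mul ev_val_scale scalerAr.
Qed.

HB.instance Definition _ :=
  GRing.Lalgebra_isAlgebra.Build R[i] freeSym fs_scaleAr.

Lemma fs_starK (b : freeSym) : fs_star (fs_star b) = b.
Proof.
move: b; elim/cls_ind=> p; rewrite !star_cls; congr cls.
rewrite /pstar -map_comp -[RHS]map_id; apply: eq_map => -[k w] /=.
by rewrite conjCK rev_starK.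
Qed.

Lemma fs_starD (b c : freeSym) : fs_star (b + c) = fs_star b + fs_star c.
Proof.
rewrite -[RHS]/(fs_add _ _) -[b + c]/(fs_add b c).
move: b c; elim/cls_ind=> p; elim/cls_ind=> q.
by rewrite !(add_cls, star_cls) /pstar map_cat.
Qed.

Lemma fs_starZ k (b : freeSym) : fs_star (k *: b) = k^* *: fs_star b.
Proof.
rewrite -[RHS]/(fs_scale _ _) -[k *: b]/(fs_scale k b).
move: b; elim/cls_ind=> p; rewrite !(scale_cls, star_cls); congr cls.
rewrite /pstar /pscale -!map_comp; apply: eq_map => -[l w] /=.
by rewrite rmorphM.
Qed.

Lemma fs_starM (b c : freeSym) : fs_star (b * c) = fs_star c * fs_star b.
Proof.
rewrite -[RHS]/(fs_mul _ _) -[b * c]/(fs_mul b c).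
move: b c; elim/cls_ind=> p; elim/cls_ind=> q.
rewrite !(mul_cls, star_cls); apply/clsP; split=> [w w'|].
  rewrite ev_fun_star ev_fun_mull star_sum ev_fun_mulr big_map.
  by apply: eq_bigr => z _; rewrite starZ /= ev_fun_star glue_star rev_starK.
by rewrite ev_val_star !ev_val_mul starM !ev_val_star.
Qed.

HB.instance Definition _ := hasStar.Build R[i] freeSym
  fs_starK fs_starD fs_starZ fs_starM.

End Model.

(** * The embedding of A and the freeness of the symmetry *)

Section Embedding.
Variables (R : realType) (D : starAlgType R[i]) (A : dprobSpace D).
Implicit Types (p q : fpoly A) (w m : seq A) (x y : A) (b : freeSym A).

Definition mono (m : seq A) : freeSym A := cls [:: (1, m)].

Lemma mono_eq m m' : (forall w w', Phi (wglue w (wglue m w')) = Phi (wglue w (wglue m' w'))) ->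
  \prod_(x <- m) x = \prod_(x <- m') x -> mono m = mono m'.
Proof.
move=> E1 E2; apply/clsP; split=> [w w'|]; first by rewrite /ev_fun !big_seq1 /= E1.
by rewrite /ev_val !big_seq1 /= E2.
Qed.

Lemma mono_mul m m' : mono m * mono m' = mono (wglue m m').
Proof. by rewrite -[LHS]/(fs_mul _ _) mul_cls /pmul /= mulr1. Qed.

Lemma mono_star m : star (mono m) = mono (rev (map star m)).
Proof. by rewrite -[LHS]/(fs_star _) star_cls /pstar /= rmorph1. Qed.

Definition emb x : freeSym A := mono [:: x].

Lemma emb_linear : linear emb.
Proof.
move=> k x y; rewrite -[RHS]/(fs_add (fs_scale k _) _) scale_cls add_cls.
apply/clsP; split=> [w w'|].
  rewrite ev_fun_cat ev_fun_scale /ev_fun !big_seq1 /= !scale1r.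
  have [p [l [r [q [E _ _]]]]] := glue_context w w'; rewrite !E.
  have -> : l * (k *: x + y) * r = k *: (l * x * r) + l * y * r.
    by rewrite mulrDr mulrDl -scalerAr -scalerAl.
  exact: Phi_linear.
by rewrite ev_val_cat ev_val_scale /ev_val !big_seq1 /= !scale1r.
Qed.

HB.instance Definition _ := GRing.isLinear.Build R[i] A (freeSym A) *:%R emb emb_linear.

Lemma emb1 : emb 1 = 1.
Proof.
apply: mono_eq; last by rewrite big_seq1 big_nil.
move=> w w'; have [p [l [r [q [E _ E']]]]] := glue_context w w'.
by rewrite E mulr1 E'.
Qed.

Lemma embM : {morph emb : x y / x * y}.
Proof. by move=> x y; rewrite /emb mono_mul. Qed.

HB.instance Definition _ := GRing.isMonoidMorphism.Build A (freeSym A) emb (emb1, embM).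

Lemma emb_star x : emb (star x) = star (emb x).
Proof. by rewrite /emb mono_star. Qed.

Definition fs_exp b : D := (fs_val b).1 [::] [::].

Lemma fs_exp_cls p : fs_exp (cls p) = ev_fun p [::] [::]. Proof. by []. Qed.

Lemma fs_exp_mono m : fs_exp (mono m) = Phi m.
Proof. by rewrite fs_exp_cls /ev_fun big_seq1 scale1r glues0. Qed.

Lemma fs_exp_linear : linear fs_exp.
Proof.
move=> k; elim/cls_ind=> p; elim/cls_ind=> q.
rewrite -[_ + cls q]/(fs_add (fs_scale k _) _) scale_cls add_cls.
by rewrite !fs_exp_cls ev_fun_cat ev_fun_scale.
Qed.

HB.instance Definition _ := GRing.isLinear.Build R[i] (freeSym A) D *:%R fs_exp fs_exp_linear.

Lemma fs_exp1 : fs_exp 1 = 1.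
Proof. exact: fs_exp_mono. Qed.

Definition fs_incl : D -> freeSym A := emb \o dincl A.
HB.instance Definition _ := GRing.LRMorphism.on fs_incl.

Lemma fs_incl_star : star_morphism fs_incl.
Proof. by move=> d; rewrite /fs_incl /= dincl_star emb_star. Qed.

Lemma fs_expM d1 b d2 : fs_exp (fs_incl d1 * b * fs_incl d2) = d1 * fs_exp b * d2.
Proof.
move: b; elim/cls_ind=> p.
rewrite -[_ * _ * _]/(fs_mul (fs_mul (cls _) _) (cls _)) !mul_cls !fs_exp_cls.
rewrite ev_fun_mull big_seq1 scale1r ev_fun_mulr big_seq1 scale1r.
rewrite /ev_fun mulr_sumr mulr_suml; apply: eq_bigr => z _.
by rewrite /= -[_ :: _]cat0s glues0 Phi_gluel Phi_gluer -scalerAr -scalerAl mulrA.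
Qed.

Lemma fs_exp_star : star_morphism fs_exp.
Proof.
elim/cls_ind=> p; rewrite -[star _]/(fs_star _) star_cls !fs_exp_cls.
by rewrite ev_fun_star.
Qed.

Definition fs_space : dprobSpace D :=
  DProbSpace fs_incl_star fs_exp1 fs_expM fs_exp_star.

Local Notation B := fs_space.

Definition sym : B := mono [:: 1; 1].

Lemma sym_star : star sym = sym.
Proof. by rewrite /sym mono_star /= star1. Qed.

Lemma sym_comm d : sym * dincl B d = dincl B d * sym.
Proof.
rewrite /sym -[dincl B d]/(mono [:: dincl A d]) !mono_mul /= mul1r mulr1.
apply: mono_eq; last by rewrite !big_cons !big_nil !mulr1 mul1r.
move=> w w'; have [p [l [r [q [_ E _]]]]] := glue_context w w'.
rewrite (E 1 [::]) (E (dincl A d) [::]) /= mul1r mulr1.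
by rewrite Phi_balanced.
Qed.

Lemma sym_sqr : sym * sym = 1.
Proof.
rewrite /sym mono_mul /= mulr1; apply: mono_eq.
  move=> w w'; have [p [l [r [q [_ E E']]]]] := glue_context w w'.
  rewrite (E 1 [:: 1]) E' /= mul1r mulr1 -(rmorph1 (dincl A)) Phi_merge.
  by rewrite rmorph1 mulr1.
by rewrite !big_cons !big_nil !mulr1.
Qed.

Lemma sym_mean : cexp B sym = 0.
Proof.
rewrite -[LHS]/(fs_exp _) fs_exp_mono.
by rewrite (@Phi_vanish _ _ _ 1 [::] 1).
Qed.

Lemma sym_expn k : sym ^+ k = if odd k then sym else 1.
Proof.
elim: k => [//|k IHk]; rewrite exprS IHk /=; case: odd; rewrite /= ?mulr1 //.
exact: sym_sqr.
Qed.

Lemma sym_scalar : scalar_rv sym.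
Proof.
split; rewrite ?sym_star //; [exact: sym_comm|exact: sym_comm|move=> k l].
rewrite -exprD sym_expn; case: odd.
  by exists 0; rewrite sym_mean scale0r.
by exists 1; rewrite cexp1 scale1r.
Qed.

(** Injectivity comes from the component where u is set to 1, which returns x itself. *)
Lemma emb_enlargement : @enlargement _ _ A B emb.
Proof.
split=> // [x y /clsP[_]|x|x]; first by rewrite /ev_val !big_seq1 /= !scale1r.
  exact: emb_star.
by rewrite -[LHS]/(fs_exp _) fs_exp_mono.
Qed.

Section Freeness.
Variable a : A.

Lemma side_emb (z : B) :
  side [set (emb a : B); star (emb a : B)]%classic [set sym; star sym]%classic true z ->
  exists x, z = emb x.
Proof.
elim=> [x|| x y _ [x' ->] _ [y' ->]|c x _ [x' ->]|x y _ [x' ->] _ [y' ->]].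
- case=> [[->|->]|[d _ <-]]; first by exists a.
    by exists (star a); rewrite emb_star.
  by exists (dincl A d).
- by exists 1; rewrite emb1.
- by exists (x' + y'); rewrite raddfD.
- by exists (c *: x'); rewrite linearZ.
- by exists (x' * y'); rewrite embM.
Qed.

(** The sums D + D u are closed under products since u commutes with D and squares to 1. *)
Lemma side_sym (z : B) :
  side [set (emb a : B); star (emb a : B)]%classic [set sym; star sym]%classic false z ->
  exists d e, z = dincl B d + dincl B e * sym.
Proof.
elim=> [x|| x y _ [d [e ->]] _ [d' [e' ->]]|c x _ [d [e ->]]|
  x y _ [d [e ->]] _ [d' [e' ->]]].
- rewrite sym_star => -[xs|[d _ <-]]; last first.
    by exists d, 0; rewrite rmorph0 mul0r addr0.
  have -> : x = sym by case: xs.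
  by exists 0, 1; rewrite rmorph0 rmorph1 mul1r add0r.
- by exists 1, 0; rewrite rmorph0 mul0r addr0 rmorph1.
- by exists (d + d'), (e + e'); rewrite !rmorphD mulrDl addrACA.
- by exists (c *: d), (c *: e); rewrite !linearZ /= scalerDr -scalerAl.
exists (d * d' + e * e'), (d * e' + e * d').
rewrite mulrDl !mulrDr !rmorphD !rmorphM mulrDl !mulrA.
rewrite -(mulrA (dincl B e) sym) sym_comm !mulrA.
rewrite -(mulrA (dincl B e) sym) sym_comm !mulrA -(mulrA _ sym) sym_sqr mulr1.
rewrite -!addrA; congr (_ + _); rewrite [RHS]addrCA; congr (_ + _).
by rewrite addrC.
Qed.

Lemma side_sym_centered (z : B) :
  side [set (emb a : B); star (emb a : B)]%classic [set sym; star sym]%classic false z ->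
  cexp B z = 0 -> exists d, z = mono [:: dincl A d; 1].
Proof.
move=> /side_sym[d [e ->]].
have -> : cexp B (dincl B d + dincl B e * sym) =
    cexp B (dincl B d) + cexp B (dincl B e * sym) by apply: linearD.
rewrite cexpMl sym_mean mulr0 addr0 dinclK => ->; exists e; rewrite rmorph0 add0r.
by rewrite -[dincl B e]/(mono [:: dincl A e]) mono_mul /= mulr1.
Qed.

(** An alternating product of centered elements is a single word whose inner letters are all
    centered, so [Phi_vanish] applies; a single letter from A is itself centered. *)
Lemma sym_free : @free_pair _ _ B [set (emb a : B); star (emb a : B)]%classic
  [set sym; star sym]%classic.
Proof.
move=> [//|n] s x _ h1 h2.
(* After a factor from the side of u the word ends in [1], the empty place behind the trailing u. If
   the last factor is from the side of A, its letter is the last one of [y :: m], and [c] covers a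
   word of one letter. *)
suff [y [m [em [E c]]]] : exists y m, (forall z, z \in m -> cexp A z = 0) /\
    (\prod_(j < n.+1) x j = mono (if s n then y :: m else y :: rcons m 1) /\
    (s n -> m = [::] -> cexp A y = 0)).
  rewrite E -[LHS]/(fs_exp _) fs_exp_mono; case: (s n) c => [c|_]; last first.
    exact: Phi_vanish.
  case/lastP: m em {E} c => [_ c|m y' em _]; first exact: c.
  by apply: Phi_vanish => z zm; apply: em; rewrite mem_rcons inE zm orbT.
elim: n h1 h2 => [|n IHn] h1 h2.
  rewrite big_ord1; have [gx ex] := h1 0%N isT.
  case: (s 0%N) gx => gx.
    have [y yE] := side_emb gx; exists y, [::]; rewrite yE; split=> //; split=> // _ _.
    by rewrite -ex yE -[RHS]/(fs_exp _) fs_exp_mono.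
  have [d dE] := side_sym_centered gx ex; exists (dincl A d), [::].
  by rewrite dE.
have [||y [m [em [E c]]]] := IHn.
- by move=> j jn; apply: h1; apply: ltnW.
- by move=> j jn; apply: h2; apply: ltnW.
rewrite big_ord_recr /= E; have [gx ex] := h1 n.+1 (ltnSn _).
have sn : s n.+1 = ~~ s n by have := h2 n (ltnSn _); case: (s n); case: (s n.+1).
rewrite sn in gx *; case: (s n) gx E c => gx E c.
  (* The new factor is d u: the last letter is multiplied by d, which keeps it centered, and becomes
     interior unless it is the first letter. *)
  have [d ->] := side_sym_centered gx ex; rewrite mono_mul.
  case/lastP: m em {E} c => [_ c|m y' em _].
    by exists (y * dincl A d), [::].
  exists y, (rcons m (y' * dincl A d)); split; last first.
    by rewrite -rcons_cons glue_rcons_cons /= -cats1 -cat_rcons.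
  move=> z; rewrite mem_rcons inE => /orP[/eqP->|zm].
    by rewrite cexpMr em ?mul0r // mem_rcons mem_head.
  by apply: em; rewrite mem_rcons inE zm orbT.
(* The new factor from A takes the place of the trailing [1]. *)
have [y' y'E] := side_emb gx.
have ey' : cexp A y' = 0.
  by rewrite -ex y'E -[RHS]/(fs_exp _) fs_exp_mono.
exists y, (rcons m y'); split.
  by move=> z; rewrite mem_rcons inE => /orP[/eqP->//|]; apply: em.
split; last by case: (m).
by rewrite y'E mono_mul -rcons_cons glue_rcons_cons mul1r cats1.
Qed.

End Freeness.
End Embedding.

Lemma free_symmetry_exists (R : realType) (D : starAlgType R[i]) (A : dprobSpace D)
    (a : A) :
  exists (B : dprobSpace D) (j : {lrmorphism A -> B}) (u : B),
    [/\ enlargement j, scalar_rv u, unitary u, cexp B u = 0 &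
      free_pair [set j a; star (j a)]%classic [set u; star u]%classic].
Proof.
exists (fs_space A), (@emb R D A), (sym A); split.
- exact: emb_enlargement.
- exact: sym_scalar.
- by split; rewrite sym_star sym_sqr.
- exact: sym_mean.
- exact: sym_free.
Qed.

(** * The equivalence of the four conditions *)

Section Equivalence.
Variables (R : realType) (D : starAlgType R[i]) (A : dprobSpace D) (a : A).

Lemma cumulants_of_vanishing : vanishing_cumulants a ->
  forall n (s : nat -> bool) (d : nat -> D), (0 < n)%N -> ~ alternating n s ->
  cumulant [seq dincl A (d k) * spow a (s k) | k <- iota 0 n] = 0.
Proof.
move=> kV n s d n0 nalt; apply: (kV _ (map s (iota 0 n))).
  elim: (iota 0 n) => [//|k l IHl] /=; split=> //.
  by exists (d k), 1; rewrite rmorph1 mulr1.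
apply/negP => /andP[/is_altP[b [k sE]] ev]; apply: nalt.
rewrite size_map size_iota in ev; split=> //; exists b => i lt_i.
have nk : n = k by rewrite -(size_iota 0 n) -(size_map s) sE size_altl.
have := @nth_altl b k true i; rewrite -sE -nk => /(_ lt_i) <-.
by rewrite (nth_map 0%N) ?size_iota // nth_iota.
Qed.

Lemma rotation_enlargement (B : dprobSpace D) (j : {lrmorphism A -> B}) (u : B) :
  vanishing_chains a -> enlargement j -> scalar_rv u -> unitary u ->
  free_pair [set j a; star (j a)]%classic [set u; star u]%classic ->
  same_ddistr (j a) (u * j a).
Proof.
move=> V enl rv un fr; apply: vanishing_rotation => //.
exact: (enl_chains a enl).1.
Qed.

Lemma enlargement_vanishing (B : dprobSpace D) (j : {lrmorphism A -> B}) (u : B)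
    (alpha : R[i]) :
  enlargement j -> scalar_rv u -> unitary u ->
  free_pair [set j a; star (j a)]%classic [set u; star u]%classic ->
  cexp B u = alpha%:A -> `|alpha| < 1 -> same_ddistr (j a) (u * j a) ->
  vanishing_chains a.
Proof.
move=> enl rv un fr um a1 hd; apply: (enl_chains a enl).2.
exact: (rotation_vanishing rv un fr um a1 hd).
Qed.

End Equivalence.

Local Open Scope classical_set_scope.
Local Open Scope ring_scope.

Theorem mainTheorem3 (R : realType) (D : starAlgType R[i])
    (A : dprobSpace D) (a : A) :
  [<->
    (* (1) *)
    forall (n : nat) (i : nat -> bool) (x : nat -> A), (0 < n)%N ->
      (forall k, (k < n)%N -> Pmx a (i k) (i k.+1) (x k)) ->
      cexp A (\prod_(k < n) x k) = 0;
    (* (2) *)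
    forall (n : nat) (s : nat -> bool) (d : nat -> D), (0 < n)%N ->
      ~ alternating n s ->
      cumulant [seq dincl A (d k) * spow a (s k) | k <- iota 0 n] = 0;
    (* (3) *)
    exists (B : dprobSpace D) (j : {lrmorphism A -> B}) (u : B),
      [/\ enlargement j, scalar_rv u & unitary u] /\
      [/\ free_pair [set j a; star (j a)] [set u; star u],
          exists2 alpha : R[i], cexp B u = alpha%:A & `|alpha| < 1
        & same_ddistr (j a) (u * j a)];
    (* (4) *)
    forall (B : dprobSpace D) (j : {lrmorphism A -> B}) (u : B),
      enlargement j -> scalar_rv u -> unitary u ->
      free_pair [set j a; star (j a)] [set u; star u] ->
      same_ddistr (j a) (u * j a)].
Proof.
tfae.
- move=> /chainP V; apply: cumulants_of_vanishing.
  exact: vanishing_chains_cumulants.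
- move=> kV; have V := vanishing_cumulants_chains (cumulant_letters kV).
  have [B [j [u [enl rv un um fr]]]] := free_symmetry_exists a.
  exists B, j, u; split=> //; split=> //; last exact: rotation_enlargement.
  by exists 0; rewrite ?normr0 ?ltr01 // scale0r.
- move=> [B [j [u [[enl rv un] [fr [alpha um a1] hd]]]]].
  have V := enlargement_vanishing enl rv un fr um a1 hd.
  by move=> B' j' u'; apply: rotation_enlargement.
(* The free symmetry is admissible in (4), and its mean 0 is small enough to return from invariance
   to (1). *)
- move=> h4; apply/chainP.
  have [B [j [u [enl rv un um fr]]]] := free_symmetry_exists a.
  apply: (enlargement_vanishing enl rv un fr (alpha := 0)); last exact: h4.
    by rewrite scale0r.
  by rewrite normr0 ltr01.
Qed.
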